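(* Let $v>0$ and consider the system $$\ddot x+v\,x=\int\kappa(\nu)\,\xi(\nu,t)\,d\nu,\qquad \rho\,(\ddot\xi+\nu^2\xi)=\kappa\,x,\qquad x(t)\in\mathbb{R},$$ with initial values $x|_{t=0}=x_0$, $\xi|_{t=0}=\xi_0(\nu)$, $\dot x|_{t=0}=\dot x_0$, $\dot\xi|_{t=0}=\dot\xi_0(\nu)$ (a linear one-dimensional oscillator interacting with a thermostat). Suppose that hypotheses (i)–(v) and hypothesis (T) of the context hold, and that $\hat w_\diamond^\pm(\nu_0)>v$. Let $\lambda_0\in(0,\nu_0)$ be the zero on $[0,\nu_0]$ of the function $\hat\Phi^\pm(\nu)=-\nu^2+v-\hat w_\diamond^\pm(\nu)$. Then, for a solution $x(t),\xi(\nu,t)$, $t\in\mathbb{R}$, of finite constant energy, there exist $\alpha\in\mathbb{C}$ and $\vartheta\in\mathcal{C}_0$ such that $\psi(t)=x(t)$ satisfies $$\psi(t)=\alpha e^{i\lambda_0t}+\overline\alpha e^{-i\lambda_0t}+\vartheta(t).$$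
   Context: $\int$ means $\int_{-\infty}^{+\infty}$. $\rho,\kappa,\xi_0,\dot\xi_0$ are real functions of $\nu\in\mathbb{R}$; $\xi(\nu,t)$ is real; $\kappa/\sqrt\rho$ is extended by zero to $\mathbb{R}\setminus\operatorname{supp}\rho$. Energy: $E=\frac12\dot x^2+\frac12\int\rho\dot\xi^2d\nu+\frac12 vx^2+\frac12\int\rho\nu^2\xi^2d\nu-x\int\kappa\xi\,d\nu$. Spaces. $\mathcal{C}_b$: bounded uniformly continuous functions $\mathbb{R}\to\mathbb{C}$. $\mathcal{C}_0\subset\mathcal{C}_b$: those tending to zero at both $+\infty$ and $-\infty$. $\mathcal{M}$: finite complex Radon measures on $\mathbb{R}$ (identified with densities, as distributions). $\mathcal{F}(\psi)=\hat\psi(\lambda)=\int e^{-i\lambda\tau}\psi(\tau)\,d\tau$ (in the sense of distributions), $\hat{\mathcal{M}}=\mathcal{F}(\mathcal{M})$. Thermostat data. $\hat a(\nu)=\kappa(\nu)/\sqrt{\rho(\nu)}$, $\hat w(\nu)=\frac{2\pi\hat a^2(\nu)}{i\nu}$, $\sigma=\{s:\hat a(s)\ne0\}$, $w=\mathcal{F}^{-1}(\hat w)$ (which lies in $L_1$ under (v)). $w_\diamond^\pm(\tau)=\pm\frac12(w(\tau)-w(-\tau))$ if $\pm\tau>0$ and $w_\diamond^\pm(\tau)=0$ if $\pm\tau<0$; $\hat w_\diamond^\pm=\mathcal{F}(w_\diamond^\pm)$; these are $C^1$ and $\hat w_\diamond^\pm(0)=K$. Under (T), $\hat\Phi^+=\hat\Phi^-$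 on $[-\nu_0,\nu_0]$, and this function is real, even, decreasing on $[0,\nu_0]$, with $\hat\Phi^\pm(0)=v-K>0$. Hypotheses: (i) $\rho\ge0$ and $\operatorname{supp}\kappa\subset\operatorname{supp}\rho$. (ii) $\int\frac{\kappa^2}{\rho}\,d\nu$ and $K:=\int\frac{\kappa^2}{\rho\nu^2}\,d\nu$ are finite. (iii) $v-K>0$. (iv) $\int\rho\,(\dot\xi_0^2+\nu^2\xi_0^2)\,d\nu<\infty$. (v) $\hat a$ and $\hat a'=d\hat a/d\nu$ belong to $\hat{\mathcal{M}}$, and $\hat a(0)=\hat w(0)=0$. (T) There is a constant $\nu_0\ge0$ such that: (a) $\hat a(\nu)$ vanishes for $|\nu|\le\nu_0$ and is positive for $|\nu|>\nu_0$; (b) $\sigma=\{\nu\in\mathbb{R}:|\nu|>\nu_0\}$; (c) the restrictions of $\hat w_\diamond^+$ and $\hat w_\diamond^-$ to $[-\nu_0,\nu_0]$ are equal to each other, real, even, and increasing on $[0,\nu_0]$. *)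

(* Defs.v *)
(* MathComp-Analysis, with complex numbers R[i] over an arbitrary realType R. *)
From HB Require Import structures.
From mathcomp Require Import all_boot all_order all_algebra.
From mathcomp Require Import complex.
From mathcomp Require Import all_classical all_reals all_analysis.

Set Implicit Arguments.
Unset Strict Implicit.
Unset Printing Implicit Defensive.

Import Order.TTheory GRing.Theory Num.Theory.
Import numFieldNormedType.Exports.

Local Open Scope classical_set_scope.
Local Open Scope ring_scope.

Section ComplexFourier.
Variable R : realType.

Definition expi (y : R) : R[i] := (cos y +i* sin y)%C.

Definition cintegral d (T : measurableType d) (m : {measure set T -> \bar R})
    (f : T -> R[i]) : R[i] :=
  ((\int[m]_t complex.Re (f t)) +i* (\int[m]_t complex.Im (f t)))%C.

Definition fourier (f : R -> R[i]) (lambda : R) : R[i] :=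
  cintegral (@lebesgue_measure R) (fun tau => expi (- (lambda * tau)) * f tau).

(* The normalisation is forced by the convention for [fourier]; on integrable
   functions the distributional inverse transform is this integral. *)
Definition inv_fourier (f : R -> R[i]) (tau : R) : R[i] :=
  ((2 * pi)^-1)%:C%C *
  cintegral (@lebesgue_measure R) (fun lambda => expi (lambda * tau) * f lambda).

Definition fourier_measure (m : {finite_measure set (measurableTypeR R) -> \bar R})
    (lambda : R) : R[i] :=
  cintegral m (fun tau : R => expi (- (lambda * tau))).

(* A finite complex Radon measure on the line is written
   (mu1 - mu2) + i (mu3 - mu4) with finite positive Borel measures (on the line
   these are automatically Radon); its distributional Fourier transform is the
   function below. *)
Definition in_hatM (f : R -> R[i]) : Prop :=
  exists mu1 mu2 mu3 mu4 : {finite_measure set (measurableTypeR R) -> \bar R},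
    forall lambda,
      f lambda = (fourier_measure mu1 lambda - fourier_measure mu2 lambda)
        + 'i%C * (fourier_measure mu3 lambda - fourier_measure mu4 lambda).

(* [R[i]^o] is R[i] with the normed-module structure given by the modulus. *)
Definition in_Cb (f : R -> (R[i])^o) : Prop :=
  bounded_fun f /\ unif_continuous f.

Definition in_C0 (f : R -> (R[i])^o) : Prop :=
  [/\ in_Cb f, f t @[t --> +oo] --> (0 : (R[i])^o)
    & f t @[t --> -oo] --> (0 : (R[i])^o)].

Definition supp (f : R -> R) : set R := closure [set nu | f nu != 0].

End ComplexFourier.

Section Thermostat.
Variable R : realType.
Variables rho kappa : R -> R.

Local Notation mu := (@lebesgue_measure R).

(* Since x / 0 = 0 in R, this is already extended by zero off {rho != 0}. *)
Definition ahat (nu : R) : R := kappa nu / Num.sqrt (rho nu).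

(* In \bar R one has c / 0 = +oo for c > 0 and 0 / 0 = 0, so a finite integral
   forces kappa = 0 almost everywhere on {rho = 0}. *)
Definition int_kappa2_rho : \bar R :=
  (\int[mu]_nu ((kappa nu ^+ 2)%:E / (rho nu)%:E))%E.

Definition eK : \bar R :=
  (\int[mu]_nu ((kappa nu ^+ 2)%:E / (rho nu * nu ^+ 2)%:E))%E.

Definition K : R := fine eK.

(* At nu = 0 the quotient evaluates to 0. *)
Definition what (nu : R) : R[i] :=
  ((2 * pi * ahat nu ^+ 2)%:C / ('i * nu%:C))%C.

Definition sigma : set R := [set s | ahat s != 0].

(* [what] is integrable as soon as int_kappa2_rho and eK are finite. *)
Definition w : R -> R[i] := inv_fourier what.

Definition wplus (tau : R) : R[i] :=
  if 0 < tau then 2^-1 * (w tau - w (- tau)) else 0.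

Definition wminus (tau : R) : R[i] :=
  if tau < 0 then - (2^-1 * (w tau - w (- tau))) else 0.

Definition hat_wplus : R -> R[i] := fourier wplus.
Definition hat_wminus : R -> R[i] := fourier wminus.

Definition hat_Phiplus (v nu : R) : R[i] := (- nu ^+ 2 + v)%:C%C - hat_wplus nu.
Definition hat_Phiminus (v nu : R) : R[i] := (- nu ^+ 2 + v)%:C%C - hat_wminus nu.

(* [in_hatM] is a pointwise equality, so ahat is continuous, and having its
   distributional derivative in hatM amounts to being differentiable with
   derivative in hatM. The fourth conjunct is "what(0) = 0", read for the
   continuous extension of what: the literal value at 0 is a division by zero. *)
Definition fourier_regular : Prop :=
  [/\ in_hatM (fun nu => (ahat nu)%:C%C),
      forall nu, derivable ahat nu 1,
      in_hatM (fun nu => (derive1 ahat nu)%:C%C),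
      what nu @[nu --> 0^'] --> (0 : (R[i])^o)
    & ahat 0 = 0].

(* In R[i], z <= z' means that z' - z is a nonnegative real. Increasing is only
   required in the weak sense, which also covers the strict one. *)
Definition transparency_gap (nu0 : R) : Prop :=
  [/\ 0 <= nu0,
      forall nu, `|nu| <= nu0 -> ahat nu = 0,
      forall nu, nu0 < `|nu| -> 0 < ahat nu,
      sigma = [set nu | nu0 < `|nu|]
    & [/\ forall nu, `|nu| <= nu0 -> hat_wplus nu = hat_wminus nu,
          forall nu, `|nu| <= nu0 -> complex.Im (hat_wplus nu) = 0,
          forall nu, `|nu| <= nu0 -> hat_wplus (- nu) = hat_wplus nu
        & forall nu nu', 0 <= nu -> nu <= nu' -> nu' <= nu0 ->
            hat_wplus nu <= hat_wplus nu']].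

(* [xi nu] is the trajectory of the oscillator of frequency nu; the exceptional
   null set of frequencies does not depend on the time. *)
Definition solution (v x0 dx0 : R) (xi0 dxi0 : R -> R)
    (x : R -> R) (xi : R -> R -> R) : Prop :=
  [/\ forall t, derivable x t 1 /\ derivable (derive1 x) t 1,
      forall t, mu.-integrable setT (EFin \o (fun nu => kappa nu * xi nu t)),
      forall t, derive1 (derive1 x) t + v * x t = \int[mu]_nu (kappa nu * xi nu t),
      {ae mu, forall nu,
         [/\ forall t, derivable (xi nu) t 1 /\ derivable (derive1 (xi nu)) t 1,
             forall t, rho nu * (derive1 (derive1 (xi nu)) t + nu ^+ 2 * xi nu t)
                       = kappa nu * x t,
             xi nu 0 = xi0 nu
           & derive1 (xi nu) 0 = dxi0 nu]}
    & x 0 = x0 /\ derive1 x 0 = dx0].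

Definition energy (v : R) (x : R -> R) (xi : R -> R -> R) (t : R) : R :=
  2^-1 * derive1 x t ^+ 2
  + 2^-1 * (\int[mu]_nu (rho nu * derive1 (xi nu) t ^+ 2))
  + 2^-1 * v * x t ^+ 2
  + 2^-1 * (\int[mu]_nu (rho nu * nu ^+ 2 * xi nu t ^+ 2))
  - x t * \int[mu]_nu (kappa nu * xi nu t).

Definition finite_energy (x : R -> R) (xi : R -> R -> R) (t : R) : Prop :=
  [/\ mu.-integrable setT (EFin \o (fun nu => rho nu * derive1 (xi nu) t ^+ 2)),
      mu.-integrable setT (EFin \o (fun nu => rho nu * nu ^+ 2 * xi nu t ^+ 2))
    & mu.-integrable setT (EFin \o (fun nu => kappa nu * xi nu t))].

Definition finite_constant_energy (v : R) (x : R -> R) (xi : R -> R -> R) : Prop :=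
  (forall t, finite_energy x xi t) /\
  exists E, forall t, energy v x xi t = E.

End Thermostat.

(* Main.v *)
Require Import Defs.
From mathcomp Require Import all_boot all_order all_algebra.
From mathcomp Require Import complex ring lra.
From mathcomp Require Import all_classical all_reals all_analysis.
From mathcomp Require Import measurable_realfun lebesgue_integral_under.

Set Implicit Arguments.
Unset Strict Implicit.
Unset Printing Implicit Defensive.
Import Order.TTheory GRing.Theory Num.Theory.
Import numFieldNormedType.Exports.
Local Open Scope classical_set_scope.
Local Open Scope ring_scope.

(** Write [a] for [ahat] and y(nu,t) = sqrt(rho(nu)) xi(nu,t). The system becomes

        x'' + v x = int a y dnu,        y'' + nu^2 y = a x,

    a single oscillator coupled to a continuum of oscillators whose frequencies
    fill |nu| >= nu0, since [a] vanishes on [-nu0, nu0]. Put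
    c(nu) = a(nu) / (nu^2 - l0^2) with l0 the given zero in (0, nu0). The vector
    (1, c) is an eigenvector of the coupled system with frequency l0 as soon as
    v - l0^2 = int a c dnu, and this is what the vanishing of hat_Phi at l0 says
    ([Re_hat_wplus], [self_energyE]). As the coupling is symmetric, the
    projection p = x + int c y dnu satisfies p'' = - l0^2 p exactly: this is the
    oscillation that persists. With P = p / (1 + int c^2 dnu), the remainder
    X = x - P, Y = y - c P solves the same driven equation and is orthogonal to
    the eigenvector, int c Y dnu = - X ([trapped_mode_decomposition]).

    It remains to see that X tends to 0. Finite energy together with v - K > 0
    makes x and x' bounded ([energy_coercive]), so X is bounded and Lipschitz,
    and it suffices that X is square integrable on the half line
    ([lipschitz_L2_cvg0]). Solving for Y by Duhamel's formula and inserting the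
    result in the orthogonality relation gives a Volterra equation
    X + q * X = f, where q(t) = int a(nu) c(nu) / nu sin(nu t) dnu and f is a
    sum of transforms of square integrable data, hence square integrable
    ([model_decay], [volterra_decay]). Because [a] vanishes near the
    singularities 0, l0, - l0 of the weights and [a], a' are bounded and
    continuous, q is integrable ([gap_kernel_L1]).

    The equation is solved with the Fourier transform, on damped functions since
    X is only known to be bounded. What has to be excluded is a zero of
    1 + qhat on the real axis, where qhat is the half-line transform of q
    ([dispersion_lower]). For 0 <= l <= nu0 the real part is at least 1, for
    l > nu0 the imaginary part is a nonzero multiple of a(l)^2 + a(-l)^2, and for
    large l a resolvent identity shows that the real part of qhat is small. So the
    modulus of 1 + qhat is bounded below, uniformly in a small damping, and
    Plancherel's theorem bounds the square norm of the damped X uniformly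
    ([volterra_L2]). The two Plancherel inequalities on the half line that this
    uses are obtained by inserting e^(-et) and recognising the Poisson kernel.
    Reversing time gives the limit at - infinity. *)

(** * Integrable functions on the line *)

(** Without its [discriminate] step, which would evaluate both sides of every
    equation between integrals in the context. *)
Ltac done ::=
  trivial; hnf; intros; solve
  [ do ![solve [trivial | simple refine (@sym_equal _ _ _ _); trivial]
      | contradiction | split]
  | match goal with H : ~ _ |- _ => solve [case H; trivial]
               | H : is_true false |- _ => discriminate H
               | H : is_true (~~ true) |- _ => discriminate H end ].

Section L1.
Context {R : realType}.
Notation mu := (@lebesgue_measure R).
Implicit Types (D : set R) (f g u w : R -> R).

(** A wrapper that does not unfold: integrability is a pair made of
    measurability and of a bound on an integral, and unification would
    otherwise look inside both. *)
Inductive L1 D f : Prop := L1I of mu.-integrable D (EFin \o f).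

Lemma L1P D f : L1 D f -> mu.-integrable D (EFin \o f).
Proof. by case. Qed.

Lemma L1_measurable D f : L1 D f -> measurable_fun D f.
Proof. by move=> [/integrableP[/measurable_EFinP]]. Qed.

Lemma L1_le D g f : measurable D -> measurable_fun D f -> L1 D g ->
  (forall x, D x -> `|f x| <= g x) -> L1 D f.
Proof.
move=> mD mf [ig] fg; constructor; apply: le_integrable ig => //; first exact/measurable_EFinP.
by move=> x Dx /=; rewrite lee_fin (le_trans (fg _ Dx))// ler_norm.
Qed.

Lemma L1D D f g : measurable D -> L1 D f -> L1 D g -> L1 D (fun x => f x + g x).
Proof. by move=> mD [fi] [gi]; constructor; exact: (integrableD _ fi gi). Qed.

Lemma L1B D f g : measurable D -> L1 D f -> L1 D g -> L1 D (fun x => f x - g x).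
Proof. by move=> mD [fi] [gi]; constructor; exact: (integrableB _ fi gi). Qed.

Lemma L1Z D k f : measurable D -> L1 D f -> L1 D (fun x => k * f x).
Proof. by move=> mD [fi]; constructor; exact: (integrableZl _ k fi). Qed.

Lemma L1_norm D f : L1 D f -> L1 D (fun x => `|f x|).
Proof. by move=> [fi]; constructor; exact: integrable_norm. Qed.

Lemma L1_sub D E f : measurable D -> measurable E -> E `<=` D -> L1 D f -> L1 E f.
Proof. by move=> mD mE ED [fi]; constructor; exact: integrableS fi. Qed.

Lemma L1_bounded D (h f : R -> R) (M : R) : measurable D -> measurable_fun D h ->
  (forall x, D x -> `|h x| <= M) -> L1 D f -> L1 D (fun x => f x * h x).
Proof.
move=> mD mh hM fi; apply: (@L1_le _ (fun x => M * `|f x|)) => //.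
- by apply: measurable_funM => //; exact: L1_measurable.
- by apply: L1Z => //; exact: L1_norm.
- by move=> x Dx; rewrite normrM mulrC ler_wpM2r// hM.
Qed.

Lemma L1_ge0 D f : measurable_fun D f -> (forall x, D x -> 0 <= f x) ->
  (\int[mu]_(x in D) (f x)%:E < +oo)%E -> L1 D f.
Proof.
move=> mf f0 fi; constructor; apply/integrableP; split; first exact/measurable_EFinP.
apply: le_lt_trans fi; rewrite le_eqVlt; apply/orP; left; apply/eqP.
by apply: eq_integral => x /[!inE] Dx /=; rewrite ger0_norm// f0.
Qed.

Lemma L1_EFin D f : measurable D -> L1 D f ->
  (\int[mu]_(x in D) (f x)%:E = (\int[mu]_(x in D) f x)%:E)%E.
Proof. by move=> mD [fi]; rewrite fineK//; exact: integrable_fin_num. Qed.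

Lemma RintD D f g : measurable D -> L1 D f -> L1 D g ->
  \int[mu]_(x in D) (f x + g x) = \int[mu]_(x in D) f x + \int[mu]_(x in D) g x.
Proof. by move=> mD [fi] [gi]; exact: RintegralD. Qed.

Lemma RintB D f g : measurable D -> L1 D f -> L1 D g ->
  \int[mu]_(x in D) (f x - g x) = \int[mu]_(x in D) f x - \int[mu]_(x in D) g x.
Proof. by move=> mD [fi] [gi]; exact: RintegralB. Qed.

Lemma RintZl D f k : measurable D -> L1 D f ->
  \int[mu]_(x in D) (k * f x) = k * \int[mu]_(x in D) f x.
Proof. by move=> mD [fi]; exact: RintegralZl. Qed.

Lemma RintZr D f k : measurable D -> L1 D f ->
  \int[mu]_(x in D) (f x * k) = \int[mu]_(x in D) f x * k.
Proof. by move=> mD [fi]; exact: RintegralZr. Qed.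

Lemma le_Rint D f g : measurable D -> L1 D f -> L1 D g ->
  (forall x, D x -> f x <= g x) -> \int[mu]_(x in D) f x <= \int[mu]_(x in D) g x.
Proof. by move=> mD [fi] [gi] fg; exact: le_Rintegral. Qed.

Lemma le_Rint_norm D f g : measurable D -> L1 D f -> L1 D g ->
  (forall x, D x -> `|f x| <= g x) -> `|\int[mu]_(x in D) f x| <= \int[mu]_(x in D) g x.
Proof.
move=> mD fi gi fg; apply: (le_trans (le_normr_Rintegral _ _)) => //; first by case: fi.
by apply: le_Rint => //; exact: L1_norm.
Qed.

Lemma Rintegral_dominated D (f_ : nat -> R -> R) f g : measurable D ->
  (forall n, measurable_fun D (f_ n)) -> L1 D g ->
  (forall x, D x -> f_ n x @[n --> \oo] --> f x) ->
  (forall n x, D x -> `|f_ n x| <= g x) ->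
  L1 D f /\ (\int[mu]_(x in D) f_ n x @[n --> \oo] --> \int[mu]_(x in D) f x).
Proof.
move=> mD mf ig cf fg.
have mlim : measurable_fun D f by exact: (measurable_fun_cvg mf cf).
have [] := @dominated_convergence _ _ _ mu D mD
   (fun n => EFin \o f_ n) (EFin \o f) (EFin \o g) _ _ _ (L1P ig) _.
- by move=> n; apply/measurable_EFinP; exact: mf.
- by apply/measurable_EFinP; exact: mlim.
- apply: aeW => x Dx; apply: cvg_EFin; first exact: nearW.
  exact: cf.
- by apply: aeW => x n Dx /=; rewrite lee_fin fg.
move=> i1 _ i2.
split; first exact: (L1I i1).
apply: fine_cvg; rewrite -/(Rintegral _ _ _) -L1_EFin//; exact: i2.
Qed.

Lemma L1_mkcond D f : measurable D ->
  L1 D f <-> L1 setT (fun x => f x * \1_D x).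
Proof.
move=> mD; have H : mu.-integrable D (EFin \o f) <-> mu.-integrable setT (EFin \o (fun x => f x * \1_D x)).
  rewrite (_ : EFin \o (fun x => f x * \1_D x) = (EFin \o f) \_ D).
    exact: (integrable_mkcond (mu := mu) (EFin \o f) mD).
  apply/funext => x /=; rewrite patchE indicE.
  by case: ifP => _ /=; rewrite ?mulr1 ?mulr0.
by split => -[/H].
Qed.

Lemma Rintegral_mkind D f :
  \int[mu]_(x in D) f x = \int[mu]_x (f x * \1_D x).
Proof.
rewrite Rintegral_mkcond; apply: eq_Rintegral => x _; rewrite patchE indicE.
by case: ifP => _ /=; rewrite ?mulr1 ?mulr0.
Qed.

(** Domination by a product makes the integrand integrable on the product
    space, which is all that Fubini's theorem asks for. *)
Lemma Fubini_dom D1 D2 (f : R -> R -> R) u w :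
  measurable D1 -> measurable D2 ->
  measurable_fun [set: R * R] (fun z => f z.1 z.2) ->
  L1 D1 u -> L1 D2 w ->
  (forall x y, D1 x -> D2 y -> `|f x y| <= u x * w y) ->
  [/\ L1 D1 (fun x => \int[mu]_(y in D2) f x y),
      L1 D2 (fun y => \int[mu]_(x in D1) f x y) &
  \int[mu]_(x in D1) \int[mu]_(y in D2) f x y =
  \int[mu]_(y in D2) \int[mu]_(x in D1) f x y].
Proof.
move=> mD1 mD2 mf iu iw fuw.
(* extension by zero: everything then takes place on the whole plane *)
pose h (z : R * R) : R := f z.1 z.2 * (\1_D1 z.1 * \1_D2 z.2).
pose u' x := `|u x| * \1_D1 x; pose w' x := `|w x| * \1_D2 x.
have iu' : L1 setT u' by exact: ((L1_mkcond _ mD1).1 (L1_norm iu)).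
have iw' : L1 setT w' by exact: ((L1_mkcond _ mD2).1 (L1_norm iw)).
have mh : measurable_fun setT (EFin \o h).
  apply/measurable_EFinP; apply: measurable_funM => //.
  apply: measurable_funM.
    exact: (measurableT_comp (measurable_indic mD1) measurable_fst).
  exact: (measurableT_comp (measurable_indic mD2) measurable_snd).
have hle x y : `|h (x, y)| <= u' x * w' y.
  rewrite /h /= /u' /w' !indicE.
  case: (boolP (x \in D1)) => [/[!inE] Dx|_]; last by rewrite !(mul0r, mulr0) normr0.
  case: (boolP (y \in D2)) => [/[!inE] Dy|_]; last by rewrite !(mul0r, mulr0) normr0.
  by rewrite !mulr1 -normrM (le_trans (fuw _ _ Dx Dy))// ler_norm.
have ih : (mu \x mu)%E.-integrable setT (EFin \o h).
  apply/integrable12ltyP => //.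
  apply: (@le_lt_trans _ _ (\int[mu]_x (u' x * \int[mu]_y w' y)%:E)%E).
    apply: ge0_le_integral => //.
    - by move=> x _; exact: integral_ge0.
    - apply: (measurable_fun_fubini_tonelli_F (m2 := mu) (abse \o (EFin \o h))) => //.
        exact: measurableT_comp.
      by move=> z; exact: abse_ge0.
    - apply/measurable_EFinP/measurable_funM => //.
      exact: L1_measurable iu'.
    - move=> x _.
      rewrite EFinM -L1_EFin// -integralZl//; last exact: (L1P iw').
      apply: ge0_le_integral => //.
      + apply: measurableT_comp => //.
        exact: (measurableT_comp mh (pair1_measurable x)).
      + apply: emeasurable_funM => //; apply/measurable_EFinP; exact: L1_measurable iw'.
      + by move=> y _; rewrite /= -EFinM lee_fin hle.
  under eq_integral do rewrite mulrC EFinM.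
  rewrite integralZl//; last exact: (L1P iu').
  rewrite L1_EFin//; exact: ltry.
have h1 x : \int[mu]_y h (x, y) = (\int[mu]_(y in D2) f x y) * \1_D1 x.
  rewrite [in RHS]Rintegral_mkind indicE /h /=.
  case: (boolP (x \in D1)) => [/[!inE] Dx|Dx] /=.
    by rewrite mulr1; apply: eq_Rintegral => y _; rewrite indicE mem_set// mul1r.
  rewrite mulr0 -[RHS](mul0r (fine (mu setT))) -Rintegral_cst//.
  by apply: eq_Rintegral => y _; rewrite indicE (negbTE Dx) mul0r mulr0.
have h2 y : \int[mu]_x h (x, y) = (\int[mu]_(x in D1) f x y) * \1_D2 y.
  rewrite [in RHS]Rintegral_mkind indicE /h /=.
  case: (boolP (y \in D2)) => [/[!inE] Dx|Dx] /=.
    by rewrite mulr1; apply: eq_Rintegral => x _; rewrite [X in _ * X]mulrC indicE mem_set// mul1r.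
  rewrite mulr0 -[RHS](mul0r (fine (mu setT))) -Rintegral_cst//.
  by apply: eq_Rintegral => x _; rewrite [X in _ * (_ * X)]indicE (negbTE Dx) !mulr0.
have fin1 x : (\int[mu]_y (EFin \o h) (x, y))%E = (\int[mu]_y h (x, y))%:E.
  rewrite L1_EFin//.
  apply: (@L1_le _ (fun y => u' x * w' y)) => //.
  - have := measurableT_comp mh (pair1_measurable x).
    by move=> /measurable_EFinP.
  - by apply: L1Z.
have fin2 y : (\int[mu]_x (EFin \o h) (x, y))%E = (\int[mu]_x h (x, y))%:E.
  rewrite L1_EFin//.
  apply: (@L1_le _ (fun x => w' y * u' x)) => //.
  - have := measurableT_comp mh (pair2_measurable y).
    by move=> /measurable_EFinP.
  - by apply: L1Z.
  - by move=> x _; rewrite mulrC.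
split.
- apply/(L1_mkcond _ mD1); have := integrable_fubini_F ih; rewrite /fubini_F => H; constructor; move: H.
  by under eq_fun do rewrite fin1 h1.
- apply/(L1_mkcond _ mD2).
  have : mu.-integrable setT (fun y => (\int[mu]_x (EFin \o h) (x, y))%E).
    (* the other partial integral is the first one of the transposed function *)
    pose h' (z : R * R) := h (z.2, z.1).
    have ih' : (mu \x mu)%E.-integrable setT (EFin \o h').
      apply/integrable12ltyP.
        apply/measurable_EFinP; apply: (measurableT_comp (proj1 (measurable_EFinP _ _) mh)).
        by apply/measurable_fun_pairP; split; [exact: measurable_snd|exact: measurable_fst].
      exact: ((integrable21ltyP mu mu mh).1 ih).
    exact: (integrable_fubini_F ih').
  by move=> H; constructor; move: H; under eq_fun do rewrite fin2 h2.
- have := Fubini ih.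
  under eq_integral do rewrite fin1 h1.
  under [X in _ = X -> _]eq_integral do rewrite fin2 h2.
  by move=> H; rewrite [LHS]Rintegral_mkind [RHS]Rintegral_mkind /Rintegral H.
Qed.

(** A translation kernel is dominated by no product of functions of one
    variable; here the majorant only has to be integrable in each variable and
    as an iterated integral. *)
Lemma Fubini_le (F G : R -> R -> R) :
  measurable_fun [set: R * R] (fun z => F z.1 z.2) ->
  measurable_fun [set: R * R] (fun z => G z.1 z.2) ->
  (forall x y, `|F x y| <= G x y) ->
  (forall x, L1 setT (G x)) -> (forall y, L1 setT (G^~ y)) ->
  L1 setT (fun y => \int[mu]_x G x y) ->
  [/\ L1 setT (fun x => \int[mu]_y F x y),
      L1 setT (fun y => \int[mu]_x F x y) &
  \int[mu]_x \int[mu]_y F x y = \int[mu]_y \int[mu]_x F x y].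
Proof.
move=> mF mG FG G1 G2 iG.
have F1 x : L1 setT (F x).
  apply: (L1_le _ _ (G1 x)) => //.
  exact: (measurableT_comp mF (pair1_measurable x)).
have F2 y : L1 setT (F^~ y).
  apply: (L1_le _ _ (G2 y)) => //.
  exact: (measurableT_comp mF (pair2_measurable y)).
pose h (z : R * R) : R := F z.1 z.2.
have mh : measurable_fun setT (EFin \o h) by exact/measurable_EFinP.
have ih : (mu \x mu)%E.-integrable setT (EFin \o h).
  apply/integrable21ltyP => //.
  apply: (@le_lt_trans _ _ (\int[mu]_y (\int[mu]_x G x y)%:E)%E); last first.
    by rewrite L1_EFin// ltry.
  apply: ge0_le_integral => //.
  - by move=> y _; exact: integral_ge0.
  - apply: (measurable_fun_fubini_tonelli_G (m1 := mu) (abse \o (EFin \o h))) => //.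
      exact: measurableT_comp.
    by move=> z; exact: abse_ge0.
  - by apply/measurable_EFinP; exact: L1_measurable iG.
  - move=> y _; rewrite -L1_EFin//.
    apply: ge0_le_integral => //.
    + apply/measurable_EFinP; apply: measurableT_comp => //.
      exact: L1_measurable (F2 y).
    + by apply/measurable_EFinP; exact: L1_measurable (G2 y).
    + by move=> x _; rewrite lee_fin; exact: FG.
have fin1 x : (\int[mu]_y (EFin \o h) (x, y))%E = (\int[mu]_y F x y)%:E.
  by rewrite -L1_EFin//; exact: F1.
have fin2 y : (\int[mu]_x (EFin \o h) (x, y))%E = (\int[mu]_x F x y)%:E.
  by rewrite -L1_EFin//; exact: F2.
split.
- by have := integrable_fubini_F ih; rewrite /fubini_F => H; constructor; move: H; under eq_fun do rewrite fin1.
- have : mu.-integrable setT (fun y => (\int[mu]_x (EFin \o h) (x, y))%E).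
    (* the other partial integral is the first one of the transposed function *)
    pose h' (z : R * R) := h (z.2, z.1).
    have ih' : (mu \x mu)%E.-integrable setT (EFin \o h').
      apply/integrable12ltyP.
        apply/measurable_EFinP; apply: (measurableT_comp (proj1 (measurable_EFinP _ _) mh)).
        by apply/measurable_fun_pairP; split; [exact: measurable_snd|exact: measurable_fst].
      exact: ((integrable21ltyP mu mu mh).1 ih).
    exact: (integrable_fubini_F ih').
  by move=> H; constructor; move: H; under eq_fun do rewrite fin2.
- have := Fubini ih.
  under eq_integral do rewrite fin1.
  under [X in _ = X -> _]eq_integral do rewrite fin2.
  by move=> H; rewrite /Rintegral H.
Qed.

End L1.

(** * Derivatives and the fundamental theorem of calculus *)

Section Deriv.
Context {R : realType}.
Implicit Types (f g : R -> R) (x : R).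

(** Hides the type class of derivatives, whose instances would otherwise be
    searched for at each use. *)
Definition isder f x (a : R) : Prop := is_derive x 1 f a.

Lemma isd_eq f x (a b : R) : isder f x a -> a = b -> isder f x b.
Proof. by move=> h <-. Qed.
Lemma isd_cst (c x : R) : isder (fun=> c) x 0.
Proof. exact: is_derive_cst. Qed.
Lemma isd_id x : isder (fun t => t) x 1.
Proof. exact: is_derive_id. Qed.
Lemma isdM f g x (a b : R) : isder f x a -> isder g x b ->
  isder (fun t => f t * g t) x (a * g x + f x * b).
Proof.
rewrite /isder => df dg.
have := is_deriveM df dg; rewrite /GRing.scale/= addrC [g x * a]mulrC; exact.
Qed.
Lemma isdD f g x (a b : R) : isder f x a -> isder g x b ->
  isder (fun t => f t + g t) x (a + b).
Proof. by rewrite /isder => df dg; exact: is_deriveD. Qed.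
Lemma isdN f x (a : R) : isder f x a -> isder (fun t => - f t) x (- a).
Proof. by rewrite /isder => df; exact: is_deriveN. Qed.
Lemma isd_comp f g x (a b : R) : isder f (g x) a -> isder g x b ->
  isder (fun t => f (g t)) x (a * b).
Proof. by rewrite /isder => df dg; exact: (@is_derive1_comp _ f g). Qed.
Lemma isd_sin g x (b : R) : isder g x b ->
  isder (fun t => sin (g t)) x (cos (g x) * b).
Proof. by move=> dg; apply: isd_comp dg; exact: is_derive_sin. Qed.
Lemma isd_cos g x (b : R) : isder g x b ->
  isder (fun t => cos (g t)) x (- sin (g x) * b).
Proof. by move=> dg; apply: isd_comp dg; exact: is_derive_cos. Qed.
Lemma isd_expR g x (b : R) : isder g x b ->
  isder (fun t => expR (g t)) x (expR (g x) * b).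
Proof. by move=> dg; apply: isd_comp dg; exact: is_derive_expR. Qed.
Lemma isd_atan g x (b : R) : isder g x b ->
  isder (fun t => atan (g t)) x ((1 + g x ^+ 2)^-1 * b).
Proof. by move=> dg; apply: isd_comp dg; exact: is_derive1_atan. Qed.
End Deriv.

(** Differentiates along the structure of the function; after [isd_eq],
    comparing the outcome with an expected derivative is left to [ring] or
    [field]. *)
Ltac isd := first [ eassumption | exact: isd_cst | exact: isd_id
  | apply: isdN; isd | apply: isdD; isd | apply: isdM; isd
  | apply: isd_sin; isd | apply: isd_cos; isd | apply: isd_expR; isd
  | apply: isd_atan; isd ].

Section Calculus.
Context {R : realType}.
Notation mu := (@lebesgue_measure R).
Implicit Types (f F : R -> R).

(** Lebesgue measure is determined by the half-open intervals, on which
    translation invariance is a computation. *)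
Lemma lebesgue_measure_shift (s : R) (A : set R) : measurable A ->
  pushforward mu (+%R^~ s : _ -> measurableTypeR R) A = mu A.
Proof.
move=> mA; apply/esym/lebesgue_measure_unique => //= [|_ _ [[a b]] _ <-]; first exact: measurable_funD.
rewrite /pushforward (_ : _ @^-1` _ = `]a - s, b - s]%classic).
  rewrite !lebesgue_measure_itv/= !lte_fin ltrD2r; case: ifP => // _.
  by rewrite -!EFinB; congr EFin; ring.
by apply/seteqP; split => x /=; rewrite !in_itv/= ltrBlDr lerBrDr.
Qed.

Lemma L1_shift s f : L1 setT f ->
  L1 setT (fun x => f (x + s)) /\ \int[mu]_x f (x + s) = \int[mu]_x f x.
Proof.
move=> fi; have mf := L1_measurable fi.
have ms : measurable_fun setT (+%R^~ s : _ -> measurableTypeR R) by exact: measurable_funD.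
have pI (g : R -> \bar R) : (\int[pushforward mu (+%R^~ s : _ -> measurableTypeR R)]_x g x = \int[mu]_x g x)%E.
  by apply: eq_measure_integral => A mA _ /=; exact: lebesgue_measure_shift.
have iL : L1 setT (fun x => f (x + s)).
  constructor; apply/integrableP; split.
    by apply/measurable_EFinP; apply: (measurableT_comp mf ms).
  have [/integrableP[_]] := fi.
  rewrite -pI ge0_integral_pushforward//.
  apply: measurableT_comp => //; apply/measurable_EFinP; exact: mf.
split => //; congr fine; rewrite -[RHS]pI integral_pushforward//; last exact: (L1P iL).
by apply/measurable_EFinP; exact: mf.
Qed.

Lemma Rintegral_exhaust (D : set R) (A : nat -> set R) f : measurable D ->
  (forall n, measurable (A n)) -> (forall n, A n `<=` D) ->
  (forall x, D x -> \forall n \near \oo, A n x) -> L1 D f ->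
  \int[mu]_(x in A n) f x @[n --> \oo] --> \int[mu]_(x in D) f x.
Proof.
move=> mD mA AD Ax fi.
have mf := L1_measurable fi.
have [//||||_] := @Rintegral_dominated _ D (fun n x => f x * \1_(A n) x) f (fun x => `|f x|) mD.
- by move=> n; apply: measurable_funM => //; exact: measurable_indic.
- exact: L1_norm.
- move=> x Dx; apply: cvg_near_cst; have := Ax x Dx; apply: filterS => n An.
  by rewrite indicE mem_set// mulr1.
- move=> n x Dx; rewrite normrM ler_piMr// indicE; case: (_ \in _) => /=; by rewrite ?normr1 ?normr0.
rewrite [X in X @ _ --> _](_ : _ = (fun n => \int[mu]_(x in A n) f x))//.
apply/funext => n; symmetry.
rewrite Rintegral_mkind [RHS]Rintegral_mkind; apply: eq_Rintegral => x _.
rewrite -mulrA; congr (_ * _); rewrite !indicE.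
by case: (boolP (x \in A n)) => [/[!inE] /(AD n) Dx|_]; rewrite ?mul0r// mem_set// mulr1.
Qed.

Lemma is_derive_continuous F f : (forall x : R, isder F x (f x)) -> continuous F.
Proof.
move=> dF x; apply: differentiable_continuous; apply/derivable1_diffP.
have dFx : is_derive x 1 _ _ := dF x; exact: ex_derive.
Qed.

Lemma Rintegral_FTC F f a b : a < b -> (forall x : R, isder F x (f x)) ->
  continuous f -> \int[mu]_(x in `[a, b]) f x = F b - F a.
Proof.
move=> ab dF cf; rewrite /Rintegral (@continuous_FTC2 _ f F)//.
- exact: continuous_subspaceT.
- have cF := is_derive_continuous dF; split.
  + by move=> x _; have dFx : is_derive x 1 _ _ := dF x; exact: ex_derive.
  + by apply: cvg_at_right_filter; exact: cF.
  + by apply: cvg_at_left_filter; exact: cF.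
- by move=> x _; rewrite derive1E; have dFx : is_derive x 1 _ _ := dF x; exact: derive_val.
Qed.

Lemma cvg_natS_pinfty : (fun n : nat => n.+1%:R : R) @ \oo --> +oo.
Proof.
by apply/cvgryPge => A; near=> n; rewrite (@le_trans _ _ n%:R) ?ler_nat//;
  near: n; exact: nbhs_infty_ger.
Unshelve. all: by end_near. Qed.

(** The integral is the limit of the integrals over [-n, n], so only the
    difference of the two end values of F has to converge. *)
Lemma FTC_line F f (l : R) : (forall x : R, isder F x (f x)) -> continuous f ->
  L1 setT f -> F x - F (- x) @[x --> +oo] --> l -> \int[mu]_x f x = l.
Proof.
move=> dF cf fi Fl.
have H : \int[mu]_(x in `[- n.+1%:R, n.+1%:R]) f x @[n --> \oo] --> l.
  rewrite (_ : (fun n => _) = (fun n : nat => F n.+1%:R - F (- n.+1%:R))).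
    by move/cvg_pinftyP : Fl; apply; exact: cvg_natS_pinfty.
  by apply/funext => n; rewrite (Rintegral_FTC _ dF)// gtrN.
have := @Rintegral_exhaust setT (fun n => `[- n.+1%:R, n.+1%:R]%classic) f measurableT.
move=> /(_ (fun _ => measurable_itv _)) /(_ (fun _ _ _ => I)).
move=> H2; apply: (cvg_unique _ _ H) => //; apply: H2 => // x _.
near=> n => /=; rewrite in_itv /= -ler_norml.
by rewrite (@le_trans _ _ n%:R) ?ler_nat//; near: n; exact: nbhs_infty_ger.
Unshelve. all: by end_near. Qed.

Lemma FTC_ray F f (a l : R) : (forall x : R, isder F x (f x)) -> continuous f ->
  L1 `[a, +oo[ f -> F x @[x --> +oo] --> l ->
  \int[mu]_(x in `[a, +oo[) f x = l - F a.
Proof.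
move=> dF cf fi Fl.
have H : \int[mu]_(x in `[a, a + n.+1%:R]) f x @[n --> \oo] --> l - F a.
  rewrite (_ : (fun n => _) = (fun n : nat => F (a + n.+1%:R) - F a)).
    apply: cvgB; last exact: cvg_cst.
    move/cvg_pinftyP : Fl; apply; apply/cvgryPge => A.
    by have /cvgryPge/(_ (A - a)) := cvg_natS_pinfty; apply: filterS => n; rewrite lerBlDl.
  by apply/funext => n; rewrite (Rintegral_FTC _ dF)// ltrDl.
have := @Rintegral_exhaust `[a, +oo[%classic (fun n => `[a, a + n.+1%:R]%classic) f (measurable_itv _).
move=> /(_ (fun _ => measurable_itv _)).
move=> H2; apply: (cvg_unique _ _ H) => //; apply: H2 => //.
  by move=> n x /=; rewrite !in_itv/= => /andP[->].
move=> x /=; rewrite in_itv/= andbT => ax; near=> n => /=; rewrite in_itv /= ax/=.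
rewrite -lerBlDl (@le_trans _ _ n%:R) ?ler_nat//; near: n; exact: nbhs_infty_ger.
Unshelve. all: by end_near. Qed.

End Calculus.

(** * Damped harmonics and the Poisson kernel *)

Section Elementary.
Context {R : realType}.
Notation mu := (@lebesgue_measure R).
Notation ray := (`[0, +oo[%classic : set R).

Lemma isd_ex_cont (f : R -> R) : (forall x : R, exists l : R, isder f x l) ->
  continuous f.
Proof.
rewrite /isder => h x; have [l dl] := h x; apply: differentiable_continuous.
by apply/derivable1_diffP; exact: ex_derive.
Qed.

Lemma cvg_expNM (e : R) : 0 < e -> expR (- (e * x)) @[x --> +oo] --> (0 : R).
Proof.
move=> e0.
apply: (@cvg_comp _ _ _ (fun x : R => e * x) (fun y : R => expR (- y)) _ (pinfty_nbhs R)).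
  apply/cvgryPge => A; near=> x.
  rewrite mulrC -ler_pdivrMr//; near: x; exact: nbhs_pinfty_ge.
exact: cvgr_expR.
Unshelve. all: by end_near. Qed.

Lemma L1_exp (e : R) : 0 < e -> L1 ray (fun t => expR (- (e * t))).
Proof.
move=> e0.
have dF (x : R) : isder (fun t => - e^-1 * expR (- (e * t))) x (expR (- (e * x))).
  by apply: isd_eq; [isd|rewrite /=; field; rewrite gt_eqF].
have cf : continuous (fun t => expR (- (e * t))).
  by apply: isd_ex_cont => x; eexists; isd.
apply: L1_ge0.
- by apply: measurable_funTS; exact: continuous_measurable_fun.
- by move=> x _; exact: expR_ge0.
rewrite (@ge0_continuous_FTC2y _ _ (fun t => - e^-1 * expR (- (e * t))) 0 (- e^-1 * 0)).
- exact: ltry.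
- by move=> x _; exact: expR_ge0.
- exact: continuous_subspaceT.
- by apply: cvgM; [exact: cvg_cst|exact: cvg_expNM].
- by move=> x _; have dFx : is_derive x 1 _ _ := dF x; exact: ex_derive.
- by apply: cvg_at_right_filter; apply: is_derive_continuous dF _.
- by move=> x _; rewrite derive1E; have dFx : is_derive x 1 _ _ := dF x; exact: derive_val.
Qed.

Lemma cvg_0_bounded (F : R -> R) (g : R -> R) (M : R) : (forall x, `|g x| <= M) ->
  F x @[x --> +oo] --> (0 : R) -> F x * g x @[x --> +oo] --> (0 : R).
Proof.
move=> gM F0; apply: norm_cvg0.
apply: (@squeeze_cvgr _ _ _ _ (cst 0) (fun x => `|F x| * M)).
- by apply: nearW => x; rewrite normr_ge0 normrM ler_wpM2l.
- exact: cvg_cst.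
- rewrite -[X in _ --> X](mul0r M); apply: cvgM; last exact: cvg_cst.
  rewrite -(@normr0 _ R); exact: cvg_norm.
Qed.

Lemma sqrD_neq0 (e u : R) : 0 < e -> e ^+ 2 + u ^+ 2 != 0.
Proof. by move=> e0; rewrite gt_eqF// ltr_wpDr ?sqr_ge0// exprn_gt0. Qed.

Lemma L1_expcos (e u : R) : 0 < e -> L1 ray (fun t => expR (- (e * t)) * cos (u * t)).
Proof.
move=> e0; apply: (L1_bounded (M := 1)) => //; last exact: L1_exp.
  apply: measurable_funTS; apply: continuous_measurable_fun.
  by apply: isd_ex_cont => x; eexists; isd.
by move=> x _; exact: cos_max.
Qed.

Lemma L1_expsin (e u : R) : 0 < e -> L1 ray (fun t => expR (- (e * t)) * sin (u * t)).
Proof.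
move=> e0; apply: (L1_bounded (M := 1)) => //; last exact: L1_exp.
  apply: measurable_funTS; apply: continuous_measurable_fun.
  by apply: isd_ex_cont => x; eexists; isd.
by move=> x _; exact: sin_max.
Qed.

Lemma laplace_cos (e u : R) : 0 < e ->
  \int[mu]_(t in ray) (expR (- (e * t)) * cos (u * t)) = e / (e ^+ 2 + u ^+ 2).
Proof.
move=> e0; have eu := sqrD_neq0 u e0.
rewrite (@FTC_ray _ (fun t => expR (- (e * t)) * ((u * sin (u * t) - e * cos (u * t)) / (e ^+ 2 + u ^+ 2))) _ 0 0).
- by rewrite !mulr0 oppr0 expR0 sin0 cos0; ring.
- by move=> x; apply: isd_eq; [isd|rewrite /=; field].
- by apply: isd_ex_cont => x; eexists; isd.
- exact: L1_expcos.
- apply: (@cvg_0_bounded _ _ ((`|u| + `|e|) / `|e ^+ 2 + u ^+ 2|)); last exact: cvg_expNM.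
  move=> x; rewrite normrM normfV ler_wpM2r ?invr_ge0//.
  rewrite (le_trans (ler_normB _ _))// !normrM lerD// ler_piMr//; [exact: sin_max|exact: cos_max].
Qed.

Lemma laplace_sin (e u : R) : 0 < e ->
  \int[mu]_(t in ray) (expR (- (e * t)) * sin (u * t)) = u / (e ^+ 2 + u ^+ 2).
Proof.
move=> e0; have eu := sqrD_neq0 u e0.
rewrite (@FTC_ray _ (fun t => expR (- (e * t)) * ((- e * sin (u * t) - u * cos (u * t)) / (e ^+ 2 + u ^+ 2))) _ 0 0).
- by rewrite !mulr0 oppr0 expR0 sin0 cos0; ring.
- by move=> x; apply: isd_eq; [isd|rewrite /=; field].
- by apply: isd_ex_cont => x; eexists; isd.
- exact: L1_expsin.
- apply: (@cvg_0_bounded _ _ ((`|e| + `|u|) / `|e ^+ 2 + u ^+ 2|)); last exact: cvg_expNM.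
  move=> x; rewrite normrM normfV ler_wpM2r ?invr_ge0//.
  rewrite (le_trans (ler_normB _ _))// !normrM normrN lerD// ler_piMr//; [exact: sin_max|exact: cos_max].
Qed.

(** Pi times the Poisson kernel of the upper half plane at height e; up to the
    factor pi it is an approximate identity as e tends to 0. *)
Definition poisson (e u : R) : R := e / (e ^+ 2 + u ^+ 2).

Lemma poisson_ge0 e u : 0 < e -> 0 <= poisson e u.
Proof. by move=> e0; rewrite divr_ge0 ?addr_ge0 ?sqr_ge0// ltW. Qed.

Lemma poissonN e u : poisson e (- u) = poisson e u.
Proof. by rewrite /poisson sqrrN. Qed.

Lemma continuous_poisson e : 0 < e -> continuous (poisson e).
Proof.
move=> e0 x; apply: cvgM; first exact: cvg_cst.
apply: cvgV; first exact: sqrD_neq0.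
apply: cvgD; first exact: cvg_cst.
exact: exprn_continuous.
Qed.

Lemma poisson_le e u : 0 < e -> poisson e u <= e^-1.
Proof.
move=> e0; rewrite /poisson ler_pdivrMr; last by rewrite ltr_wpDr ?sqr_ge0// exprn_gt0.
by rewrite expr2 mulrDr mulrA mulVf ?gt_eqF// mul1r lerDl mulr_ge0// ?sqr_ge0// invr_ge0 ltW.
Qed.

Lemma integral_poisson0 e : 0 < e ->
  L1 setT (poisson e) /\ \int[mu]_u poisson e u = pi.
Proof.
move=> e0.
have dF (x : R) : isder (fun t => atan (e^-1 * t)) x (poisson e x).
  apply: isd_eq; first by isd.
  rewrite /=.
  by rewrite /poisson; field; rewrite sqrD_neq0// gt_eqF.
have H : (\int[mu]_u (poisson e u)%:E = pi%:E)%E.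
  rewrite ge0_symfun_integralT//; last 3 first.
  - by move=> x; exact: poisson_ge0.
  - exact: continuous_poisson.
  - by move=> x /=; rewrite poissonN.
  rewrite -set_itvcy (@ge0_continuous_FTC2y _ _ (fun t => atan (e^-1 * t)) 0 (pi / 2)).
  - rewrite mulr0 atan0 sube0 -EFinM; congr EFin; by field.
  - by move=> x _; exact: poisson_ge0.
  - by apply: continuous_subspaceT; exact: continuous_poisson.
  - apply: (@cvg_comp _ _ _ (fun x : R => e^-1 * x) (@atan R) _ (pinfty_nbhs R)); last exact: cvgy_atan.
    apply/cvgryPge => A; near=> x.
    rewrite mulrC ler_pdivlMr//; near: x; exact: nbhs_pinfty_ge.
  - by move=> x _; have dFx : is_derive x 1 _ _ := dF x; exact: ex_derive.
  - by apply: cvg_at_right_filter; apply: is_derive_continuous dF _.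
  - by move=> x _; rewrite derive1E; have dFx : is_derive x 1 _ _ := dF x; exact: derive_val.
split; last by rewrite /Rintegral H.
apply: L1_ge0.
- apply: continuous_measurable_fun; exact: continuous_poisson.
- by move=> x _; exact: poisson_ge0.
- by rewrite H ltry.
Unshelve. all: by end_near. Qed.

Lemma integral_poisson e s : 0 < e ->
  L1 setT (fun u => poisson e (u - s)) /\ \int[mu]_u poisson e (u - s) = pi.
Proof.
move=> e0; have [i1 i2] := integral_poisson0 e0.
by have [j1 j2] := L1_shift (- s) i1; rewrite j2 i2.
Qed.

End Elementary.

(** * Sine and cosine transforms, Plancherel inequalities *)

Section Tools.
Context {R : realType}.
Notation mu := (@lebesgue_measure R).
Implicit Types (D : set R) (f g h : R -> R).

Lemma Fatou_bound D (f_ : nat -> R -> R) f (M : R) : measurable D ->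
  (forall n, L1 D (f_ n)) -> (forall n x, D x -> 0 <= f_ n x) ->
  (forall x, D x -> f_ n x @[n --> \oo] --> f x) ->
  (\forall n \near \oo, \int[mu]_(x in D) f_ n x <= M) ->
  L1 D f /\ \int[mu]_(x in D) f x <= M.
Proof.
move=> mD fi f0 cf fM.
have mf : measurable_fun D f.
  by apply: (measurable_fun_cvg (h := f_)) => // n; exact: L1_measurable.
have fx0 x : D x -> 0 <= f x.
  move=> Dx; have cx := cf x Dx; rewrite -(cvg_lim _ cx)//.
  apply: limr_ge; first by apply/cvg_ex; eexists; exact: cx.
  by apply: nearW => n; exact: f0.
have H : (\int[mu]_(x in D) (f x)%:E <= M%:E)%E.
  have -> : (\int[mu]_(x in D) (f x)%:E =
     \int[mu]_(x in D) limn_einf (fun n => (f_ n x)%:E))%E.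
    apply: eq_integral => x /[!inE] Dx.
    have cx : (f_ n x)%:E @[n --> \oo] --> (f x)%:E.
      by apply: cvg_EFin; [exact: nearW|exact: cf].
    by rewrite is_cvg_limn_einfE//; [rewrite (cvg_lim _ cx)//|apply/cvg_ex; eexists; exact: cx].
  have := @fatou _ _ _ mu D mD (fun n x => (f_ n x)%:E).
  move=> /(_ (fun n => proj2 (measurable_EFinP _ _) (L1_measurable (fi n)))).
  have fE n x : D x -> (0 <= (f_ n x)%:E)%E by move=> Dx; rewrite lee_fin f0.
  move=> /(_ fE) H; apply: (le_trans H) => //.
  rewrite limn_einf_lim; apply: lime_le; first exact: is_cvg_einfs.
  move: fM; apply: filterS => n fM.
  rewrite /einfs/= (@le_trans _ _ (\int[mu]_(x in D) (f_ n x)%:E)%E)//.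
    by apply: ereal_inf_lbound; exists n => //=.
  by rewrite L1_EFin.
have fL : L1 D f by apply: L1_ge0 => //; exact: le_lt_trans H (ltry _).
by split => //; rewrite -lee_fin -L1_EFin.
Qed.

End Tools.

Lemma measurable_cosR (R : realType) : measurable_fun setT (@cos R).
Proof. by apply: continuous_measurable_fun; exact: continuous_cos. Qed.
Lemma measurable_sinR (R : realType) : measurable_fun setT (@sin R).
Proof. by apply: continuous_measurable_fun; exact: continuous_sin. Qed.

(** Continuity does not help for integrands of two variables that contain an
    arbitrary measurable function; here such a function is handled by the
    hypothesis on its measurability. *)
Ltac measurable_by_parts := lazymatch goal with
  | |- measurable_fun _ (fun z => GRing.mul (@?f z) (@?g z)) =>
     apply: (@measurable_funM _ _ _ _ f g); measurable_by_parts
  | |- measurable_fun _ (fun z => GRing.add (@?f z) (GRing.opp (@?g z))) =>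
     apply: (@measurable_funB _ _ _ _ f g); measurable_by_parts
  | |- measurable_fun _ (fun z => GRing.add (@?f z) (@?g z)) =>
     apply: (@measurable_funD _ _ _ _ f g); measurable_by_parts
  | |- measurable_fun _ (fun z => GRing.opp (@?f z)) =>
     apply: (@measurable_funN _ _ _ _ f); measurable_by_parts
  | |- measurable_fun _ (fun z => cos (@?f z)) =>
     apply: (measurableT_comp (@measurable_cosR _)); measurable_by_parts
  | |- measurable_fun _ (fun z => sin (@?f z)) =>
     apply: (measurableT_comp (@measurable_sinR _)); measurable_by_parts
  | |- measurable_fun _ (fun z => expR (@?f z)) =>
     apply: (measurableT_comp (@measurable_expR _)); measurable_by_parts
  | |- measurable_fun _ (fun z => z.1) => exact: measurable_fst
  | |- measurable_fun _ (fun z => z.2) => exact: measurable_snd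
  | |- measurable_fun _ (fun z => z) => exact: measurable_id
  | |- measurable_fun _ (fun _ => ?c) => exact: measurable_cst
  | H : measurable_fun setT ?h |- measurable_fun _ (fun z => ?h (@?f z)) =>
     apply: (measurableT_comp H); measurable_by_parts
  | |- measurable_fun _ fst => exact: measurable_fst
  | |- measurable_fun _ snd => exact: measurable_snd
  | _ => first [assumption | idtac] end.

Section Transforms.
Context {R : realType}.
Notation mu := (@lebesgue_measure R).
Notation ray := (`[0, +oo[%classic : set R).
Implicit Types (f g h : R -> R).

(** The Fourier transform of h is [cosT h - i sinT h]; treating the two parts
    separately keeps all integrals real. *)
Definition cosT h t := \int[mu]_x (h x * cos (t * x)).
Definition sinT h t := \int[mu]_x (h x * sin (t * x)).

Lemma cont_cosl (t : R) : continuous (fun x : R => cos (t * x)).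
Proof. by apply: isd_ex_cont => x; eexists; isd. Qed.
Lemma cont_sinl (t : R) : continuous (fun x : R => sin (t * x)).
Proof. by apply: isd_ex_cont => x; eexists; isd. Qed.

Lemma L1_cos D h (t : R) : measurable D -> L1 D h -> L1 D (fun x => h x * cos (t * x)).
Proof.
move=> mD hi; apply: (L1_bounded (M := 1)) => //.
  apply: measurable_funTS; apply: continuous_measurable_fun; exact: cont_cosl.
by move=> x _; exact: cos_max.
Qed.

Lemma L1_sin D h (t : R) : measurable D -> L1 D h -> L1 D (fun x => h x * sin (t * x)).
Proof.
move=> mD hi; apply: (L1_bounded (M := 1)) => //.
  apply: measurable_funTS; apply: continuous_measurable_fun; exact: cont_sinl.
by move=> x _; exact: sin_max.
Qed.

Lemma cosT_le h t : L1 setT h -> `|cosT h t| <= \int[mu]_x `|h x|.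
Proof.
move=> hi; apply: le_Rint_norm => //; [exact: L1_cos|exact: L1_norm|].
by move=> x _; rewrite normrM ler_piMr// cos_max.
Qed.

Lemma sinT_le h t : L1 setT h -> `|sinT h t| <= \int[mu]_x `|h x|.
Proof.
move=> hi; apply: le_Rint_norm => //; [exact: L1_sin|exact: L1_norm|].
by move=> x _; rewrite normrM ler_piMr// sin_max.
Qed.

Lemma continuous_param D (F : R -> R -> R) g : measurable D ->
  (forall t, L1 D (F t)) -> (forall x, D x -> continuous (F^~ x)) -> L1 D g ->
  (forall t x, D x -> `|F t x| <= g x) -> continuous (fun t => \int[mu]_(x in D) F t x).
Proof.
move=> mD Fi cF gi Fg t.
have It : t \in `]t - 1, t + 1[%classic.
  by rewrite inE/= in_itv/= ltrDl ltr01 ltrBlDr ltrDl ltr01.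
apply: (@continuity_under_integral _ _ _ mu F D mD (t - 1) (t + 1) _ _ g (L1P gi)) => //.
- by move=> x _; exact: (L1P (Fi x)).
- by apply: aeW => x Dx y _; exact: cF.
- by move=> x _; apply: aeW => y Dy; exact: Fg.
Qed.

Lemma continuous_cosT h : L1 setT h -> continuous (cosT h).
Proof.
move=> hi; apply: (@continuous_param setT _ (fun x => `|h x|)) => //.
- by move=> t; exact: L1_cos.
- by move=> x _; apply: isd_ex_cont => t; eexists; isd.
- exact: L1_norm.
- by move=> t x _; rewrite normrM ler_piMr// cos_max.
Qed.

Lemma continuous_sinT h : L1 setT h -> continuous (sinT h).
Proof.
move=> hi; apply: (@continuous_param setT _ (fun x => `|h x|)) => //.
- by move=> t; exact: L1_sin.
- by move=> x _; apply: isd_ex_cont => t; eexists; isd.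
- exact: L1_norm.
- by move=> t x _; rewrite normrM ler_piMr// sin_max.
Qed.

(** The squared modulus of the Fourier transform. *)
Definition energyT h t := cosT h t ^+ 2 + sinT h t ^+ 2.

Lemma measurable_cosT h : L1 setT h -> measurable_fun setT (cosT h).
Proof. by move=> hi; apply: continuous_measurable_fun; exact: continuous_cosT. Qed.

Lemma measurable_sinT h : L1 setT h -> measurable_fun setT (sinT h).
Proof. by move=> hi; apply: continuous_measurable_fun; exact: continuous_sinT. Qed.

Lemma energyT_ge0 h t : 0 <= energyT h t.
Proof. by rewrite addr_ge0 ?sqr_ge0. Qed.

Lemma measurable_energyT h : L1 setT h -> measurable_fun setT (energyT h).
Proof.
by move=> hi; apply: measurable_funD; apply: measurable_funX;
  [exact: measurable_cosT|exact: measurable_sinT].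
Qed.

Lemma energyT_split h t : L1 setT h ->
  energyT h t = \int[mu]_x (h x * (cosT h t * cos (t * x) + sinT h t * sin (t * x))).
Proof.
move=> hi.
have iC := L1_cos t measurableT hi; have iS := L1_sin t measurableT hi.
transitivity (\int[mu]_x (cosT h t * (h x * cos (t * x)) + sinT h t * (h x * sin (t * x)))).
  rewrite RintD//; [|exact: L1Z..].
  by rewrite !RintZl.
by apply: eq_Rintegral => x _; ring.
Qed.

Lemma cosT_shift h t x : L1 setT h ->
  cosT h t * cos (t * x) + sinT h t * sin (t * x) =
  \int[mu]_y (h y * cos ((x - y) * t)).
Proof.
move=> hi.
have iC := L1_cos t measurableT hi; have iS := L1_sin t measurableT hi.
transitivity (\int[mu]_y (cos (t * x) * (h y * cos (t * y)) + sin (t * x) * (h y * sin (t * y)))).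
  rewrite RintD//; [|exact: L1Z..].
  by rewrite !RintZl// [cos _ * _]mulrC [sin _ * _]mulrC.
by apply: eq_Rintegral => y _; rewrite [(x - y) * t]mulrC mulrBr cosB; ring.
Qed.

Lemma integral_poissonr e x : 0 < e ->
  L1 setT (fun y => poisson e (x - y)) /\ \int[mu]_y poisson e (x - y) = pi.
Proof.
move=> e0; have [k1 k2] := integral_poisson x e0.
have kx : (fun y => poisson e (y - x)) = (fun y => poisson e (x - y)).
  by apply/funext => y; rewrite -poissonN opprB.
by rewrite kx in k1 k2.
Qed.

Definition conv_poisson e h x := \int[mu]_y (h y * poisson e (x - y)).

Lemma L1_poisson e h x : 0 < e -> L1 setT h -> L1 setT (fun y => h y * poisson e (x - y)).
Proof.
move=> e0 hi; apply: (L1_bounded (M := e^-1)) => //.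
  apply: continuous_measurable_fun => y.
  apply: (@continuous_comp _ _ _ (fun y => x - y) (poisson e)).
    by apply: continuousB; [exact: cst_continuous|exact: cvg_id].
  exact: continuous_poisson.
by move=> y _; rewrite ger0_norm ?poisson_ge0// poisson_le.
Qed.

(** Expanded as a double integral, the energy at t is the integral of h x h y
    cos ((x - y) t). The damping makes the exchange of integrals legitimate,
    and the integral over t of the damped cosine is the Poisson kernel. *)
Lemma laplace_energy e h : 0 < e -> L1 setT h ->
  [/\ L1 ray (fun t => expR (- (e * t)) * energyT h t),
      L1 setT (fun x => h x * conv_poisson e h x) &
      \int[mu]_(t in ray) (expR (- (e * t)) * energyT h t) =
      \int[mu]_x (h x * conv_poisson e h x)].
Proof.
move=> e0 hi.
pose N := \int[mu]_x `|h x|.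
have N0 : 0 <= N by apply: Rintegral_ge0.
have mh := L1_measurable hi.
have mC := measurable_cosT hi; have mS := measurable_sinT hi.
pose G t x := cosT h t * cos (t * x) + sinT h t * sin (t * x).
have Gle t x : `|G t x| <= N + N.
  rewrite (le_trans (ler_normD _ _))// !normrM lerD// -[N]mulr1; apply: ler_pM => //.
  - exact: cosT_le.
  - exact: cos_max.
  - exact: sinT_le.
  - exact: sin_max.
have mexp : measurable_fun setT (fun t : R => expR (- (e * t))).
  by apply: continuous_measurable_fun; apply: isd_ex_cont => x; eexists; isd.
have [||||i1 i2 eq1] := @Fubini_dom R ray setT (fun t x => expR (- (e * t)) * (h x * G t x))
  (fun t => expR (- (e * t)) * (N + N)) (fun x => `|h x|) (measurable_itv _) measurableT.
- rewrite /G /=; measurable_by_parts.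
- apply: (L1_bounded (M := N + N)) => //; last exact: L1_exp.
  by move=> x _; rewrite ger0_norm// addr_ge0.
- exact: L1_norm.
- move=> t x _ _; rewrite !normrM ger0_norm ?expR_ge0// -mulrA ler_wpM2l ?expR_ge0//.
  by rewrite mulrC ler_wpM2r.
have e1 t : \int[mu]_x (expR (- (e * t)) * (h x * G t x)) = expR (- (e * t)) * energyT h t.
  rewrite RintZl//; first by rewrite -energyT_split.
  apply: (L1_bounded (M := N + N)) => //.
  by rewrite /G; apply: continuous_measurable_fun; apply: isd_ex_cont => x; eexists; isd.
have e2 x : \int[mu]_(t in ray) (expR (- (e * t)) * (h x * G t x)) = h x * conv_poisson e h x.
  transitivity (h x * \int[mu]_(t in ray) (expR (- (e * t)) * G t x)).
    rewrite -RintZl//; first by apply: eq_Rintegral => t _; ring.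
    apply: (L1_bounded (M := N + N)) => //; last exact: L1_exp.
    by rewrite /G; apply: measurable_funTS; measurable_by_parts.
  congr (_ * _).
  transitivity (\int[mu]_(t in ray) \int[mu]_y (expR (- (e * t)) * (h y * cos ((x - y) * t)))).
    apply: eq_Rintegral => t _; rewrite RintZl//; first by rewrite -cosT_shift.
    apply: (L1_bounded (M := 1)) => //.
      by apply: continuous_measurable_fun; apply: isd_ex_cont => y; eexists; isd.
    by move=> y _; exact: cos_max.
  have [||||_ _ ->] := @Fubini_dom R ray setT (fun t y => expR (- (e * t)) * (h y * cos ((x - y) * t)))
  (fun t => expR (- (e * t))) (fun x => `|h x|) (measurable_itv _) measurableT.
  - measurable_by_parts.
  - exact: L1_exp.
  - exact: L1_norm.
  - move=> t y _ _; rewrite !normrM ger0_norm ?expR_ge0// ler_wpM2l ?expR_ge0//.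
    by rewrite ler_piMr// cos_max.
  - apply: eq_Rintegral => y _.
    transitivity (h y * \int[mu]_(t in ray) (expR (- (e * t)) * cos ((x - y) * t))).
      by rewrite -RintZl//; [apply: eq_Rintegral => t _; ring|exact: L1_expcos].
    by rewrite laplace_cos.
split.
- by move: i1; rewrite (_ : (fun _ => _) = (fun t => expR (- (e * t)) * energyT h t))//; apply/funext.
- by move: i2; rewrite (_ : (fun _ => _) = (fun x => h x * conv_poisson e h x))//; apply/funext.
transitivity (\int[mu]_(t in ray) \int[mu]_x (expR (- (e * t)) * (h x * G t x))).
  by apply: eq_Rintegral => t _.
by rewrite eq1; apply: eq_Rintegral => x _.
Qed.

(** Schur's test: 2 h x h y <= h x ^+ 2 + h y ^+ 2, and the kernel has mass pi
    in each variable. *)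
Lemma schur_poisson e h : 0 < e -> L1 setT h -> L1 setT (fun x => h x ^+ 2) ->
  L1 setT (fun x => h x * conv_poisson e h x) ->
  \int[mu]_x (h x * conv_poisson e h x) <= pi * \int[mu]_x (h x ^+ 2).
Proof.
move=> e0 hi h2i hP.
have mh := L1_measurable hi.
have mP : measurable_fun setT (poisson e).
  by apply: continuous_measurable_fun; exact: continuous_poisson.
have [||||||j1 _ j3] := @Fubini_le R (fun x y => h y ^+ 2 * poisson e (x - y))
  (fun x y => h y ^+ 2 * poisson e (x - y)).
- apply: measurable_funM.
    by apply: measurable_funX; exact: (measurableT_comp mh measurable_snd).
  by apply: (measurableT_comp mP); measurable_by_parts.
- apply: measurable_funM.
    by apply: measurable_funX; exact: (measurableT_comp mh measurable_snd).
  by apply: (measurableT_comp mP); measurable_by_parts.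
- by move=> x y; rewrite ger0_norm// mulr_ge0 ?sqr_ge0 ?poisson_ge0.
- by move=> x; exact: L1_poisson.
- by move=> y; apply: L1Z => //; have [] := integral_poisson y e0.
- rewrite (_ : (fun _ => _) = (fun y => pi * h y ^+ 2)); first exact: L1Z.
  apply/funext => y; have [k1 k2] := integral_poisson y e0.
  by rewrite (RintZl _ measurableT k1) mulrC k2.
have J : \int[mu]_x \int[mu]_y (h y ^+ 2 * poisson e (x - y)) = pi * \int[mu]_x (h x ^+ 2).
  rewrite j3 -RintZl//; apply: eq_Rintegral => y _.
  have [k1 k2] := integral_poisson y e0.
  by rewrite RintZl// k2 mulrC.
have iD : L1 setT (fun x => pi * h x ^+ 2 + \int[mu]_y (h y ^+ 2 * poisson e (x - y))).
  by apply: L1D => //; exact: L1Z.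
apply: (@le_trans _ _ (\int[mu]_x (2^-1 * (pi * h x ^+ 2 + \int[mu]_y (h y ^+ 2 * poisson e (x - y)))))).
  apply: le_Rint => //; first exact: L1Z.
  move=> x _.
  have [k1 k2] := integral_poissonr x e0.
  have l1 : L1 setT (fun y => h x ^+ 2 * poisson e (x - y)) by exact: L1Z.
  have l2 := L1_poisson x e0 h2i.
  have -> : 2^-1 * (pi * h x ^+ 2 + \int[mu]_y (h y ^+ 2 * poisson e (x - y))) =
    \int[mu]_y (2^-1 * (h x ^+ 2 * poisson e (x - y) + h y ^+ 2 * poisson e (x - y))).
    rewrite RintZl//; last exact: (L1D measurableT l1 l2).
    by rewrite RintD// RintZl// k2 [pi * _]mulrC.
  rewrite /conv_poisson -RintZl//; last exact: L1_poisson.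
  apply: le_Rint => //.
  - by apply: L1Z => //; exact: L1_poisson.
  - by apply: L1Z => //; exact: L1D.
  move=> y _; have := poisson_ge0 (x - y) e0; move: (poisson _ _) => p p0.
  have : 0 <= (h x - h y) ^+ 2 * p by rewrite mulr_ge0 ?sqr_ge0.
  by move: (h x) (h y) => hx hy; clear -p0; lra.
rewrite RintZl// RintD//; last exact: L1Z.
rewrite J RintZl//; move: (pi * _) => I0; clear; lra.
Qed.

Lemma invr_natS_gt0 n : 0 < (n.+1%:R : R)^-1. Proof. by rewrite invr_gt0. Qed.

Lemma cvg_exp_harmonic (t : R) : expR (- ((n.+1%:R)^-1 * t)) @[n --> \oo] --> (1 : R).
Proof.
have H : - ((n.+1%:R)^-1 * t) @[n --> \oo] --> (- (0 * t) : R).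
  by apply: cvgN; apply: cvgM; [exact: (@cvg_harmonic R)|exact: cvg_cst].
have K : expR (- ((n.+1%:R)^-1 * t)) @[n --> \oo] --> expR (- (0 * t)).
  by apply: (@cvg_comp _ _ _ (fun n : nat => - ((n.+1%:R)^-1 * t)) expR _ _ _ H); exact: continuous_expR.
by move: K; rewrite mul0r oppr0 expR0.
Qed.

(** By [laplace_energy] and [schur_poisson] the damped energies are bounded
    independently of the damping; Fatou's lemma removes it. The constant is pi
    and not 2 pi since the energy is even and integrated over a half line. *)
Lemma plancherel_le h : L1 setT h -> L1 setT (fun x => h x ^+ 2) ->
  L1 ray (energyT h) /\ \int[mu]_(t in ray) energyT h t <= pi * \int[mu]_x (h x ^+ 2).
Proof.
move=> hi h2i.
have H n := laplace_energy (invr_natS_gt0 n) hi.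
have M0 : 0 <= \int[mu]_x `|h x| by exact: Rintegral_ge0.
apply: (@Fatou_bound _ _ (fun n t => expR (- ((n.+1%:R)^-1 * t)) * energyT h t)) => //.
- by move=> n; have [] := H n.
- by move=> n x _; rewrite mulr_ge0 ?expR_ge0 ?energyT_ge0.
- move=> x _; rewrite -[X in _ --> X]mul1r; apply: cvgM; last exact: cvg_cst.
  exact: cvg_exp_harmonic.
- apply: nearW => n; have [_ k ->] := H n; exact: schur_poisson.
Qed.

(** An approximate identity recovers point values: close to x the function h
    is close to h x, and away from x the kernel is of order e. *)
Lemma conv_poisson_cvg h (M x : R) : L1 setT h -> (forall x, `|h x| <= M) ->
  {for x, continuous h} ->
  conv_poisson (n.+1%:R)^-1 h x @[n --> \oo] --> pi * h x.
Proof.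
move=> hi hM cx.
have M0 : 0 <= M by rewrite (le_trans _ (hM 0)).
apply/cvgrPdist_le => eta eta0.
have pi0 : 0 < (pi : R) by exact: pi_gt0.
pose eta' := eta / (2 * pi).
have eta'0 : 0 < eta' by rewrite divr_gt0// mulr_gt0.
have /cvgrPdist_le/(_ _ eta'0) := cx.
move=> /nbhs_ballP[r /= r0 hr].
(* for |u| >= r one has poisson e u <= (1 + r^-2) e (poisson 1 u) *)
pose C := 2 * M * (1 + r^-2).
have C0 : 0 <= C by rewrite !mulr_ge0// addr_ge0// invr_ge0 exprn_ge0// ltW.
near=> n.
set e := (_^-1).
have e0 : 0 < e by exact: invr_natS_gt0.
have [p1 p2] := integral_poissonr x e0.
have [q1 q2] := integral_poissonr x (@ltr01 R).
have ih := L1_poisson x e0 hi.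
have -> : pi * h x - conv_poisson e h x = \int[mu]_y ((h x - h y) * poisson e (x - y)).
  rewrite mulrC -p2 -RintZl// /conv_poisson -RintB//; last exact: L1Z.
  by apply: eq_Rintegral => y _; rewrite mulrBl.
apply: (@le_trans _ _ (\int[mu]_y (eta' * poisson e (x - y) + C * e * poisson 1 (x - y)))).
  apply: le_Rint_norm => //.
  - rewrite (_ : (fun _ => _) = (fun y => h x * poisson e (x - y) - h y * poisson e (x - y))).
      by apply: L1B => //; exact: L1Z.
    by apply/funext => y; rewrite mulrBl.
  - by apply: L1D => //; exact: L1Z.
  move=> y _; rewrite normrM (ger0_norm (poisson_ge0 _ _))//.
  have [xy|xy] := ltP `|x - y| r.
    rewrite ler_wpDr//; first by rewrite mulr_ge0 ?poisson_ge0// mulr_ge0// ltW.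
    by rewrite ler_wpM2r ?poisson_ge0//; apply: hr.
  rewrite ler_wpDl//; first by rewrite mulr_ge0 ?poisson_ge0// ltW.
  have xy2 : r ^+ 2 <= (x - y) ^+ 2.
    by rewrite -[leRHS]real_normK ?num_real// lerXn2r ?nnegrE// ltW.
  have : `|h x - h y| <= 2 * M.
    by rewrite (le_trans (ler_normB _ _))// mulr2n mulrDl mul1r lerD.
  move: (x - y) xy2 => u xy2 hxy.
  have u0 : 0 < u ^+ 2 by rewrite (lt_le_trans _ xy2)// exprn_gt0.
  rewrite (@le_trans _ _ (2 * M * poisson e u))// ?ler_wpM2r ?poisson_ge0//.
  rewrite /C -!mulrA ler_wpM2l// ler_wpM2l// /poisson mul1r expr1n.
  rewrite mulrCA ler_wpM2l ?(ltW e0)//.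
  rewrite (@le_trans _ _ (u ^+ 2)^-1)//.
    by rewrite lef_pV2 ?posrE// ?lerDr ?sqr_ge0// ltr_wpDr// ?sqr_ge0 // exprn_gt0.
  rewrite ler_pdivlMr ?ltr_wpDr ?sqr_ge0// mulrDr mulr1 mulVf ?gt_eqF// addrC lerD2l.
  by rewrite lef_pV2 ?posrE// exprn_gt0.
rewrite RintD//; [|exact: L1Z..].
rewrite (RintZl eta' measurableT p1) (RintZl (C * e) measurableT q1) q2.
rewrite p2.
have E : eta' * pi = eta / 2.
  by rewrite /eta' invfM mulrA divfK// gt_eqF.
rewrite [leRHS](splitr eta) E lerD2l.
have -> : C * e * pi = e * (C * pi) by ring.
rewrite /e; near: n.
have : (fun n => (n.+1%:R)^-1 * (C * pi)) n @[n --> \oo] --> (0 * (C * pi) : R).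
  by apply: cvgM; [exact: (@cvg_harmonic R)|exact: cvg_cst].
rewrite mul0r => /cvgrPdist_le/(_ (eta / 2)); rewrite divr_gt0// => /(_ isT).
apply: filterS => n; rewrite sub0r normrN ger0_norm// mulr_ge0//.
  by rewrite mulr_ge0// ltW.
Unshelve. all: by end_near. Qed.

(** Here the damped energies are computed in the limit: [conv_poisson_cvg]
    turns them into the integral of pi h^2, and each is at most the undamped
    energy. A jump of h is allowed where h vanishes, which covers functions
    cut off at the origin. *)
Lemma plancherel_ge h (M : R) : L1 setT h -> L1 setT (fun x => h x ^+ 2) ->
  (forall x, `|h x| <= M) -> (forall x, h x = 0 \/ {for x, continuous h}) ->
  L1 ray (energyT h) ->
  pi * \int[mu]_x (h x ^+ 2) <= \int[mu]_(t in ray) energyT h t.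
Proof.
move=> hi h2i hM hc eL.
have H n := laplace_energy (invr_natS_gt0 n) hi.
have M0 : 0 <= M by rewrite (le_trans _ (hM 0)).
have bnd n x : `|conv_poisson (n.+1%:R)^-1 h x| <= M * pi.
  have e0 := invr_natS_gt0 n; set e := (_^-1) in e0 *.
  have [p1 p2] := integral_poissonr x e0.
  have -> : M * pi = \int[mu]_y (M * poisson e (x - y)) by rewrite (RintZl M measurableT p1) p2.
  apply: le_Rint_norm => //; [exact: L1_poisson|exact: L1Z|].
  by move=> y _; rewrite normrM (ger0_norm (poisson_ge0 _ _))// ler_wpM2r ?poisson_ge0.
have mh := L1_measurable hi.
have [||||i1 i2] := @Rintegral_dominated R setT (fun n x => h x * conv_poisson (n.+1%:R)^-1 h x)
   (fun x => h x * (pi * h x)) (fun x => M * pi * `|h x|) measurableT.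
- by move=> n; have [_ k _] := H n; exact: L1_measurable k.
- by apply: L1Z => //; exact: L1_norm.
- move=> x _; have [->|cx] := hc x.
    by under eq_fun do rewrite mul0r; rewrite mul0r; exact: cvg_cst.
  apply: cvgM; first exact: cvg_cst.
  exact: (conv_poisson_cvg hi hM).
- by move=> n x _; rewrite normrM mulrC ler_wpM2r.
have -> : pi * \int[mu]_x (h x ^+ 2) = \int[mu]_x (h x * (pi * h x)).
  by rewrite -RintZl//; apply: eq_Rintegral => x _; ring.
rewrite -(cvg_lim _ i2)//; apply: limr_le; first by apply/cvg_ex; eexists; exact: i2.
apply: nearW => n; have [k1 _ <-] := H n; apply: le_Rint => // t.
rewrite /= in_itv/= andbT => t0; rewrite ler_piMl ?energyT_ge0//.
by rewrite -expR0 ler_expR oppr_le0 mulr_ge0// ltW.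
Qed.

End Transforms.

(** * Causal convolutions and Volterra equations *)

Section Volterra.
Context {R : realType}.
Notation mu := (@lebesgue_measure R).
Notation ray := (`[0, +oo[%classic : set R).
Implicit Types (u v q f : R -> R).

Definition causal u t := if 0 < t then u t else 0.

Lemma causal_indic u : causal u = (fun t => u t * \1_(`]0, +oo[%classic : set R) t).
Proof.
apply/funext => t; rewrite /causal indicE; case: ifPn => t0.
  by rewrite mem_set ?mulr1//= in_itv/= t0.
by rewrite memNset ?mulr0//= in_itv/= andbT; apply/negP.
Qed.

Lemma measurable_causal u : measurable_fun setT u -> measurable_fun setT (causal u).
Proof.
by move=> mu'; rewrite causal_indic; apply: measurable_funM => //; exact: measurable_indic.
Qed.

Lemma L1_causal u : L1 ray u <-> L1 setT (causal u).
Proof.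
have mo : measurable (`]0, +oo[%classic : set R) by exact: measurable_itv.
have E : L1 ray u <-> L1 (`]0, +oo[%classic : set R) u.
  split => H.
    by apply: L1_sub H => // t /=; rewrite !in_itv/= !andbT => /ltW.
  constructor; apply/integrableP; case: H => /integrableP [m1 m2].
  have m3 : measurable_fun ray (EFin \o u).
    by apply/measurable_EFinP/measurable_fun_itv_obnd_cbndP/measurable_EFinP; exact: m1.
  split; first exact: m3.
  rewrite -integral_itv_obnd_cbnd//; apply: measurableT_comp => //.
rewrite E causal_indic; exact: L1_mkcond.
Qed.

Lemma Rint_causal u : measurable_fun setT u ->
  \int[mu]_t causal u t = \int[mu]_(t in ray) u t.
Proof.
move=> mu'; rewrite causal_indic -Rintegral_mkind /Rintegral.
rewrite integral_itv_obnd_cbnd//; apply/measurable_EFinP; exact: measurable_funTS.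
Qed.

Definition convol u v t := \int[mu]_s (u (t - s) * v s).

Section convolution.
Variables (u v : R -> R) (Mu : R).
Hypotheses (iu : L1 setT u) (iv : L1 setT v) (uM : forall t, `|u t| <= Mu).

Let mu_ := L1_measurable iu.
Let mv_ := L1_measurable iv.

(** Exchanging the integrals moves the translation from u to k; for k a sine
    or cosine the addition formulas then give the convolution theorems below. *)
Lemma convol_fubini (k : R -> R) : measurable_fun setT k -> (forall t, `|k t| <= 1) ->
  L1 setT (fun t => convol u v t * k t) /\
  \int[mu]_t (convol u v t * k t) =
  \int[mu]_s (v s * \int[mu]_t (u t * k (t + s))).
Proof.
move=> mk k1.
have iu' s : L1 setT (fun t => u (t - s)) by have [] := L1_shift (- s) iu.
have i1 t : L1 setT (fun s => u (t - s) * v s).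
  under eq_fun do rewrite mulrC.
  apply: (L1_bounded (M := Mu)) => //.
  by apply: (measurableT_comp mu_); measurable_by_parts.
have [||||||j1 _ j3] := @Fubini_le R (fun t s => u (t - s) * v s * k t)
  (fun t s => `|u (t - s) * v s|).
- by measurable_by_parts; apply: (measurableT_comp mu_); measurable_by_parts.
- apply: measurableT_comp => //.
  by measurable_by_parts; apply: (measurableT_comp mu_); measurable_by_parts.
- by move=> t s; rewrite normrM ler_piMr.
- by move=> t; exact: L1_norm.
- move=> s; apply: L1_norm.
  by under eq_fun do rewrite mulrC; exact: L1Z.
- rewrite (_ : (fun _ => _) = (fun s => (\int[mu]_t `|u t|) * `|v s|)).
    by apply: L1Z => //; exact: L1_norm.
  apply/funext => s; under eq_Rintegral do rewrite normrM.
  rewrite RintZr//; last exact: L1_norm.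
  by congr (_ * _); have [_ ->] := L1_shift (- s) (L1_norm iu).
have e1 t : \int[mu]_s (u (t - s) * v s * k t) = convol u v t * k t by rewrite RintZr.
split.
  by move: j1; under eq_fun do rewrite e1.
transitivity (\int[mu]_t \int[mu]_s (u (t - s) * v s * k t)).
  by apply: eq_Rintegral => t _.
rewrite j3; apply: eq_Rintegral => s _.
have iuk : L1 setT (fun t => u t * k (t + s)).
  apply: (L1_bounded (M := 1)) => //; apply: (measurableT_comp mk); measurable_by_parts.
have [_ <-] := L1_shift (- s) iuk.
rewrite -RintZl//; last by have [] := L1_shift (- s) iuk.
by apply: eq_Rintegral => t _; rewrite subrK; ring.
Qed.

Lemma L1_convol : L1 setT (convol u v).
Proof.
have [||j1 _] := @convol_fubini (fun=> 1).
- exact: measurable_cst.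
- by move=> t; rewrite normr1.
by move: j1; rewrite (_ : (fun _ => _) = convol u v)//; apply/funext => t; rewrite mulr1.
Qed.

Lemma cosT_convol t : cosT (convol u v) t = cosT u t * cosT v t - sinT u t * sinT v t.
Proof.
rewrite {1}/cosT; have [||_ ->] := @convol_fubini (fun x => cos (t * x)).
- by apply: continuous_measurable_fun; exact: cont_cosl.
- by move=> x; exact: cos_max.
have iC := L1_cos t measurableT iu; have iS := L1_sin t measurableT iu.
have jC := L1_cos t measurableT iv; have jS := L1_sin t measurableT iv.
transitivity (\int[mu]_s (cosT u t * (v s * cos (t * s)) - sinT u t * (v s * sin (t * s)))).
  apply: eq_Rintegral => s _.
  transitivity (v s * \int[mu]_x (cos (t * s) * (u x * cos (t * x)) - sin (t * s) * (u x * sin (t * x)))).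
    by congr (_ * _); apply: eq_Rintegral => x _; rewrite mulrDr cosD; ring.
  rewrite RintB//; [|exact: L1Z..].
  rewrite (RintZl _ measurableT iC) (RintZl _ measurableT iS) -/(cosT u t) -/(sinT u t); ring.
rewrite RintB//; [|exact: L1Z..].
by rewrite (RintZl _ measurableT jC) (RintZl _ measurableT jS).
Qed.

Lemma sinT_convol t : sinT (convol u v) t = sinT u t * cosT v t + cosT u t * sinT v t.
Proof.
rewrite {1}/sinT; have [||_ ->] := @convol_fubini (fun x => sin (t * x)).
- by apply: continuous_measurable_fun; exact: cont_sinl.
- by move=> x; exact: sin_max.
have iC := L1_cos t measurableT iu; have iS := L1_sin t measurableT iu.
have jC := L1_cos t measurableT iv; have jS := L1_sin t measurableT iv.
transitivity (\int[mu]_s (sinT u t * (v s * cos (t * s)) + cosT u t * (v s * sin (t * s)))).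
  apply: eq_Rintegral => s _.
  transitivity (v s * \int[mu]_x (cos (t * s) * (u x * sin (t * x)) + sin (t * s) * (u x * cos (t * x)))).
    by congr (_ * _); apply: eq_Rintegral => x _; rewrite mulrDr sinD; ring.
  rewrite RintD//; [|exact: L1Z..].
  rewrite (RintZl _ measurableT iC) (RintZl _ measurableT iS) -/(cosT u t) -/(sinT u t); ring.
rewrite RintD//; [|exact: L1Z..].
by rewrite (RintZl _ measurableT jC) (RintZl _ measurableT jS).
Qed.

(** The convolution theorem, read on moduli: the transform of v + u * v is the
    product of those of v and of delta_0 + u. *)
Lemma energyT_volterra t :
  energyT (fun s => v s + convol u v s) t =
  ((1 + cosT u t) ^+ 2 + sinT u t ^+ 2) * energyT v t.
Proof.
have iw := L1_convol.
have jC := L1_cos t measurableT iv; have jS := L1_sin t measurableT iv.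
have kC := L1_cos t measurableT iw; have kS := L1_sin t measurableT iw.
rewrite {1}/energyT.
have -> : cosT (fun s => v s + convol u v s) t = cosT v t + cosT (convol u v) t.
  by rewrite /cosT -RintD//; apply: eq_Rintegral => s _; rewrite mulrDl.
have -> : sinT (fun s => v s + convol u v s) t = sinT v t + sinT (convol u v) t.
  by rewrite /sinT -RintD//; apply: eq_Rintegral => s _; rewrite mulrDl.
by rewrite cosT_convol sinT_convol /energyT; ring.
Qed.

End convolution.

Definition damped (e : R) u t := expR (- (e * t)) * u t.

Lemma L1_damped e u M : 0 < e -> measurable_fun setT u -> (forall t, `|u t| <= M) ->
  L1 ray (damped e u).
Proof.
by move=> e0 mu' uM; apply: (L1_bounded (M := M)) => //; [exact: measurable_funTS|exact: L1_exp].
Qed.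

Lemma damped_le e u t : 0 <= e -> 0 <= t -> `|damped e u t| <= `|u t|.
Proof.
move=> e0 t0; rewrite normrM ler_piMl// ger0_norm ?expR_ge0//.
by rewrite -expR0 ler_expR oppr_le0 mulr_ge0.
Qed.

Lemma causal_damped_le e u t M : 0 <= e -> (forall t, `|u t| <= M) ->
  `|causal (damped e u) t| <= M.
Proof.
move=> e0 uM; rewrite /causal; case: ifPn => t0.
  by rewrite (le_trans (damped_le u e0 (ltW t0))).
by rewrite normr0 (le_trans _ (uM 0)).
Qed.

Lemma L1_convol_causal u v t Mu Mv : measurable_fun setT u -> measurable_fun setT v ->
  (forall t, `|u t| <= Mu) -> (forall t, `|v t| <= Mv) ->
  L1 setT (fun s => causal u (t - s) * causal v s).
Proof.
move=> mu' mv' uM vM.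
have M0 : 0 <= Mu by rewrite (le_trans _ (uM 0)).
have M1 : 0 <= Mv by rewrite (le_trans _ (vM 0)).
have i1 : L1 setT (\1_(`[0, t]%classic : set R)).
  by constructor; exact: integrable_indic_itv.
apply: (L1_le _ _ (L1Z (Mu * Mv) _ i1)) => //.
  apply: measurable_funM; last exact: measurable_causal.
  by apply: (measurableT_comp (measurable_causal mu')); measurable_by_parts.
move=> s _; rewrite normrM /causal.
case: (ltP 0 s) => s0; last by rewrite normr0 mulr0 !mulr_ge0// indicE.
case: (ltP 0 (t - s)) => ts; last by rewrite normr0 mul0r !mulr_ge0// indicE.
rewrite indicE mem_set/= ?mulr1; last by rewrite in_itv/= ltW//= -subr_ge0 ltW.
by rewrite ler_pM.
Qed.

(** The exponential is multiplicative, so a damped solution of a Volterra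
    equation solves the damped equation. *)
Lemma convol_damped e u v t Mu Mv : measurable_fun setT u -> measurable_fun setT v ->
  (forall t, `|u t| <= Mu) -> (forall t, `|v t| <= Mv) ->
  convol (causal (damped e u)) (causal (damped e v)) t =
  damped e (convol (causal u) (causal v)) t.
Proof.
move=> mu' mv' uM vM; rewrite /damped /convol.
rewrite -(RintZl _ measurableT (L1_convol_causal t mu' mv' uM vM)).
apply: eq_Rintegral => s _; rewrite /causal.
case: ifPn => _; last by rewrite !mul0r mulr0.
case: ifPn => _; last by rewrite !mulr0.
have -> : - (e * t) = - (e * (t - s)) + - (e * s) by ring.
by rewrite expRD; ring.
Qed.

(** Being only bounded, x has no transform of its own, but its damped version
    has one, and solves the damped equation. Dividing by the symbol there
    costs a factor 1 / delta; the two Plancherel inequalities turn this into a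
    bound on the damped square norm that does not depend on the damping, and
    Fatou's lemma concludes. *)
Lemma volterra_L2 (q x f : R -> R) (M Mq delta : R) :
  measurable_fun setT q -> (forall t, `|q t| <= Mq) -> L1 ray q ->
  continuous x -> (forall t, `|x t| <= M) ->
  measurable_fun setT f -> L1 ray (fun t => f t ^+ 2) ->
  (forall t, 0 < t -> x t + convol (causal q) (causal x) t = f t) ->
  0 < delta ->
  (\forall n \near \oo, forall l, 0 <= l ->
     delta <= (1 + cosT (causal (damped (n.+1%:R)^-1 q)) l) ^+ 2 +
              sinT (causal (damped (n.+1%:R)^-1 q)) l ^+ 2) ->
  L1 setT (fun t => causal x t ^+ 2).
Proof.
move=> mq qM iq cx xM mf if2 xf d0 low.
have mx : measurable_fun setT x by exact: continuous_measurable_fun.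
pose v n := causal (damped (n.+1%:R)^-1 x).
pose B := delta^-1 * \int[mu]_(t in ray) (f t ^+ 2).
have mexp (e : R) : measurable_fun setT (fun t : R => expR (- (e * t))).
  by apply: continuous_measurable_fun; apply: isd_ex_cont => t; eexists; isd.
have iv n : L1 setT (v n).
  by apply/L1_causal; apply: (L1_damped (M := M)) => //; exact: invr_natS_gt0.
have vM n t : `|v n t| <= M by apply: causal_damped_le => //; exact: ltW (invr_natS_gt0 n).
have v2 n : L1 setT (fun t => v n t ^+ 2).
  rewrite (_ : (fun _ => _) = (fun t => v n t * v n t)); last by apply/funext => t; rewrite expr2.
  by apply: (L1_bounded (M := M)) => //; exact: L1_measurable (iv n).
have main n : (forall l, 0 <= l ->
     delta <= (1 + cosT (causal (damped (n.+1%:R)^-1 q)) l) ^+ 2 +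
              sinT (causal (damped (n.+1%:R)^-1 q)) l ^+ 2) ->
    \int[mu]_t (v n t ^+ 2) <= B.
  move=> lown; have e0 := @invr_natS_gt0 R n; have := iv n; have := vM n; have := v2 n.
  rewrite /v; set e := (_^-1) in e0 lown *.
  set u := causal (damped e q) in lown *.
  set ve := causal _ => v2' vM' iv'.
  have reduced_weight' : measurable_fun setT (damped e q) by apply: measurable_funM.
  have iu : L1 setT u by apply/L1_causal; exact: (L1_damped (M := Mq)).
  have uM t : `|u t| <= Mq by apply: causal_damped_le => //; exact: ltW.
  pose phi t := ve t + convol u ve t.
  (* the right-hand side of the damped equation is the damped f, cut off at 0 *)
  have phiE : phi = causal (damped e f).
    apply/funext => t; rewrite /phi (convol_damped _ _ mq mx qM xM) /ve /causal.
    case: ifPn => t0; first by rewrite /damped -xf// mulrDr.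
    rewrite add0r /damped /convol [X in _ * X](_ : _ = 0) ?mulr0//.
    rewrite -[RHS](mul0r (fine (mu setT))) -Rintegral_cst//.
    apply: eq_Rintegral => s _; rewrite /causal.
    case: ltP => ts; last by rewrite mul0r.
    case: ltP => s0; last by rewrite mulr0.
    by case/negP: t0; apply: (lt_trans s0); rewrite -subr_gt0.
  have iphi : L1 setT phi by apply: L1D => //; exact: (L1_convol iu iv' uM).
  have f2' : L1 setT (causal (fun t => f t ^+ 2)) by apply/L1_causal.
  have phi2le t : `|phi t ^+ 2| <= causal (fun t => f t ^+ 2) t.
    rewrite phiE /causal; case: ifPn => t0; last by rewrite expr0n/= normr0.
    rewrite normrX -[leRHS]real_normK ?num_real// lerXn2r ?nnegrE//.
    by apply: damped_le; exact: ltW.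
  have iphi2 : L1 setT (fun t => phi t ^+ 2).
    by apply: (L1_le _ _ f2') => //; apply: measurable_funX; exact: L1_measurable iphi.
  have Iphi2 : \int[mu]_t (phi t ^+ 2) <= \int[mu]_(t in ray) (f t ^+ 2).
    rewrite -Rint_causal; last exact: measurable_funX.
    by apply: le_Rint => // t _; rewrite (le_trans (ler_norm _)).
  have [p1 p2] := plancherel_le iphi iphi2.
  have lev t : ray t -> `|energyT ve t| <= delta^-1 * energyT phi t.
    rewrite /= in_itv/= andbT => t0; rewrite ger0_norm ?energyT_ge0//.
    rewrite /phi (energyT_volterra iu iv' uM) mulrA ler_peMl ?energyT_ge0//.
    by rewrite ler_pdivlMl// mulr1 lown.
  have iEv : L1 ray (energyT ve).
    apply: (L1_le _ _ (L1Z delta^-1 _ p1)) => //.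
    by apply: measurable_funTS; exact: measurable_energyT.
  have := plancherel_ge iv' v2' vM' _ iEv.
  have vc t : ve t = 0 \/ {for t, continuous ve}.
    rewrite /ve; have [t0|t0] := ltP 0 t; last by left; rewrite /causal ltNge t0.
    right; have cd : {for t, continuous (damped e x)}.
      have cexp : continuous (fun s : R => expR (- (e * s))).
        by apply: isd_ex_cont => y; eexists; isd.
      by apply: cvgM; [exact: cexp|exact: cx].
    have e1 : causal (damped e x) t = damped e x t by rewrite /causal t0.
    suff : causal (damped e x) y @[y --> t] --> damped e x t by rewrite -e1.
    apply: cvg_trans cd; apply: near_eq_cvg; near=> y.
    by rewrite /causal ifT//; near: y; exact: lt_nbhsr.
  move=> /(_ vc) => H.
  have pi0 : 0 < (pi : R) by exact: pi_gt0.
  rewrite -(ler_pM2l pi0) (le_trans H)//.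
  apply: (@le_trans _ _ (\int[mu]_(t in ray) (delta^-1 * energyT phi t))).
    by apply: le_Rint => //; [exact: L1Z|move=> t /lev; rewrite ger0_norm ?energyT_ge0].
  rewrite (RintZl _ _ p1)// /B mulrCA ler_wpM2l ?invr_ge0 ?(ltW d0)//.
  by rewrite (le_trans p2)// ler_wpM2l// ltW.
have [|||H _] := @Fatou_bound R setT (fun n t => v n t ^+ 2) (fun t => causal x t ^+ 2) B measurableT v2.
- by move=> n t _; exact: sqr_ge0.
- move=> t _; suff H : v n t @[n --> \oo] --> causal x t by apply: cvgM.
  rewrite /v /causal; case: ifPn => _; last exact: cvg_cst.
  rewrite /damped -[X in _ --> X]mul1r; apply: cvgM; last exact: cvg_cst.
  exact: cvg_exp_harmonic.
- by move: low; apply: filterS => n; exact: main.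
- by [].
Unshelve. all: by end_near. Qed.
End Volterra.

(** * Kernels whose density vanishes near the origin *)

Section Kernel.
Context {R : realType}.
Notation ray := (`[0, +oo[%classic : set R).

(** Integrating by parts, t sinT g t = cosT g' t. Plancherel for g and g' then
    makes (1 + t^2) (sinT g t)^2 integrable, and the Cauchy-Schwarz inequality
    against 1 / (1 + t^2) makes sinT g integrable. *)
Lemma kernel_L1 (g g' : R -> R) :
  (forall x : R, isder g x (g' x)) -> continuous g' ->
  L1 setT g -> L1 setT g' ->
  L1 setT (fun x => g x ^+ 2) -> L1 setT (fun x => g' x ^+ 2) ->
  g x @[x --> +oo] --> (0 : R) -> g (- x) @[x --> +oo] --> (0 : R) ->
  L1 ray (sinT g).
Proof.
move=> dg cg' ig ig' ig2 ig'2 gy gNy.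
have tk t : t * sinT g t = cosT g' t.
  have iC := L1_cos t measurableT ig'; have iS := L1_sin t measurableT ig.
  apply/eqP; rewrite -subr_eq0 -opprB oppr_eq0; apply/eqP.
  rewrite /sinT /cosT -(RintZl _ measurableT iS) -RintB//; last exact: L1Z.
  apply: (@FTC_line _ (fun x => g x * cos (t * x))).
  - by move=> x; have dgx := dg x; apply: isd_eq; [isd|rewrite /=; ring].
  - have cg : continuous g := is_derive_continuous dg.
    move=> x; apply: cvgB; apply: cvgM; [exact: cg'|exact: cont_cosl|exact: cvg_cst|].
    by apply: cvgM; [exact: cg|exact: cont_sinl].
  - by apply: L1B => //; exact: L1Z.
  - rewrite -(subr0 0); apply: cvgB.
      by apply: (cvg_0_bounded (M := 1)) => // x; exact: cos_max.
    by apply: (@cvg_0_bounded _ (fun x => g (- x)) (fun x => cos (t * - x)) 1) => // x; exact: cos_max.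
have [e1 _] := plancherel_le ig ig2; have [e2 _] := plancherel_le ig' ig'2.
have p1 : L1 ray (poisson 1).
  by apply: (L1_sub measurableT) => //; have [] := integral_poisson0 (@ltr01 R).
have H : L1 ray (fun t => 2^-1 * (poisson 1 t + (energyT g t + energyT g' t))).
  by apply: L1Z => //; apply: L1D => //; exact: L1D.
apply: (L1_le _ _ H) => //.
  by apply: measurable_funTS; exact: measurable_sinT.
move=> t _.
apply: (@le_trans _ _ (2^-1 * (poisson 1 t + (1 + t ^+ 2) * sinT g t ^+ 2))).
  rewrite /poisson expr1n div1r.
  have w0 : 0 < 1 + t ^+ 2 by rewrite ltr_wpDr ?sqr_ge0.
  rewrite -[sinT g t ^+ 2]real_normK ?num_real//.
  move: (1 + t ^+ 2) (`|sinT g t|) w0 => w k w0; clear -w0.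
  have -> : w^-1 + w * k ^+ 2 = (w * k - 1) ^+ 2 / w + 2 * k by field; rewrite gt_eqF.
  have : 0 <= (w * k - 1) ^+ 2 / w by rewrite divr_ge0 ?sqr_ge0// ltW.
  by move: (_ / w) => z; lra.
rewrite ler_wpM2l ?invr_ge0// lerD2l mulrDl mul1r -exprMn tk /energyT.
by rewrite lerD// ?lerDr ?lerDl sqr_ge0.
Qed.

Section gap.
Variables (a a' : R -> R) (nu0 l0 Ma Ma' : R).
Hypotheses (l00 : 0 < l0) (l0nu0 : l0 < nu0)
  (da : forall x : R, isder a x (a' x)) (ca' : continuous a')
  (aM : forall x, `|a x| <= Ma) (a'M : forall x, `|a' x| <= Ma')
  (a0 : forall x, `|x| <= nu0 -> a x = 0)
  (ia : L1 setT (fun x => a x ^+ 2)).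
Variables (m m' : R -> R) (C : R).
Hypotheses (dm : forall x : R, l0 < `|x| -> isder m x (m' x))
  (cm' : forall x : R, l0 < `|x| -> {for x, continuous m'})
  (mC : forall x, nu0 <= `|x| -> `|m x| <= C / `|x|)
  (m'C : forall x, nu0 <= `|x| -> `|m' x| <= C).

Let nu00 : 0 < nu0. Proof. exact: lt_trans l0nu0. Qed.
Let g x := a x ^+ 2 * m x.
Let g' x := 2 * a x * a' x * m x + a x ^+ 2 * m' x.

Let ca : continuous a := is_derive_continuous da.
Let ma : measurable_fun setT a := continuous_measurable_fun ca.

Let C0 : 0 <= C.
Proof. by rewrite (le_trans _ (m'C (x := nu0) _))// ger0_norm// ltW. Qed.
Let Ma0 : 0 <= Ma. Proof. by rewrite (le_trans _ (aM 0)). Qed.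
Let Ma'0 : 0 <= Ma'. Proof. by rewrite (le_trans _ (a'M 0)). Qed.

Let near_gap (x : R) : `|x| < nu0 -> \forall y \near x, `|y| < nu0.
Proof.
move=> xn; apply/nbhs_ballP; exists (nu0 - `|x|) => /=; first by rewrite subr_gt0.
move=> y; rewrite /ball/= => xy.
have : `|y| <= `|x| + `|x - y|.
  by rewrite -{1}(subKr x y) (le_trans (ler_normB _ _)).
by move: xy; move: (`|x - y|) (`|y|) (`|x|) => p q r; lra.
Qed.

Let dg (x : R) : isder g x (g' x).
Proof.
have [xn|xn] := ltP `|x| nu0.
  have gx : g' x = 0 by rewrite /g' a0 ?ltW// mulr0 !mul0r expr0n/= mul0r addr0.
  rewrite gx /isder.
  apply: (@near_eq_is_derive _ _ _ (fun=> 0)).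
  near=> y; rewrite /g a0 ?expr0n ?mul0r//; apply: ltW; near: y; exact: near_gap.
have dax := da x; have dmx := dm (lt_le_trans l0nu0 xn).
rewrite /g (_ : (fun x => _) = (fun x => a x * a x * m x)); last by apply/funext => y; rewrite expr2.
by apply: isd_eq; [isd|rewrite /= /g'; ring].
Unshelve. all: by end_near. Qed.

Let cg' : continuous g'.
Proof.
move=> x; have [xn|xn] := ltP `|x| nu0.
  have gx : g' x = 0 by rewrite /g' a0 ?ltW// mulr0 !mul0r expr0n/= mul0r addr0.
  rewrite /continuous_at gx; apply: cvg_near_cst; near=> y.
  by rewrite /g' a0 ?mulr0 ?mul0r ?expr0n/= ?mul0r ?addr0//; apply: ltW; near: y; exact: near_gap.
have xl := lt_le_trans l0nu0 xn.
have cm : {for x, continuous m}.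
  by apply: differentiable_continuous; apply/derivable1_diffP;
     have dmx : is_derive x 1 m (m' x) := dm xl; exact: ex_derive.
apply: cvgD; apply: cvgM.
- by apply: cvgM; [apply: cvgM; [exact: cvg_cst|exact: ca]|exact: ca'].
- exact: cm.
- by apply: cvgM; exact: ca.
- exact: cm'.
Unshelve. all: by end_near. Qed.

Let gap_cases (x : R) : a x = 0 \/ nu0 <= `|x|.
Proof. by have [xn|xn] := ltP `|x| nu0; [left; apply: a0; exact: ltW|right]. Qed.

Let mnu0 (x : R) : nu0 <= `|x| -> `|m x| <= C / nu0.
Proof.
move=> xn; rewrite (le_trans (mC xn))// ler_wpM2l// lef_pV2// ?posrE//.
exact: lt_le_trans xn.
Qed.

Let g_le (x : R) : `|g x| <= C / nu0 * a x ^+ 2.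
Proof.
rewrite /g; have [->|xn] := gap_cases x; first by rewrite expr0n/= mul0r mulr0 normr0.
by rewrite normrM normrX real_normK ?num_real// mulrC ler_wpM2r ?sqr_ge0// mnu0.
Qed.

Let g'_le (x : R) : `|g' x| <= `|a x| * (2 * Ma' * (C / nu0) + Ma * C).
Proof.
rewrite /g'; have [->|xn] := gap_cases x.
  by rewrite expr0n/= !(mul0r, mulr0) addr0 normr0 mul0r.
rewrite (le_trans (ler_normD _ _))// mulrDr lerD//.
  rewrite !normrM (ger0_norm (_ : 0 <= 2))// -!mulrA mulrCA ler_wpM2l// ler_wpM2l// ler_pM//.
  exact: mnu0.
rewrite normrM normrX expr2 -mulrA ler_wpM2l// ler_pM//; exact: m'C.
Qed.

(** In 2 a a' m only one factor a is available for decay. The weight m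
    supplies a factor 1 / |x| on the support of a, and the product of two
    square integrable functions is integrable. *)
Let g'_le1 (x : R) : `|g' x| <= Ma' * C * (a x ^+ 2 + (1 + nu0 ^- 2) * poisson 1 x) + C * a x ^+ 2.
Proof.
rewrite /g'; have [->|xn] := gap_cases x.
  rewrite expr0n/= !(mul0r, mulr0) addr0 normr0 add0r addr0.
  apply: mulr_ge0; [exact: mulr_ge0|apply: mulr_ge0; last exact: poisson_ge0].
  by rewrite addr_ge0// invr_ge0 sqr_ge0.
have x0 : 0 < `|x| by exact: lt_le_trans xn.
rewrite (le_trans (ler_normD _ _))// lerD//; last first.
  by rewrite normrM normrX real_normK ?num_real// mulrC ler_wpM2r ?sqr_ge0// m'C.
rewrite !normrM (ger0_norm (_ : 0 <= 2))//.
apply: (@le_trans _ _ (2 * `|a x| * Ma' * (C / `|x|))).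
  by rewrite !ler_pM// ?mulr_ge0// mC.
have -> : 2 * `|a x| * Ma' * (C / `|x|) = Ma' * C * (2 * `|a x| * `|x|^-1) by ring.
rewrite ler_wpM2l ?mulr_ge0//.
apply: (@le_trans _ _ (a x ^+ 2 + `|x|^-1 ^+ 2)).
  rewrite -[a x ^+ 2]real_normK ?num_real//.
  move: `|a x| (`|x|^-1) => p q; clear.
  by rewrite -subr_ge0 (_ : _ - _ = (p - q) ^+ 2) ?sqr_ge0//; ring.
rewrite lerD2l /poisson expr1n div1r ler_pdivlMr ?ltr_wpDr ?sqr_ge0//.
rewrite mulrDr mulr1 -[x ^+ 2 in leLHS]real_normK ?num_real// exprVn mulVf ?expf_neq0 ?gt_eqF//.
by rewrite addrC lerD2l lef_pV2 ?posrE ?exprn_gt0// lerXn2r ?nnegrE// ltW.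
Qed.

Let mg : measurable_fun setT g.
Proof. by apply: continuous_measurable_fun; exact: is_derive_continuous dg. Qed.
Let mg' : measurable_fun setT g'.
Proof. by apply: continuous_measurable_fun; exact: cg'. Qed.

Lemma gap_continuous : continuous g.
Proof. exact: is_derive_continuous dg. Qed.

Lemma gap_bounded x : `|g x| <= C / nu0 * Ma ^+ 2.
Proof.
rewrite (le_trans (g_le x))// ler_wpM2l ?divr_ge0 ?(ltW nu00)//.
by rewrite -[leLHS]real_normK ?num_real// lerXn2r ?nnegrE.
Qed.

Lemma gap_L1 : L1 setT g.
Proof. by apply: (L1_le _ _ (L1Z (C / nu0) _ ia)) => // x _; exact: g_le. Qed.

Let g_to0 (s : R) : `|s| = 1 -> g (s * x) @[x --> +oo] --> (0 : R).
Proof.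
move=> s1; apply: norm_cvg0.
apply: (@squeeze_cvgr _ _ _ _ (cst 0) (fun x => Ma ^+ 2 * C * x^-1)).
- near=> x; rewrite normr_ge0/=.
  have xn : nu0 <= x by near: x; apply: nbhs_pinfty_ge; exact: num_real.
  have x0 : 0 < x by exact: lt_le_trans xn.
  have sx : `|s * x| = x by rewrite normrM s1 mul1r gtr0_norm.
  rewrite /g normrM normrX -mulrA ler_pM// ?lerXn2r ?nnegrE//.
  by have := mC (x := s * x); rewrite sx; exact.
- exact: cvg_cst.
- rewrite -[X in _ --> X](mulr0 (Ma ^+ 2 * C)); apply: cvgM; first exact: cvg_cst.
  have h0 : \forall x \near +oo, 0 < (x : R) by apply: nbhs_pinfty_gt; exact: num_real.
  exact: (proj2 (gtr0_cvgV0 h0) cvg_id).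
Unshelve. all: by end_near. Qed.

(** The weight m may be singular anywhere in [-l0, l0]: a vanishes on the
    larger interval [-nu0, nu0], so a^2 m is continuously differentiable on
    the whole line and [kernel_L1] applies. *)
Lemma gap_kernel_L1 : L1 ray (sinT g).
Proof.
apply: (@kernel_L1 _ g') => //.
- exact: gap_L1.
- have i1 : L1 setT (poisson (1:R)) by have [] := integral_poisson0 (@ltr01 R).
  have H : L1 setT (fun x => Ma' * C * (a x ^+ 2 + (1 + nu0 ^- 2) * poisson 1 x) + C * a x ^+ 2).
    by apply: L1D => //; [apply: L1Z => //; apply: L1D => //|]; exact: L1Z.
  by apply: (L1_le _ _ H) => // x _; exact: g'_le1.
- apply: (L1_le _ _ (L1Z ((C / nu0 * Ma) ^+ 2) _ ia)) => //; first exact: measurable_funX.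
  move=> x _; rewrite normrX -[a x ^+ 2]real_normK ?num_real// -exprMn lerXn2r ?nnegrE//.
    by rewrite !mulr_ge0// invr_ge0 ltW.
  rewrite (le_trans (g_le x))// -[leRHS]mulrA ler_wpM2l ?divr_ge0// ?(ltW nu00)//.
  by rewrite -[a x ^+ 2]real_normK ?num_real// expr2 ler_wpM2r.
- apply: (L1_le _ _ (L1Z ((2 * Ma' * (C / nu0) + Ma * C) ^+ 2) _ ia)) => //; first exact: measurable_funX.
  move=> x _; rewrite normrX -[a x ^+ 2]real_normK ?num_real// -exprMn lerXn2r ?nnegrE//.
    by rewrite !(mulr_ge0, addr_ge0)// invr_ge0 ltW.
  by rewrite mulrC g'_le.
- have := g_to0 (normr1 R); by under eq_fun do rewrite mul1r.
- have := @g_to0 (-1) (normrN1 R); by under eq_fun do rewrite mulN1r.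
Qed.

End gap.
End Kernel.

(** * Damped transforms of kernels *)

Section Dispersion.
Context {R : realType}.
Notation mu := (@lebesgue_measure R).
Notation ray := (`[0, +oo[%classic : set R).

Lemma cosT_causal (h : R -> R) l : measurable_fun setT h ->
  cosT (causal h) l = \int[mu]_(t in ray) (h t * cos (l * t)).
Proof.
move=> mh; rewrite -Rint_causal; last first.
  apply: measurable_funM => //; apply: continuous_measurable_fun; exact: cont_cosl.
by apply: eq_Rintegral => t _; rewrite /causal; case: ifP => _ //; rewrite mul0r.
Qed.

Lemma sinT_causal (h : R -> R) l : measurable_fun setT h ->
  sinT (causal h) l = \int[mu]_(t in ray) (h t * sin (l * t)).
Proof.
move=> mh; rewrite -Rint_causal; last first.
  apply: measurable_funM => //; apply: continuous_measurable_fun; exact: cont_sinl.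
by apply: eq_Rintegral => t _; rewrite /causal; case: ifP => _ //; rewrite mul0r.
Qed.

Lemma measurable_expM (e : R) : measurable_fun setT (fun t : R => expR (- (e * t))).
Proof. by apply: continuous_measurable_fun; apply: isd_ex_cont => x; eexists; isd. Qed.

Lemma measurable_damped (e : R) (u : R -> R) : measurable_fun setT u ->
  measurable_fun setT (damped e u).
Proof. by move=> mu'; apply: measurable_funM => //; exact: measurable_expM. Qed.

(** Pi times the conjugate Poisson kernel, a regularisation of 1 / u. *)
Definition hilbert_kernel (e u : R) := u / (e ^+ 2 + u ^+ 2).

(** This formula and the next are the two halves of Plemelj's formula before
    the passage to the limit: the half-line cosine transform of sinT g is a
    regularised principal value of the density g, the sine transform an
    average that tends to a point value. Both come from exchanging integrals
    and from the Laplace transforms of sine and cosine. *)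
Lemma cosT_damped (g : R -> R) (e l : R) : 0 < e -> L1 setT g ->
  cosT (causal (damped e (sinT g))) l =
  \int[mu]_x (g x * (2^-1 * (hilbert_kernel e (x + l) + hilbert_kernel e (x - l)))).
Proof.
move=> e0 ig; have mg := L1_measurable ig.
rewrite cosT_causal; last by apply: measurable_damped; exact: measurable_sinT.
have me := measurable_expM e.
transitivity (\int[mu]_(t in ray) \int[mu]_x (expR (- (e * t)) * (cos (l * t) * (g x * sin (t * x))))).
  apply: eq_Rintegral => t _.
  transitivity (expR (- (e * t)) * cos (l * t) * sinT g t); first by rewrite /damped; ring.
  rewrite -(RintZl _ measurableT (L1_sin t measurableT ig)).
  by apply: eq_Rintegral => x _; ring.
have [||||_ _ ->] := @Fubini_dom R ray setT
  (fun t x => expR (- (e * t)) * (cos (l * t) * (g x * sin (t * x))))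
  (fun t => expR (- (e * t))) (fun x => `|g x|) (measurable_itv _) measurableT.
- measurable_by_parts.
- exact: L1_exp.
- exact: L1_norm.
- move=> t x _ _; rewrite !normrM (ger0_norm (expR_ge0 _)) ler_wpM2l ?expR_ge0//.
  by rewrite -[leRHS]mul1r ler_pM ?cos_max// ler_piMr// sin_max.
apply: eq_Rintegral => x _.
have i1 := L1_expsin (x + l) e0; have i2 := L1_expsin (x - l) e0.
transitivity (\int[mu]_(t in ray) (g x * (2^-1 * (expR (- (e * t)) * sin ((x + l) * t) +
   expR (- (e * t)) * sin ((x - l) * t))))).
  apply: eq_Rintegral => t _.
  by rewrite mulrDl mulrBl sinD sinB [t * x]mulrC; field.
rewrite RintZl//; last by apply: L1Z => //; exact: L1D.
rewrite RintZl//; last exact: L1D.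
by rewrite RintD// !laplace_sin.
Qed.

Lemma sinT_damped (g : R -> R) (e l : R) : 0 < e -> L1 setT g ->
  sinT (causal (damped e (sinT g))) l =
  2^-1 * (conv_poisson e g l - conv_poisson e g (- l)).
Proof.
move=> e0 ig; have mg := L1_measurable ig.
rewrite sinT_causal; last by apply: measurable_damped; exact: measurable_sinT.
have me := measurable_expM e.
transitivity (\int[mu]_(t in ray) \int[mu]_x (expR (- (e * t)) * (sin (l * t) * (g x * sin (t * x))))).
  apply: eq_Rintegral => t _.
  transitivity (expR (- (e * t)) * sin (l * t) * sinT g t); first by rewrite /damped; ring.
  rewrite -(RintZl _ measurableT (L1_sin t measurableT ig)).
  by apply: eq_Rintegral => x _; ring.
have [||||_ _ ->] := @Fubini_dom R ray setT
  (fun t x => expR (- (e * t)) * (sin (l * t) * (g x * sin (t * x))))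
  (fun t => expR (- (e * t))) (fun x => `|g x|) (measurable_itv _) measurableT.
- measurable_by_parts.
- exact: L1_exp.
- exact: L1_norm.
- move=> t x _ _; rewrite !normrM (ger0_norm (expR_ge0 _)) ler_wpM2l ?expR_ge0//.
  by rewrite -[leRHS]mul1r ler_pM ?sin_max// ler_piMr// sin_max.
have j1 := L1_poisson l e0 ig; have j2 := L1_poisson (- l) e0 ig.
rewrite /conv_poisson -RintB// -RintZl//; last exact: L1B.
apply: eq_Rintegral => x _.
have i1 := L1_expcos (l - x) e0; have i2 := L1_expcos (- l - x) e0.
transitivity (\int[mu]_(t in ray) (g x * (2^-1 * (expR (- (e * t)) * cos ((l - x) * t) -
   expR (- (e * t)) * cos ((- l - x) * t))))).
  apply: eq_Rintegral => t _.
  have -> : (- l - x) * t = - (l * t + x * t) by ring.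
  by rewrite cosN mulrBl cosB cosD [t * x]mulrC; field.
rewrite RintZl//; last by apply: L1Z => //; exact: L1B.
rewrite RintZl//; last exact: L1B.
by rewrite RintB// !laplace_cos// /poisson; ring.
Qed.

End Dispersion.

(** * The two spectral weights *)

Section Multipliers.
Context {R : realType}.

Lemma isdV (f : R -> R) (x b : R) : f x != 0 -> isder f x b ->
  isder (fun t => (f t)^-1) x (- b / f x ^+ 2).
Proof.
rewrite /isder => fx df; have := is_deriveV fx df.
by rewrite /GRing.scale /= mulNr mulrC -mulNr.
Qed.

Lemma isd_cont_at (f : R -> R) (x b : R) : isder f x b -> {for x, continuous f}.
Proof.
rewrite /isder => df; apply: differentiable_continuous.
by apply/derivable1_diffP; exact: ex_derive.
Qed.

Variables (nu0 l0 : R).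
Hypotheses (l00 : 0 < l0) (l0nu0 : l0 < nu0).
Let nu00 : 0 < nu0. Proof. exact: lt_trans l0nu0. Qed.

(** The odd part of the memory kernel w of the thermostat is the sine
    transform of a^2 times this weight. Dividing once more by x^2 - l0^2 gives
    [reduced_weight], whose kernel governs the motion orthogonal to the
    trapped mode. *)
Definition memory_weight (x : R) := x^-1.
Definition memory_weight' (x : R) := - 1 / x ^+ 2.
Definition reduced_weight (x : R) := (x * (x ^+ 2 - l0 ^+ 2))^-1.
Definition reduced_weight' (x : R) := - (3 * x ^+ 2 - l0 ^+ 2) / (x * (x ^+ 2 - l0 ^+ 2)) ^+ 2.

Let neq0 (x : R) : l0 < `|x| -> x != 0.
Proof. by move=> xl; rewrite -normr_gt0 (lt_trans l00). Qed.

Let sqr_gt (x : R) : l0 < `|x| -> 0 < x ^+ 2 - l0 ^+ 2.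
Proof.
by move=> xl; rewrite subr_gt0 -[x ^+ 2]real_normK ?num_real// ltrXn2r// ?nnegrE// ltW.
Qed.

Let pneq0 (x : R) : l0 < `|x| -> x * (x ^+ 2 - l0 ^+ 2) != 0.
Proof. by move=> xl; apply: mulf_neq0; [exact: neq0|rewrite gt_eqF// sqr_gt]. Qed.

Lemma isder_memory_weight (x : R) : l0 < `|x| -> isder memory_weight x (memory_weight' x).
Proof. by move=> xl; apply: isdV; [exact: neq0|exact: isd_id]. Qed.

Let isd_p (x : R) : isder (fun x => x * (x ^+ 2 - l0 ^+ 2)) x (3 * x ^+ 2 - l0 ^+ 2).
Proof.
rewrite (_ : (fun x => _) = (fun x => x * (x * x + - (l0 ^+ 2)))); last first.
  by apply/funext => y; rewrite expr2.
by apply: isd_eq; [isd|rewrite /=; ring].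
Qed.

Lemma isder_reduced_weight (x : R) : l0 < `|x| -> isder reduced_weight x (reduced_weight' x).
Proof. by move=> xl; apply: isdV; [exact: pneq0|exact: isd_p]. Qed.

Lemma continuous_memory_weight' (x : R) : l0 < `|x| -> {for x, continuous memory_weight'}.
Proof.
move=> xl; apply: cvgM; first exact: cvg_cst.
by apply: cvgV; [rewrite expf_neq0 ?neq0|exact: exprn_continuous].
Qed.

Lemma continuous_reduced_weight' (x : R) : l0 < `|x| -> {for x, continuous reduced_weight'}.
Proof.
move=> xl; apply: cvgM.
  by apply: cvgN; apply: cvgB; [apply: cvgM; [exact: cvg_cst|exact: exprn_continuous]|exact: cvg_cst].
apply: cvgV; first by rewrite expf_neq0 ?pneq0.
apply: (@cvg_comp _ _ _ (fun x => x * (x ^+ 2 - l0 ^+ 2)) (fun y => y ^+ 2)).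
  exact: isd_cont_at (isd_p x).
exact: exprn_continuous.
Qed.

(** A single constant large enough for the four bounds below. *)
Definition gap_const := 1 + nu0 ^- 2 + (nu0 ^+ 2 - l0 ^+ 2)^-1 + 3 * (nu0 ^+ 2 - l0 ^+ 2) ^- 2.

Let d0 : 0 < nu0 ^+ 2 - l0 ^+ 2.
Proof. by apply: sqr_gt; rewrite gtr0_norm. Qed.

Let dx (x : R) : nu0 <= `|x| -> nu0 ^+ 2 - l0 ^+ 2 <= x ^+ 2 - l0 ^+ 2.
Proof.
by move=> xn; rewrite lerD2r -[x ^+ 2]real_normK ?num_real// lerXn2r ?nnegrE// ltW.
Qed.

Lemma memory_weight_le (x : R) : nu0 <= `|x| -> `|memory_weight x| <= gap_const / `|x|.
Proof.
move=> xn; rewrite /memory_weight normfV ler_peMl// /gap_const -!addrA lerDl.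
by rewrite !addr_ge0// ?mulr_ge0 ?invr_ge0 ?sqr_ge0// ltW.
Qed.

Lemma memory_weight'_le (x : R) : nu0 <= `|x| -> `|memory_weight' x| <= gap_const.
Proof.
move=> xn; rewrite /memory_weight' mulN1r normrN normfV normrX.
apply: (@le_trans _ _ (nu0 ^- 2)).
  by rewrite lef_pV2 ?posrE ?exprn_gt0 ?(lt_le_trans nu00)// lerXn2r ?nnegrE// ltW.
rewrite /gap_const -addrA [1 + _]addrC -addrA lerDl.
by rewrite !addr_ge0// ?mulr_ge0 ?invr_ge0 ?sqr_ge0// ltW.
Qed.

Lemma reduced_weight_le (x : R) : nu0 <= `|x| -> `|reduced_weight x| <= gap_const / `|x|.
Proof.
move=> xn; have xl := lt_le_trans l0nu0 xn.
rewrite /reduced_weight invfM normrM normfV mulrC ler_wpM2r ?invr_ge0//.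
rewrite normfV gtr0_norm ?sqr_gt//.
apply: (@le_trans _ _ (nu0 ^+ 2 - l0 ^+ 2)^-1).
  by rewrite lef_pV2 ?dx// posrE ?sqr_gt//; exact: d0.
rewrite /gap_const addrAC lerDr.
by rewrite !addr_ge0// ?mulr_ge0 ?invr_ge0 ?sqr_ge0// ltW.
Qed.

Lemma reduced_weight'_le (x : R) : nu0 <= `|x| -> `|reduced_weight' x| <= gap_const.
Proof.
move=> xn; have xl := lt_le_trans l0nu0 xn.
have x2 : 0 < x ^+ 2 by rewrite exprn_even_gt0//= neq0.
apply: (@le_trans _ _ (3 * (nu0 ^+ 2 - l0 ^+ 2) ^- 2)); last first.
  by rewrite /gap_const lerDr !addr_ge0// ?invr_ge0 ?sqr_ge0// ltW.
rewrite /reduced_weight' normrM normrN normfV exprMn.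
have sx := sqr_gt xl; have dxx := dx xn.
rewrite !ger0_norm; last 2 first.
- by rewrite mulr_ge0 ?sqr_ge0.
- by move: sx x2; move: (x ^+ 2) (l0 ^+ 2) => p q; lra.
rewrite invfM mulrA ler_pM ?invr_ge0 ?sqr_ge0//.
- by rewrite divr_ge0 ?(ltW x2)//; move: sx x2; move: (x ^+ 2) (l0 ^+ 2) => p q; lra.
- by rewrite ler_pdivrMr// gerBl sqr_ge0.
- by rewrite lef_pV2 ?posrE ?exprn_gt0// lerXn2r ?nnegrE ?(ltW d0) ?(ltW sx).
Qed.

End Multipliers.

(** * Removing the damping *)

Section LowerBound.
Context {R : realType}.
Notation mu := (@lebesgue_measure R).
Notation ray := (`[0, +oo[%classic : set R).
Notation eps n := (n.+1%:R^-1 : R).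

(** The error is at most the integral of (1 - e^(-t/n)) |h t|, whatever the
    frequency, and this tends to 0 by dominated convergence. *)
Lemma damped_uniform (h : R -> R) : measurable_fun setT h -> L1 ray h ->
  exists r : nat -> R, (r n @[n --> \oo] --> (0 : R)) /\
   forall n l,
     `|cosT (causal (damped (eps n) h)) l - cosT (causal h) l| <= r n /\
     `|sinT (causal (damped (eps n) h)) l - sinT (causal h) l| <= r n.
Proof.
move=> mh ih.
pose r n := \int[mu]_(t in ray) ((1 - expR (- (eps n * t))) * `|h t|).
have e01 n (t : R) : ray t -> 0 <= 1 - expR (- (eps n * t)) <= 1.
  rewrite /= in_itv/= andbT => t0.
  by rewrite gerBl expR_ge0 andbT subr_ge0 -[leRHS]expR0 ler_expR oppr_le0 mulr_ge0//.
have mr n : measurable_fun ray (fun t => (1 - expR (- (eps n * t))) * `|h t|).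
  apply: measurable_funTS; apply: measurable_funM; last exact: measurableT_comp.
  by apply: measurable_funB; [exact: measurable_cst|exact: measurable_expM].
have le n t : ray t -> `|(1 - expR (- (eps n * t))) * `|h t| | <= `|h t|.
  move=> /(e01 n) /andP[h0 h1]; rewrite normrM normr_id ler_piMl//.
  by rewrite ger0_norm.
have ir n : L1 ray (fun t => (1 - expR (- (eps n * t))) * `|h t|).
  by apply: (L1_le _ _ (L1_norm ih)) => // t; exact: le.
exists r; split.
  have [||||_] := @Rintegral_dominated R ray
    (fun n t => (1 - expR (- (eps n * t))) * `|h t|) (fun=> 0) (fun t => `|h t|) (measurable_itv _).
  - by [].
  - exact: L1_norm.
  - move=> t _; rewrite -[X in _ --> X](mul0r `|h t|); apply: cvgM; last exact: cvg_cst.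
    rewrite -[X in _ --> X](subrr 1); apply: cvgB; first exact: cvg_cst.
    exact: cvg_exp_harmonic.
  - by move=> n t; exact: le.
  - by rewrite Rintegral_cst// mul0r.
move=> n l; have md : measurable_fun setT (damped (eps n) h) by exact: measurable_damped.
have id : L1 ray (damped (eps n) h).
  apply: (L1_le _ _ (L1_norm ih)) => //; first exact: measurable_funTS.
  move=> t /=; rewrite in_itv/= andbT => t0; exact: damped_le.
split.
- rewrite !cosT_causal// -RintB//; [|exact: L1_cos..].
  apply: le_Rint_norm => //; first by apply: L1B => //; exact: L1_cos.
  move=> t rt; rewrite -mulrBl /damped normrM.
  have /andP[h0 h1] := e01 n t rt.
  have -> : expR (- (eps n * t)) * h t - h t = - ((1 - expR (- (eps n * t))) * h t) by ring.
  by rewrite normrN normrM (ger0_norm h0) ler_piMr ?mulr_ge0// cos_max.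
- rewrite !sinT_causal// -RintB//; [|exact: L1_sin..].
  apply: le_Rint_norm => //; first by apply: L1B => //; exact: L1_sin.
  move=> t rt; rewrite -mulrBl /damped normrM.
  have /andP[h0 h1] := e01 n t rt.
  have -> : expR (- (eps n * t)) * h t - h t = - ((1 - expR (- (eps n * t))) * h t) by ring.
  by rewrite normrN normrM (ger0_norm h0) ler_piMr ?mulr_ge0// sin_max.
Qed.

Lemma cvg_of_dist (u r : nat -> R) (l : R) : r n @[n --> \oo] --> (0 : R) ->
  (forall n, `|u n - l| <= r n) -> u n @[n --> \oo] --> l.
Proof.
move=> r0 ur; apply/cvgrPdist_le => e e0.
have /cvgrPdist_le/(_ e e0) := r0; apply: filterS => n.
by rewrite sub0r normrN => re; rewrite distrC (le_trans (ur n))// (le_trans _ re)// ler_norm.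
Qed.

Lemma cvg_damped_cos (h : R -> R) l : measurable_fun setT h -> L1 ray h ->
  cosT (causal (damped (eps n) h)) l @[n --> \oo] --> cosT (causal h) l.
Proof.
by move=> mh ih; have [r [r0 H]] := damped_uniform mh ih;
  apply: (cvg_of_dist r0) => n; have [] := H n l.
Qed.

Lemma cvg_damped_sin (h : R -> R) l : measurable_fun setT h -> L1 ray h ->
  sinT (causal (damped (eps n) h)) l @[n --> \oo] --> sinT (causal h) l.
Proof.
by move=> mh ih; have [r [r0 H]] := damped_uniform mh ih;
  apply: (cvg_of_dist r0) => n; have [] := H n l.
Qed.

Lemma hilbert_kernel_le (e u : R) : 0 < e -> `|hilbert_kernel e u| <= e^-1.
Proof.
move=> e0; have w0 : 0 < e ^+ 2 + u ^+ 2 by rewrite ltr_wpDr ?sqr_ge0 ?exprn_gt0.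
rewrite /hilbert_kernel normrM normfV (gtr0_norm w0) ler_pdivrMr//.
rewrite -(@ler_pM2l _ e)// mulrA mulfV ?gt_eqF// mul1r -[u ^+ 2]real_normK ?num_real//.
have : 0 <= `|u| by [].
move: `|u| => z z0; have := sqr_ge0 (e - z); have := sqr_ge0 e; have := sqr_ge0 z; clear; nra.
Qed.

Lemma measurable_hilbert_kernel (e : R) : 0 < e -> measurable_fun setT (hilbert_kernel e).
Proof.
move=> e0; apply: continuous_measurable_fun => u; apply: cvgM; first exact: cvg_id.
apply: cvgV; first exact: sqrD_neq0.
by apply: cvgD; [exact: cvg_cst|exact: exprn_continuous].
Qed.

Lemma L1_hilbert (g : R -> R) (e l : R) : 0 < e -> L1 setT g ->
  L1 setT (fun x => g x * (2^-1 * (hilbert_kernel e (x + l) + hilbert_kernel e (x - l)))).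
Proof.
move=> e0 ig; have mH := measurable_hilbert_kernel e0.
apply: (L1_bounded (M := e^-1)) => //.
  measurable_by_parts; apply: (measurableT_comp mH); measurable_by_parts.
move=> x _; rewrite normrM ger0_norm ?invr_ge0// ler_pdivrMl// mulr2n mulrDl mul1r.
by rewrite (le_trans (ler_normD _ _))// lerD// hilbert_kernel_le.
Qed.

End LowerBound.

(** * The dispersion function *)

Lemma sqr_gap_growth {R : realType} (l l0 K : R) : 0 < l0 -> 0 <= K ->
  l0 + 2 * K + 1 <= l -> 2 * K + 1 <= l ^+ 2 - l0 ^+ 2.
Proof.
move=> l00 K0 ll; have : (2 * K + 1) * 1 <= (l - l0) * (l + l0) by apply: ler_pM; lra.
by nra.
Qed.

Lemma perturbed_modulus {R : realType} (p q u v r d : R) : r <= d / 8 ->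
  (p - q) ^+ 2 <= r -> (u - v) ^+ 2 <= r -> d <= (1 + q) ^+ 2 + v ^+ 2 ->
  d / 4 <= (1 + p) ^+ 2 + u ^+ 2.
Proof.
move=> h1 h2 h3 h4.
have := sqr_ge0 (2 * (1 + p) - (1 + q)); have := sqr_ge0 (2 * u - v); nra.
Qed.

Lemma modulus_ge {R : realType} (p q : R) : `|p| <= 2^-1 -> 4^-1 <= (1 + p) ^+ 2 + q ^+ 2.
Proof.
by rewrite ler_norml => /andP[h1 h2]; have := sqr_ge0 q; nra.
Qed.

Section Friedrichs.
Context {R : realType}.
Notation mu := (@lebesgue_measure R).
Notation ray := (`[0, +oo[%classic : set R).
Notation eps n := (n.+1%:R^-1 : R).

Variables (a a' : R -> R) (nu0 l0 Ma Ma' : R).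
Hypotheses (l00 : 0 < l0) (l0nu0 : l0 < nu0)
  (da : forall x : R, isder a x (a' x)) (ca' : continuous a')
  (aM : forall x, `|a x| <= Ma) (a'M : forall x, `|a' x| <= Ma')
  (a0 : forall x, `|x| <= nu0 -> a x = 0)
  (apos : forall x, nu0 < `|x| -> 0 < a x)
  (ia : L1 setT (fun x => a x ^+ 2)).

Definition memory_density x := a x ^+ 2 * memory_weight x.
Definition reduced_density x := a x ^+ 2 * reduced_weight l0 x.
(** The vector (1, coupling) is an eigenvector of the coupled system at
    frequency l0, provided [self_energy] equals v - l0^2. *)
Definition coupling x := a x / (x ^+ 2 - l0 ^+ 2).
Definition self_energy := \int[mu]_x (a x * coupling x).

Let nu00 : 0 < nu0. Proof. exact: lt_trans l0nu0. Qed.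
Let Ma0 : 0 <= Ma. Proof. by rewrite (le_trans _ (aM 0)). Qed.
Let d0 : 0 < nu0 ^+ 2 - l0 ^+ 2.
Proof. by rewrite subr_gt0 ltrXn2r// ?nnegrE ltW. Qed.
Let ca : continuous a := is_derive_continuous da.
Let ma : measurable_fun setT a := continuous_measurable_fun ca.

Lemma gap_cases (x : R) : a x = 0 \/ nu0 <= `|x|.
Proof. by have [xn|xn] := ltP `|x| nu0; [left; apply: a0; exact: ltW|right]. Qed.

Lemma sqr_gap (x : R) : nu0 <= `|x| -> nu0 ^+ 2 <= x ^+ 2.
Proof. by move=> xn; rewrite -[x ^+ 2]real_normK ?num_real// lerXn2r ?nnegrE// ltW. Qed.

Lemma gap_den_ge (x : R) : nu0 <= `|x| -> nu0 ^+ 2 - l0 ^+ 2 <= x ^+ 2 - l0 ^+ 2.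
Proof. by move=> /sqr_gap xn; rewrite lerD2r. Qed.

Lemma gap_den_gt0 (x : R) : nu0 <= `|x| -> 0 < x ^+ 2 - l0 ^+ 2.
Proof. by move=> /gap_den_ge; exact: lt_le_trans. Qed.

Lemma gap_neq0 (x : R) : nu0 <= `|x| -> x != 0.
Proof. by move=> xn; rewrite -normr_gt0 (lt_le_trans nu00). Qed.

Let CC := gap_const nu0 l0.
Let dmem x (h : l0 < `|x|) := isder_memory_weight l00 h.
Let cmem' x (h : l0 < `|x|) := continuous_memory_weight' l00 h.
Let mem_le (x : R) (h : nu0 <= `|x|) : `|memory_weight x| <= CC / `|x|.
Proof. exact: memory_weight_le. Qed.
Let mem'_le (x : R) (h : nu0 <= `|x|) : `|memory_weight' x| <= CC.
Proof. exact: memory_weight'_le. Qed.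
Let dred x (h : l0 < `|x|) := isder_reduced_weight l00 h.
Let cred' x (h : l0 < `|x|) := continuous_reduced_weight' l00 h.
Let red_le (x : R) (h : nu0 <= `|x|) : `|reduced_weight l0 x| <= CC / `|x|.
Proof. exact: reduced_weight_le. Qed.
Let red'_le (x : R) (h : nu0 <= `|x|) : `|reduced_weight' l0 x| <= CC.
Proof. exact: reduced_weight'_le. Qed.

Lemma L1_memory_density : L1 setT memory_density.
Proof. exact: (gap_L1 l00 l0nu0 da a0 ia dmem mem_le mem'_le). Qed.

Lemma L1_reduced_density : L1 setT reduced_density.
Proof. exact: (gap_L1 l00 l0nu0 da a0 ia dred red_le red'_le). Qed.

Lemma L1_memory_kernel : L1 ray (sinT memory_density).
Proof. exact: (gap_kernel_L1 l00 l0nu0 da ca' aM a'M a0 ia dmem cmem' mem_le mem'_le). Qed.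

Lemma L1_reduced_kernel : L1 ray (sinT reduced_density).
Proof. exact: (gap_kernel_L1 l00 l0nu0 da ca' aM a'M a0 ia dred cred' red_le red'_le). Qed.

Lemma continuous_reduced_density : continuous reduced_density.
Proof. by move=> x; exact: (gap_continuous l0nu0 da a0 dred). Qed.

Lemma bounded_reduced_density (x : R) : `|reduced_density x| <= CC / nu0 * Ma ^+ 2.
Proof. exact: (gap_bounded l00 l0nu0 aM a0 red_le red'_le). Qed.

Lemma measurable_memory_kernel : measurable_fun setT (sinT memory_density).
Proof. exact: measurable_sinT L1_memory_density. Qed.

Lemma measurable_reduced_kernel : measurable_fun setT (sinT reduced_density).
Proof. exact: measurable_sinT L1_reduced_density. Qed.

(** Coincides with 1 / (x^2 - l0^2) on the support of a, and is continuous
    everywhere. *)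
Definition gap_weight (x : R) := (Num.max (x ^+ 2 - l0 ^+ 2) (nu0 ^+ 2 - l0 ^+ 2))^-1.

Lemma couplingE x : coupling x = a x * gap_weight x.
Proof.
rewrite /coupling /gap_weight; have [->|xn] := gap_cases x; first by rewrite !mul0r.
by rewrite (max_idPl _)// gap_den_ge.
Qed.

Lemma measurable_gap_weight : measurable_fun setT gap_weight.
Proof.
apply: continuous_measurable_fun => x.
apply: cvgV; first by rewrite gt_eqF// lt_max d0 orbT.
apply: (@continuous_max _ _ (fun x : R => x ^+ 2 - l0 ^+ 2) (fun=> nu0 ^+ 2 - l0 ^+ 2)).
  by apply: cvgB; [exact: exprn_continuous|exact: cvg_cst].
exact: cvg_cst.
Qed.

Lemma measurable_coupling : measurable_fun setT coupling.
Proof.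
rewrite (_ : coupling = fun x => a x * gap_weight x); last exact/funext/couplingE.
by apply: measurable_funM => //; exact: measurable_gap_weight.
Qed.

Lemma coupling_le (x : R) : `|coupling x| <= (nu0 ^+ 2 - l0 ^+ 2)^-1 * `|a x|.
Proof.
rewrite /coupling; have [->|xn] := gap_cases x; first by rewrite mul0r normr0 mulr0.
rewrite normrM mulrC ler_wpM2r// normfV gtr0_norm ?gap_den_gt0//.
by rewrite lef_pV2 ?gap_den_ge// posrE ?gap_den_gt0//; exact: d0.
Qed.

Lemma L1_a_coupling : L1 setT (fun x => a x * coupling x).
Proof.
apply: (L1_le _ _ (L1Z (nu0 ^+ 2 - l0 ^+ 2)^-1 _ ia)) => //.
  by apply: measurable_funM => //; exact: measurable_coupling.
move=> x _; rewrite normrM (le_trans (ler_wpM2l _ (coupling_le x)))//.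
by rewrite mulrCA ler_wpM2l ?invr_ge0 ?(ltW d0)// -expr2 real_normK ?num_real.
Qed.

Let A n (l : R) := cosT (causal (damped (eps n) (sinT reduced_density))) l.
Let B n (l : R) := sinT (causal (damped (eps n) (sinT reduced_density))) l.
Let A0 (l : R) := cosT (causal (sinT reduced_density)) l.
Let B0 (l : R) := sinT (causal (sinT reduced_density)) l.

(** At positive damping e the two regularised poles of the density combine to
    a^2 (x^2 + e^2 - l^2) over positive factors, which is nonnegative because
    |x| >= nu0 >= l wherever a does not vanish. *)
Lemma cosT_reduced_ge0 (l : R) : 0 <= l -> l <= nu0 -> 0 <= A0 l.
Proof.
move=> l0' ln.
have cA := cvg_damped_cos (l := l) measurable_reduced_kernel L1_reduced_kernel.
rewrite /A0 -(cvg_lim _ cA)//; apply: limr_ge; first by apply/cvg_ex; eexists; exact: cA.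
apply: nearW => n; have e0 := @invr_natS_gt0 R n.
rewrite cosT_damped//; last exact: L1_reduced_density.
apply: Rintegral_ge0 => x _; rewrite /reduced_density /reduced_weight /hilbert_kernel.
have [->|xn] := gap_cases x; first by rewrite expr0n/= !mul0r.
set e := _^-1 in e0 *.
have x0 := gap_neq0 xn; have dx := gap_den_gt0 xn.
have h1 := sqrD_neq0 (x + l) e0; have h2 := sqrD_neq0 (x - l) e0.
have h3 : x ^+ 2 - l0 ^+ 2 != 0 by rewrite gt_eqF.
have -> : a x ^+ 2 * (x * (x ^+ 2 - l0 ^+ 2))^-1 * (2^-1 *
   ((x + l) / (e ^+ 2 + (x + l) ^+ 2) + (x - l) / (e ^+ 2 + (x - l) ^+ 2))) =
   a x ^+ 2 * (x ^+ 2 + e ^+ 2 - l ^+ 2) /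
   ((x ^+ 2 - l0 ^+ 2) * (e ^+ 2 + (x + l) ^+ 2) * (e ^+ 2 + (x - l) ^+ 2)).
  by field; rewrite x0 h1 h2 h3.
apply: mulr_ge0; first apply: mulr_ge0; first exact: sqr_ge0.
  have : l ^+ 2 <= x ^+ 2 by rewrite (le_trans _ (sqr_gap xn))// lerXn2r ?nnegrE// ltW.
  by have := sqr_ge0 e; lra.
by rewrite invr_ge0 !mulr_ge0 ?(ltW dx)// addr_ge0 ?sqr_ge0.
Qed.

(** The Poisson averages of [sinT_damped] tend to point values of the density. *)
Lemma sinT_reducedE (l : R) : B0 l = 2^-1 * (pi * reduced_density l - pi * reduced_density (- l)).
Proof.
have cB := cvg_damped_sin (l := l) measurable_reduced_kernel L1_reduced_kernel.
apply: (cvg_unique _ cB) => //.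
rewrite (_ : (fun n => _) = (fun n => 2^-1 * (conv_poisson (eps n) reduced_density l - conv_poisson (eps n) reduced_density (- l)))).
  apply: cvgM; first exact: cvg_cst.
  by apply: cvgB; apply: (conv_poisson_cvg L1_reduced_density bounded_reduced_density); exact: continuous_reduced_density.
by apply/funext => n; rewrite sinT_damped//; exact: L1_reduced_density.
Qed.

(** The weight is odd and positive beyond nu0, so both terms of
    [sinT_reducedE] are positive multiples of squares of values of a. *)
Lemma sinT_reduced_gt0 (l : R) : nu0 < l -> 0 < B0 l.
Proof.
move=> nl; have l0' : 0 < l by exact: lt_trans nl.
have nl' : nu0 < `|l| by rewrite gtr0_norm.
have dl := gap_den_gt0 (ltW nl').
have al := apos nl'; have aNl : 0 < a (- l) by apply: apos; rewrite normrN.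
rewrite sinT_reducedE mulr_gt0 ?invr_gt0// -mulrBr mulr_gt0 ?pi_gt0// /reduced_density /reduced_weight sqrrN mulNr invrN mulrN opprK.
by rewrite addr_gt0// mulr_gt0 ?exprn_gt0// invr_gt0 mulr_gt0.
Qed.

(** At positive damping this holds with error terms of order e, as an identity
    between the integrands: 1 / ((x^2 - l0^2) (x^2 - z^2)) splits into partial
    fractions. At l = l0 the left-hand side vanishes; for large l the right-
    hand side stays bounded. *)
Lemma resolvent_identity (l : R) :
  (l0 ^+ 2 - l ^+ 2) * A0 l = self_energy - cosT (causal (sinT memory_density)) l.
Proof.
have cA := cvg_damped_cos (l := l) measurable_reduced_kernel L1_reduced_kernel.
have cB := cvg_damped_sin (l := l) measurable_reduced_kernel L1_reduced_kernel.
have cK := cvg_damped_cos (l := l) measurable_memory_kernel L1_memory_kernel.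
have ce : eps n @[n --> \oo] --> (0 : R) by exact: (@cvg_harmonic R).
have H n : (eps n * eps n - l ^+ 2 + l0 ^+ 2) * A n l + 2 * eps n * l * B n l =
   self_energy - cosT (causal (damped (eps n) (sinT memory_density))) l.
  have e0 := @invr_natS_gt0 R n.
  rewrite /A /B cosT_damped ?sinT_damped ?cosT_damped//; [|exact: L1_memory_density|exact: L1_reduced_density|exact: L1_reduced_density].
  set e := _^-1 in e0 *.
  have i1 := L1_hilbert l e0 L1_reduced_density.
  have i2 := L1_hilbert l e0 L1_memory_density.
  have i3 := L1_poisson l e0 L1_reduced_density; have i4 := L1_poisson (- l) e0 L1_reduced_density.
  have i5 := L1B measurableT i3 i4.
  rewrite /conv_poisson -(RintB measurableT i3 i4) -(RintZl 2^-1 measurableT i5).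
  have i6 := L1Z 2^-1 measurableT i5.
  rewrite -(RintZl (e * e - l ^+ 2 + l0 ^+ 2) measurableT i1).
  rewrite -(RintZl (2 * e * l) measurableT i6).
  rewrite -(RintD measurableT (L1Z (e * e - l ^+ 2 + l0 ^+ 2) measurableT i1) (L1Z (2 * e * l) measurableT i6)).
  rewrite /self_energy -(RintB measurableT L1_a_coupling i2).
  apply: eq_Rintegral => x _; rewrite /reduced_density /memory_density /reduced_weight /memory_weight /hilbert_kernel /poisson /coupling.
  have [->|xn] := gap_cases x.
    by rewrite expr0n/= !(mul0r, mulr0, addr0, subr0, add0r, oppr0).
  have x0 := gap_neq0 xn; have dx := gap_den_gt0 xn.
  have h1 := sqrD_neq0 (x + l) e0; have h2 := sqrD_neq0 (x - l) e0.
  have h3 : x ^+ 2 - l0 ^+ 2 != 0 by rewrite gt_eqF.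
  have -> : (l - x) ^+ 2 = (x - l) ^+ 2 by ring.
  have -> : (- l - x) ^+ 2 = (x + l) ^+ 2 by ring.
  by field; rewrite x0 h1 h2 h3.
have C1 : (eps n * eps n - l ^+ 2 + l0 ^+ 2) * A n l + 2 * eps n * l * B n l @[n --> \oo] -->
   (0 * 0 - l ^+ 2 + l0 ^+ 2) * A0 l + 2 * 0 * l * B0 l.
  apply: cvgD.
    apply: cvgM; last exact: cA.
    apply: cvgD; last exact: cvg_cst.
    by apply: cvgB; [apply: cvgM; exact: ce|exact: cvg_cst].
  apply: cvgM; last exact: cB.
  by apply: cvgM; [apply: cvgM; [exact: cvg_cst|exact: ce]|exact: cvg_cst].
have C2 : self_energy - cosT (causal (damped (eps n) (sinT memory_density))) l @[n --> \oo] -->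
   self_energy - cosT (causal (sinT memory_density)) l by apply: cvgB; [exact: cvg_cst|exact: cK].
transitivity ((0 * 0 - l ^+ 2 + l0 ^+ 2) * A0 l + 2 * 0 * l * B0 l); first by ring.
apply: (cvg_unique _ C1) => //.
by move: C2; under eq_fun do rewrite -H.
Qed.

Lemma self_energyE : self_energy = cosT (causal (sinT memory_density)) l0.
Proof. by have /eqP := resolvent_identity l0; rewrite subrr mul0r eq_sym subr_eq0 => /eqP. Qed.

(** The real part of the symbol is at least 1 up to nu0, the sine transform of
    the kernel is positive beyond. On a compact interval continuity gives a
    positive minimum; outside, [resolvent_identity] bounds the transform of
    the kernel by 1/2 in its real part. By [damped_uniform] a small damping
    preserves the bound up to a factor. *)
Lemma dispersion_lower : exists2 delta : R, 0 < delta &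
  \forall n \near \oo, forall l, 0 <= l -> delta <= (1 + A n l) ^+ 2 + B n l ^+ 2.
Proof.
pose K := `|self_energy| + \int[mu]_t `|causal (sinT memory_density) t|.
have icq : L1 setT (causal (sinT reduced_density)) by apply/L1_causal; exact: L1_reduced_kernel.
have ick : L1 setT (causal (sinT memory_density)) by apply/L1_causal; exact: L1_memory_kernel.
have K0 : 0 <= K by rewrite addr_ge0//; exact: Rintegral_ge0.
(* beyond L the factor l^2 - l0^2 of the resolvent identity exceeds 2 K *)
pose L := l0 + 2 * K + 1.
have L0 : 0 <= L by rewrite !addr_ge0 ?mulr_ge0 ?(ltW l00).
pose f0 l := (1 + A0 l) ^+ 2 + B0 l ^+ 2.
have big (l : R) : L <= l -> 4^-1 <= f0 l.
  move=> Ll; have k1 := sqr_gap_growth l00 K0 Ll.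
  have d1 : 0 < l ^+ 2 - l0 ^+ 2 by rewrite (lt_le_trans _ k1)// ltr_wpDl// mulr_ge0.
  apply: modulus_ge; rewrite -(ler_pM2l d1).
  apply: (@le_trans _ _ K).
    rewrite -[X in X * _](ger0_norm (ltW d1)) -normrM -normrN -mulNr opprB resolvent_identity.
    by rewrite (le_trans (ler_normB _ _))// lerD2l; exact: cosT_le.
  rewrite ler_pdivlMr// mulrC (le_trans _ k1)// lerDl//.
have cf0 : continuous f0.
  move=> l; apply: cvgD.
    apply: (@cvg_comp _ _ _ (fun l => 1 + A0 l) (fun y => y ^+ 2)); last exact: exprn_continuous.
    by apply: cvgD; [exact: cvg_cst|exact: continuous_cosT].
  apply: (@cvg_comp _ _ _ B0 (fun y => y ^+ 2)); last exact: exprn_continuous.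
  exact: continuous_sinT.
have [c cL cmin] := EVT_min L0 (continuous_subspaceT cf0).
have fc : 0 < f0 c.
  move: cL; rewrite in_itv/= => /andP[c0 _]; rewrite /f0.
  have [cn|cn] := leP c nu0.
    by rewrite ltr_wpDr ?sqr_ge0// exprn_gt0// ltr_wpDr// cosT_reduced_ge0.
  by rewrite ltr_wpDl ?sqr_ge0// exprn_gt0// sinT_reduced_gt0.
pose d := Num.min (f0 c) 4^-1.
have dpos : 0 < d by rewrite lt_min fc invr_gt0 ltr0n.
have dle (l : R) : 0 <= l -> d <= f0 l.
  move=> l0'; rewrite /d ge_min; have [lL|lL] := leP l L.
    by rewrite cmin// in_itv/= l0'.
  by rewrite big ?orbT// ltW.
exists (d / 4); first by rewrite divr_gt0.
have [r [r0 H]] := damped_uniform measurable_reduced_kernel L1_reduced_kernel.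
have r2 : r n * r n @[n --> \oo] --> (0 * 0 : R) by apply: cvgM.
rewrite mulr0 in r2.
have /cvgrPdist_le/(_ (d / 8)) := r2; rewrite divr_gt0// => /(_ isT).
apply: filterS => n; rewrite sub0r normrN => rn l l0'.
have [h1 h2] := H n l; have := dle l l0'; rewrite /f0.
have {}rn : r n * r n <= d / 8 by rewrite (le_trans (ler_norm _)).
have a2 : (A n l - A0 l) ^+ 2 <= r n * r n.
  by rewrite -[leLHS]real_normK ?num_real// -expr2 lerXn2r ?nnegrE// (le_trans _ h1).
have b2 : (B n l - B0 l) ^+ 2 <= r n * r n.
  by rewrite -[leLHS]real_normK ?num_real// -expr2 lerXn2r ?nnegrE// (le_trans _ h2).
exact: (perturbed_modulus rn a2 b2).
Qed.

End Friedrichs.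

(** * Decay for the Volterra equation *)

Section Decay.
Context {R : realType}.
Notation mu := (@lebesgue_measure R).

Lemma Rint_indic_itv (c s t : R) : s <= t ->
  L1 setT (fun x => c * \1_(`[s, t]%classic : set R) x) /\
  \int[mu]_x (c * \1_(`[s, t]%classic : set R) x) = c * (t - s).
Proof.
move=> st; split.
  by apply: L1Z => //; constructor; exact: integrable_indic_itv.
rewrite -(Rintegral_mkind `[s, t]%classic (fun=> c)) Rintegral_cst//=.
congr (_ * _); rewrite lebesgue_measure_itv/= lte_fin.
move: st; rewrite le_eqVlt => /orP[/eqP ->|st]; first by rewrite ltxx subrr.
by rewrite st.
Qed.

(** If |X t| >= e, then |X| >= e / 2 on an interval of length e / (2 L) to the
    right of t. For large t this contradicts the smallness of the tail of the
    integral. *)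
Lemma lipschitz_L2_cvg0 (X : R -> R) (L : R) : 0 < L ->
  (forall s t, `|X s - X t| <= L * `|s - t|) ->
  L1 setT (fun t => causal X t ^+ 2) -> X t @[t --> +oo] --> (0 : R).
Proof.
move=> L0 lip iX.
pose F n t := causal X t ^+ 2 * \1_(`[n%:R, +oo[%classic : set R) t.
have mI (n : nat) : measurable_fun setT (\1_(`[n%:R, +oo[%classic : set R) : R -> R).
  exact: measurable_indic.
have Fle n t : `|F n t| <= causal X t ^+ 2.
  rewrite /F normrM (ger0_norm (sqr_ge0 _)) ler_piMr ?sqr_ge0// indicE.
  by case: (_ \in _); rewrite ?normr1 ?normr0.
have mF n : measurable_fun setT (F n).
  by apply: measurable_funM => //; exact: L1_measurable iX.
have iF n : L1 setT (F n) by apply: (L1_le _ _ iX).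
have [||_ F0] := @Rintegral_dominated R setT F (fun=> 0) _ measurableT mF iX.
- move=> t _; apply: cvg_near_cst; near=> n.
  rewrite /F indicE memNset ?mulr0//= in_itv/= andbT; apply/negP; rewrite -ltNge.
  by near: n; exact: nbhs_infty_gtr.
- by move=> n t _; exact: Fle.
rewrite Rintegral_cst// mul0r in F0.
apply/cvgrPdist_le => e e0.
(* the least contribution of such an interval to the integral of X^2 *)
pose eta := e ^+ 2 / 4 * (e / (2 * L)).
have eta0 : 0 < eta by rewrite !mulr_gt0 ?invr_gt0 ?exprn_gt0// mulr_gt0.
have /cvgrPdist_lt/(_ _ eta0) [n _ Hn] := F0.
have := Hn n (leqnn n); rewrite sub0r normrN ltr_norml => /andP[_ Fn].
near=> t; rewrite sub0r normrN leNgt; apply/negP => Xt.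
have tn : n%:R <= t by near: t; apply: nbhs_pinfty_ge; exact: num_real.
have t0 : 0 < t by near: t; apply: nbhs_pinfty_gt; exact: num_real.
have el : 0 < e / (2 * L) by rewrite divr_gt0// mulr_gt0.
have [j1 j2] := @Rint_indic_itv (e ^+ 2 / 4) t (t + e / (2 * L)) (ltW (ltr_pwDr el (lexx t))).
suff : eta <= \int[mu]_x F n x by rewrite leNgt Fn.
have -> : eta = \int[mu]_x (e ^+ 2 / 4 * \1_(`[t, t + e / (2 * L)]%classic : set R) x).
  by rewrite j2 addrC addKr.
apply: le_Rint => // s _; rewrite indicE.
case: (boolP (s \in _)) => [|_]; last by rewrite mulr0 mulr_ge0 ?sqr_ge0// indicE.
rewrite inE/= in_itv/= => /andP[ts st]; rewrite mulr1 /F /causal.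
rewrite (lt_le_trans t0 ts) indicE mem_set ?mulr1/=; last by rewrite in_itv/= andbT (le_trans tn).
have h : `|X s| >= e / 2.
  have h1 : `|X t - X s| <= e / 2.
    apply: (le_trans (lip _ _)); rewrite distrC ger0_norm ?subr_ge0//.
    rewrite (@le_trans _ _ (L * (e / (2 * L))))// ?ler_wpM2l ?(ltW L0)//.
      by rewrite lerBlDl.
    by rewrite le_eqVlt; apply/orP; left; apply/eqP; field; rewrite gt_eqF.
  have : `|X t| <= `|X t - X s| + `|X s|.
    by rewrite -{1}(subrK (X s) (X t)) ler_normD.
  by move: Xt h1; move: (`|X t|) (`|X s|) (`|X t - X s|) => p q r; lra.
rewrite -[leRHS]real_normK ?num_real//.
have -> : e ^+ 2 / 4 = (e / 2) ^+ 2 by field.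
by rewrite lerXn2r ?nnegrE ?divr_ge0// ltW.
Unshelve. all: by end_near. Qed.

Lemma isder_lipschitz (X X' : R -> R) (L : R) : (forall t : R, isder X t (X' t)) ->
  (forall t, `|X' t| <= L) -> forall s t, `|X s - X t| <= L * `|s - t|.
Proof.
move=> dX XL s t; wlog st : s t / s <= t.
  by move=> H; have [/H//|/ltW/H] := leP s t; rewrite distrC [X in _ -> _ <= _ * X]distrC.
have cX : continuous X := is_derive_continuous dX.
have [] := @MVT_segment _ X X' s t st.
- by move=> x _; exact: dX.
- exact: continuous_subspaceT.
move=> c _ E; rewrite distrC E normrM [`|s - t|]distrC.
by rewrite ler_wpM2r.
Qed.

Variables (a a' : R -> R) (nu0 l0 Ma Ma' : R).
Hypotheses (l00 : 0 < l0) (l0nu0 : l0 < nu0)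
  (da : forall x : R, isder a x (a' x)) (ca' : continuous a')
  (aM : forall x, `|a x| <= Ma) (a'M : forall x, `|a' x| <= Ma')
  (a0 : forall x, `|x| <= nu0 -> a x = 0)
  (apos : forall x, nu0 < `|x| -> 0 < a x)
  (ia : L1 setT (fun x => a x ^+ 2)).

(** The right-hand side is square integrable by [plancherel_le], so X is by
    [volterra_L2] and the lower bound on the symbol. *)
Lemma volterra_decay (X X' h1 h2 : R -> R) (M L : R) :
  (forall t : R, isder X t (X' t)) -> (forall t, `|X t| <= M) -> (forall t, `|X' t| <= L) ->
  L1 setT h1 -> L1 setT (fun x => h1 x ^+ 2) ->
  L1 setT h2 -> L1 setT (fun x => h2 x ^+ 2) ->
  (forall t, 0 < t -> X t + convol (causal (sinT (reduced_density a l0))) (causal X) t =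
     - (cosT h1 t + sinT h2 t)) ->
  X t @[t --> +oo] --> (0 : R).
Proof.
move=> dX XM XL i1 i12 i2 i22 eqX.
have L0 : 0 <= L by rewrite (le_trans _ (XL 0)).
have lip := isder_lipschitz dX XL.
apply: (@lipschitz_L2_cvg0 X (L + 1)).
- by rewrite ltr_wpDl.
- by move=> s t; rewrite (le_trans (lip s t))// ler_wpM2r// lerDl.
have iq := L1_reduced_density l00 l0nu0 da a0 ia.
have [d d0 low] := dispersion_lower l00 l0nu0 da ca' aM a'M a0 apos ia.
pose f t := - (cosT h1 t + sinT h2 t).
have mf : measurable_fun setT f.
  apply: measurable_funN; apply: measurable_funD; [exact: measurable_cosT|exact: measurable_sinT].
apply: (@volterra_L2 _ (sinT (reduced_density a l0)) X f M (\int[mu]_x `|reduced_density a l0 x|) d) => //.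
- exact: measurable_sinT.
- by move=> t; exact: sinT_le.
- exact: (L1_reduced_kernel l00 l0nu0 da ca' aM a'M a0 ia).
- exact: is_derive_continuous dX.
have [e1 _] := plancherel_le i1 i12; have [e2 _] := plancherel_le i2 i22.
apply: (L1_le _ _ (L1Z 2 _ (L1D _ e1 e2))) => //.
  by apply: measurable_funTS; exact: measurable_funX.
move=> t _; rewrite ger0_norm ?sqr_ge0// /f sqrrN /energyT.
move: (cosT h1 t) (sinT h1 t) (cosT h2 t) (sinT h2 t) => p q r s.
by have := sqr_ge0 (p - s); have := sqr_ge0 q; have := sqr_ge0 r; lra.
Qed.

End Decay.

(** * Driven oscillators and square-integrable data *)

Section Oscillator.
Context {R : realType}.
Notation mu := (@lebesgue_measure R).
Variables (nu : R) (y y' y'' F : R -> R).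
Hypotheses (dy : forall t : R, isder y t (y' t)) (dy' : forall t : R, isder y' t (y'' t))
  (ode : forall t, y'' t + nu ^+ 2 * y t = F t).

(** The phase space vector (nu y, y') rotated forward from time s to time t:
    without driving it does not depend on s. [H] is its second component. *)
Let G t s := nu * y s * cos (nu * (t - s)) + y' s * sin (nu * (t - s)).
Let dG t (s : R) : isder (G t) s (F s * sin (nu * (t - s))).
Proof.
have dys := dy s; have dys' := dy' s.
rewrite /G; apply: isd_eq; first by isd.
by rewrite /= -ode; ring.
Qed.

Let H t s := y' s * cos (nu * (t - s)) - nu * y s * sin (nu * (t - s)).
Let dH t (s : R) : isder (H t) s (F s * cos (nu * (t - s))).
Proof.
have dys := dy s; have dys' := dy' s.
rewrite /H; apply: isd_eq; first by isd.
by rewrite /= -ode; ring.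
Qed.

(** With K = 0 this is uniqueness for the free oscillator; with K > 0 it
    bounds the effect of a bounded drive by its duration. *)
Lemma oscillator_dist (K : R) t : (forall s, `|F s| <= K) ->
  `|nu * y t - (nu * y 0 * cos (nu * t) + y' 0 * sin (nu * t))| <= K * `|t| /\
  `|y' t - (y' 0 * cos (nu * t) - nu * y 0 * sin (nu * t))| <= K * `|t|.
Proof.
move=> FK; have K0 : 0 <= K by rewrite (le_trans _ (FK 0)).
have := isder_lipschitz (dG t) (L := K) _ t 0.
have := isder_lipschitz (dH t) (L := K) _ t 0.
rewrite /G /H !subrr !subr0 !mulr0 sin0 cos0 !mulr1 !mulr0 addr0 subr0 => h1 h2; split.
- by apply: h2 => s; rewrite normrM -[leRHS]mulr1 ler_pM// sin_max.
- by apply: h1 => s; rewrite normrM -[leRHS]mulr1 ler_pM// cos_max.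
Qed.

Lemma oscillator_bound (K : R) t : (forall s, `|F s| <= K) ->
  `|nu * y t| <= `|nu * y 0| + `|y' 0| + K * `|t| /\
  `|y' t| <= `|nu * y 0| + `|y' 0| + K * `|t|.
Proof.
move=> /(oscillator_dist t)[h1 h2].
have b (u v c s : R) : `|c| <= 1 -> `|s| <= 1 -> `|u * c + v * s| <= `|u| + `|v|.
  move=> c1 s1; rewrite (le_trans (ler_normD _ _))// !normrM lerD//.
    by rewrite -[leRHS]mulr1 ler_pM.
  by rewrite -[leRHS]mulr1 ler_pM.
split.
- rewrite -[nu * y t](subrK (nu * y 0 * cos (nu * t) + y' 0 * sin (nu * t))).
  rewrite (le_trans (ler_normD _ _))// addrC lerD//.
  by apply: b; [exact: cos_max|exact: sin_max].
- rewrite -[y' t](subrK (y' 0 * cos (nu * t) - nu * y 0 * sin (nu * t))).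
  rewrite (le_trans (ler_normD _ _))// addrC lerD//.
  rewrite -mulrN addrC [leRHS]addrC [y' 0 * _ ]mulrC [cos _ * _]mulrC addrC [leRHS]addrC addrC.
  by apply: b; rewrite ?normrN; [exact: sin_max|exact: cos_max].
Qed.

(** Multiplied by nu, Duhamel's formula needs no case distinction at nu = 0. *)
Lemma oscillator_duhamel t : continuous F -> 0 < t ->
  nu * y t = nu * y 0 * cos (nu * t) + y' 0 * sin (nu * t) +
             \int[mu]_(s in `[0, t]) (F s * sin (nu * (t - s))).
Proof.
move=> cF t0; rewrite (Rintegral_FTC t0 (dG t)); last first.
  move=> s; apply: cvgM; first exact: cF.
  have : continuous (fun s => sin (nu * (t - s))).
    by apply: isd_ex_cont => x; eexists; isd.
  exact.
by rewrite /G !subrr !subr0 !mulr0 sin0 cos0; ring.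
Qed.

End Oscillator.

Section SquareIntegrable.
Context {R : realType}.
Notation mu := (@lebesgue_measure R).
Implicit Types f g : R -> R.

Definition L2 f := measurable_fun setT f /\ L1 setT (fun x => f x ^+ 2).

Lemma L2_le f g : measurable_fun setT f -> L2 g -> (forall x, `|f x| <= g x) -> L2 f.
Proof.
move=> mf [mg ig] fg; split => //; apply: (L1_le _ _ ig) => //; first exact: measurable_funX.
move=> x _; rewrite normrX lerXn2r ?nnegrE//.
by rewrite (le_trans _ (fg x)).
Qed.

Lemma L2D f g : L2 f -> L2 g -> L2 (fun x => f x + g x).
Proof.
move=> [mf fi] [mg gi]; split; first exact: measurable_funD.
apply: (L1_le _ _ (L1Z 2 _ (L1D _ fi gi))) => //.
  by apply: measurable_funX; exact: measurable_funD.
move=> x _; rewrite ger0_norm ?sqr_ge0//.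
by move: (f x) (g x) => p q; have := sqr_ge0 (p - q); lra.
Qed.

Lemma L2Z k f : L2 f -> L2 (fun x => k * f x).
Proof.
move=> [mf fi]; split; first exact: measurable_funM.
by under eq_fun do rewrite exprMn; exact: L1Z.
Qed.

Lemma L2_norm f : L2 f -> L2 (fun x => `|f x|).
Proof.
move=> [mf fi]; split; first exact: measurableT_comp.
by under eq_fun do rewrite real_normK ?num_real//.
Qed.

Lemma L2M f g : L2 f -> L2 g -> L1 setT (fun x => f x * g x).
Proof.
move=> [mf fi] [mg gi]; apply: (L1_le _ _ (L1D _ fi gi)) => //.
  exact: measurable_funM.
move=> x _; rewrite normrM -[f x ^+ 2]real_normK ?num_real// -[g x ^+ 2]real_normK ?num_real//.
have : 0 <= `|f x| by []. have : 0 <= `|g x| by [].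
move: `|f x| `|g x| => p q p0 q0; have := sqr_ge0 (p - q); have := mulr_ge0 p0 q0; lra.
Qed.

Lemma Rint_conull (B : set R) f : measurable B -> mu (~` B) = 0 -> L1 setT f ->
  \int[mu]_(x in B) f x = \int[mu]_x f x.
Proof.
move=> mB B0 [fi]; rewrite /Rintegral [in RHS](@negligible_integral _ _ _ mu setT (~` B))//.
- by rewrite setTD setCK.
- exact: measurableC.
Qed.

Lemma Rint_indic_conull (B : set R) f : measurable B -> mu (~` B) = 0 -> L1 setT f ->
  \int[mu]_x (\1_B x * f x) = \int[mu]_x f x.
Proof.
move=> mB B0 fi; rewrite -(Rint_conull mB B0 fi) [RHS]Rintegral_mkind.
by apply: eq_Rintegral => x _; rewrite mulrC.
Qed.

Lemma L1_indic (B : set R) f : measurable B -> L1 setT f -> L1 setT (fun x => \1_B x * f x).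
Proof.
move=> mB fi; under eq_fun do rewrite mulrC.
apply: (L1_bounded (M := 1)) => //.
by move=> x _; rewrite indicE; case: (_ \in _); rewrite ?normr1 ?normr0.
Qed.

End SquareIntegrable.

Section ParametricDerivative.
Context {R : realType}.
Notation mu := (@lebesgue_measure R).

(** Derivatives as limits of sequences, through which they inherit
    measurability in a parameter. *)
Lemma isder_seq (f : R -> R) (t l : R) : isder f t l ->
  ((n.+1%:R^-1)^-1 * (f (t + n.+1%:R^-1) - f t)) @[n --> \oo] --> l.
Proof.
move=> df; have [df1 df2] : is_derive t 1 f l := df.
have /cvg_ex[/= k fk] := df1.
have kl : k = l by rewrite -df2; symmetry; apply/cvg_lim.
rewrite kl in fk.
have H : (forall n, (n.+1%:R^-1 : R) != 0) /\ (n.+1%:R^-1 : R) @[n --> \oo] --> (0 : R).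
  by split; [move=> n; rewrite invr_eq0 pnatr_eq0|exact: (@cvg_harmonic R)].
have /cvgr_dnbhsP/(_ _ H) := fk.
by under eq_fun do rewrite [_%:R^-1 *: 1]mulr1 [_ + t]addrC.
Qed.

Lemma isder_Rintegral (f f' : R -> R -> R) (g : R -> R) (t0 : R) :
  (forall t, L1 setT (f t)) -> (forall t x : R, isder (f^~ x) t (f' t x)) ->
  L1 setT g -> (forall t x, t0 - 1 < t < t0 + 1 -> `|f' t x| <= g x) ->
  isder (fun t => \int[mu]_x f t x) t0 (\int[mu]_x f' t0 x).
Proof.
move=> fi df gi fg.
have E t x : partial1of2 f t x = f' t x.
  by rewrite partial1of2E; have dfx : is_derive t 1 (f^~ x) (f' t x) := df t x; exact: derive_val.
have It : `]t0 - 1, t0 + 1[%classic t0 by rewrite /= in_itv/= ltrDl ltr01 ltrBlDr ltrDl ltr01.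
have fi' t : `]t0 - 1, t0 + 1[%classic t -> mu.-integrable setT (EFin \o f t) by move=> _; exact: L1P.
have df1 t x : `]t0 - 1, t0 + 1[%classic t -> setT x -> derivable (f^~ x) t 1.
  by move=> _ _; have dfx : is_derive t 1 (f^~ x) (f' t x) := df t x; exact: ex_derive.
have g0 x : 0 <= g x by apply: (le_trans (normr_ge0 (f' t0 x))); apply: fg; move: It; rewrite /= in_itv.
have fg' t x : `]t0 - 1, t0 + 1[%classic t -> setT x -> `|partial1of2 f t x| <= g x.
  by rewrite /= in_itv/= E => It' _; exact: fg.
have d1 := derivable_under_integral measurableT It fi' df1 g0 (L1P gi) fg'.
have d2 := differentiation_under_integral measurableT It fi' df1 g0 (L1P gi) fg'.
apply: DeriveDef => //; rewrite -derive1E d2.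
by apply: eq_Rintegral => x _; rewrite E.
Qed.

End ParametricDerivative.

(** * Decay of the part orthogonal to the trapped mode *)

Section Model.
Context {R : realType}.
Notation mu := (@lebesgue_measure R).

Lemma L1_itv_cst (M T : R) : 0 <= T -> L1 (`[0, T]%classic : set R) (fun=> M).
Proof. by move=> T0; apply/L1_mkcond => //; have [] := Rint_indic_itv M T0. Qed.

Lemma convol_causal_itv (k X : R -> R) (T : R) :
  L1 (`[0, T]%classic : set R) (fun s => k (T - s) * X s) ->
  convol (causal k) (causal X) T = \int[mu]_(s in `[0, T]) (k (T - s) * X s).
Proof.
move=> [i0].
rewrite -Rintegral_itv_obnd_cbnd; last first.
  by apply: integrableS i0 => //; apply: subset_itvr; rewrite bnd_simp.
rewrite -Rintegral_itv_bndo_bndc; last first.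
  by apply: integrableS i0 => //; apply: subset_itv; rewrite bnd_simp.
rewrite Rintegral_mkind /convol; apply: eq_Rintegral => s _.
rewrite /causal subr_gt0 indicE.
have -> : (s \in (`]0, T[%classic : set R)) = (0 < s) && (s < T).
  by apply/idP/idP => [/set_mem|H]; [|apply/mem_set]; rewrite /= in_itv/=.
by case: (0 < s); case: (s < T); rewrite ?(mulr1, mulr0, mul0r).
Qed.

Variables (a a' : R -> R) (nu0 l0 Ma Ma' : R).
Hypotheses (l00 : 0 < l0) (l0nu0 : l0 < nu0)
  (da : forall x : R, isder a x (a' x)) (ca' : continuous a')
  (aM : forall x, `|a x| <= Ma) (a'M : forall x, `|a' x| <= Ma')
  (a0 : forall x, `|x| <= nu0 -> a x = 0)
  (apos : forall x, nu0 < `|x| -> 0 < a x)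
  (ia : L1 setT (fun x => a x ^+ 2)).
Variable (B : set R).
Hypotheses (mB : measurable B) (B0 : mu (~` B) = 0).

Local Notation c := (coupling a l0).
Local Notation S := (self_energy a l0).
Let d0 : 0 < nu0 ^+ 2 - l0 ^+ 2.
Proof. by rewrite subr_gt0 ltrXn2r// ?nnegrE ltW// (lt_trans l00). Qed.
Let nu00 : 0 < nu0. Proof. exact: lt_trans l0nu0. Qed.
Let Ma0 : 0 <= Ma. Proof. by rewrite (le_trans _ (aM 0)). Qed.
Let ma : measurable_fun setT a := continuous_measurable_fun (is_derive_continuous da).

Lemma L2_a : L2 a. Proof. by split. Qed.

Lemma L2_coupling : L2 c.
Proof.
apply: (L2_le _ (L2Z (nu0 ^+ 2 - l0 ^+ 2)^-1 (L2_norm L2_a))).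
  exact: (measurable_coupling l00 l0nu0 da a0).
by move=> x; exact: coupling_le.
Qed.

Lemma coupling_bounded (x : R) : `|c x| <= (nu0 ^+ 2 - l0 ^+ 2)^-1 * Ma.
Proof. by rewrite (le_trans (coupling_le l00 l0nu0 a0 x))// ler_wpM2l ?invr_ge0 ?(ltW d0). Qed.

(** The function z / (z^2 - l0^2) decreases on [nu0, +oo). *)
Lemma freq_coupling_le (x : R) : `|x * c x| <= nu0 / (nu0 ^+ 2 - l0 ^+ 2) * `|a x|.
Proof.
rewrite /coupling; have [->|xn] := gap_cases a0 x; first by rewrite mul0r mulr0 normr0 mulr0.
have dx := gap_den_gt0 l00 l0nu0 xn.
rewrite mulrCA mulrC normrM ler_wpM2r// normrM normfV (gtr0_norm dx).
rewrite ler_pdivrMr// mulrAC ler_pdivlMr// -[x ^+ 2]real_normK ?num_real//.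
move: xn; move: `|x| => z zn; rewrite -subr_ge0.
have -> : nu0 * (z ^+ 2 - l0 ^+ 2) - z * (nu0 ^+ 2 - l0 ^+ 2) = (nu0 * z + l0 ^+ 2) * (z - nu0) by ring.
by rewrite mulr_ge0 ?subr_ge0// addr_ge0 ?sqr_ge0// mulr_ge0 ?(ltW nu00)// (le_trans (ltW nu00)).
Qed.

(** Continuous, and equal to 1 / x on the support of a. *)
Let inv_cut (x : R) := x / Num.max (x ^+ 2) (nu0 ^+ 2).
Let measurable_inv_cut : measurable_fun setT inv_cut.
Proof.
apply: continuous_measurable_fun => x; apply: cvgM; first exact: cvg_id.
apply: cvgV; first by rewrite gt_eqF// lt_max (exprn_gt0 2 nu00) orbT.
apply: (@continuous_max _ _ (fun x : R => x ^+ 2) (fun=> nu0 ^+ 2)).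
  exact: exprn_continuous.
exact: cvg_cst.
Qed.
Let inv_cutE (x : R) : nu0 <= `|x| -> inv_cut x = x^-1.
Proof.
move=> xn; rewrite /inv_cut (max_idPl _); last exact: (sqr_gap l00 l0nu0 xn).
by rewrite expr2 invfM mulrA mulfV ?mul1r// (gap_neq0 l00 l0nu0).
Qed.

Section decay.
Variables (X X' : R -> R) (Y Y' Y'' : R -> R -> R) (b : R -> R) (M L : R).
Hypotheses (dX : forall t : R, isder X t (X' t))
  (XM : forall t, `|X t| <= M) (XL : forall t, `|X' t| <= L)
  (dY : forall nu t : R, isder (Y nu) t (Y' nu t))
  (dY' : forall nu t : R, isder (Y' nu) t (Y'' nu t))
  (ode : forall nu t, Y'' nu t + nu ^+ 2 * Y nu t = \1_B nu * a nu * X t)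
  (mY0 : measurable_fun setT (fun nu => c nu * Y nu 0))
  (mY1 : measurable_fun setT (fun nu => c nu * Y' nu 0))
  (Lb : L2 b)
  (Yb : forall nu, `|nu * Y nu 0| + `|Y' nu 0| <= b nu)
  (XY : forall t, \int[mu]_nu (c nu * Y nu t) = - X t).

Let cX : continuous X := is_derive_continuous dX.

(** Duhamel's formula for each oscillator, integrated against c, expresses - X
    as a free evolution plus the integral of the drive; after exchanging the
    integrals the latter is the convolution of X with the reduced kernel. The
    factor \1_B reflects that the oscillator equations are only known for
    almost every frequency. *)
Lemma model_decay : X t @[t --> +oo] --> (0 : R).
Proof.
have [mb ib] := Lb.
have mX : measurable_fun setT X by exact: continuous_measurable_fun.
have M0 : 0 <= M by rewrite (le_trans _ (XM 0)).
have b0 nu : 0 <= b nu by rewrite (le_trans _ (Yb nu))// addr_ge0.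
have iq := L1_reduced_density l00 l0nu0 da a0 ia.
pose h1 nu := c nu * Y nu 0.
pose h2 nu := c nu * Y' nu 0 * inv_cut nu.
have mh2 : measurable_fun setT h2 by exact: measurable_funM.
(* division by nu is controlled by 1 / nu0, as c vanishes on the gap *)
have cbL1 : L1 setT (fun nu => nu0^-1 * (`|c nu| * b nu)).
  by apply: L1Z => //; apply: L2M => //; exact: L2_norm L2_coupling.
have cbL2 : L2 (fun nu => nu0^-1 * ((nu0 ^+ 2 - l0 ^+ 2)^-1 * Ma) * b nu) by exact: L2Z.
have h1b nu : `|h1 nu| <= nu0^-1 * (`|c nu| * b nu).
  rewrite /h1; have [ax|xn] := gap_cases a0 nu.
    by rewrite /coupling ax mul0r mul0r !normr0 mul0r mulr0.
  rewrite normrM mulrCA ler_wpM2l// ler_pdivlMl//.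
  rewrite (le_trans _ (Yb nu))// ler_wpDr// normrM ler_wpM2r//.
have h2b nu : `|h2 nu| <= nu0^-1 * (`|c nu| * b nu).
  rewrite /h2; have [ax|xn] := gap_cases a0 nu.
    by rewrite /coupling ax !mul0r !normr0 mul0r mulr0.
  rewrite inv_cutE// mulrC normrM normfV ler_pM ?invr_ge0//.
    by rewrite lef_pV2 ?posrE// (lt_le_trans nu00).
  by rewrite normrM ler_wpM2l// (le_trans _ (Yb nu))// ler_wpDl.
have cb nu : nu0^-1 * (`|c nu| * b nu) <= nu0^-1 * ((nu0 ^+ 2 - l0 ^+ 2)^-1 * Ma) * b nu.
  by rewrite -mulrA ler_wpM2l ?invr_ge0 ?(ltW nu00)// ler_wpM2r// coupling_bounded.
have ih1 : L1 setT h1 by apply: (L1_le _ _ cbL1) => // nu _; exact: h1b.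
have ih2 : L1 setT h2 by apply: (L1_le _ _ cbL1) => // nu _; exact: h2b.
have [_ ih12] : L2 h1 by apply: (L2_le mY0 cbL2) => nu; exact: (le_trans (h1b nu) (cb nu)).
have [_ ih22] : L2 h2 by apply: (L2_le mh2 cbL2) => nu; exact: (le_trans (h2b nu) (cb nu)).
apply: (volterra_decay l00 l0nu0 da ca' aM a'M a0 apos ia dX XM XL ih1 ih12 ih2 ih22).
move=> T T0.
have iM := L1_itv_cst M (ltW T0).
pose J nu := \int[mu]_(s in `[0, T]) (X s * sin (nu * (T - s))).
have iXs nu : L1 (`[0, T]%classic : set R) (fun s => X s * sin (nu * (T - s))).
  apply: (L1_le _ _ iM) => //.
    by apply: measurable_funTS; measurable_by_parts.
  by move=> s _; rewrite normrM -[leRHS]mulr1 ler_pM// sin_max.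
have [||||k1 k2 k3] := @Fubini_dom R setT `[0, T]%classic
  (fun nu s => reduced_density a l0 nu * (X s * sin (nu * (T - s))))
  (fun nu => `|reduced_density a l0 nu|) (fun=> M) measurableT (measurable_itv _).
- have mq := L1_measurable iq; measurable_by_parts.
- exact: L1_norm.
- exact: iM.
- move=> nu s _ _; rewrite !normrM ler_wpM2l// -[leRHS]mulr1 ler_pM// sin_max//.
have eJ nu : \int[mu]_(s in `[0, T]) (reduced_density a l0 nu * (X s * sin (nu * (T - s)))) = reduced_density a l0 nu * J nu.
  by rewrite RintZl.
have eS s : \int[mu]_nu (reduced_density a l0 nu * (X s * sin (nu * (T - s)))) = sinT (reduced_density a l0) (T - s) * X s.
  rewrite /sinT -RintZr//; last exact: L1_sin.
  by apply: eq_Rintegral => nu _; rewrite [nu * _]mulrC; ring.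
have iJ : L1 setT (fun nu => reduced_density a l0 nu * J nu).
  by rewrite -[X in L1 _ X](funext eJ).
have iS : L1 (`[0, T]%classic : set R) (fun s => sinT (reduced_density a l0) (T - s) * X s).
  by rewrite -[X in L1 _ X](funext eS).
have eC : convol (causal (sinT (reduced_density a l0))) (causal X) T = \int[mu]_nu (reduced_density a l0 nu * J nu).
  rewrite convol_causal_itv//; transitivity (\int[mu]_nu \int[mu]_(s in `[0, T]) (reduced_density a l0 nu * (X s * sin (nu * (T - s))))).
    by rewrite k3; apply: eq_Rintegral => s _; rewrite eS.
  by apply: eq_Rintegral => nu _; rewrite eJ.
have pw nu : c nu * Y nu T = h1 nu * cos (T * nu) + h2 nu * sin (T * nu) + \1_B nu * (reduced_density a l0 nu * J nu).
  rewrite /h1 /h2; have [ax|xn] := gap_cases a0 nu.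
    by rewrite /coupling /reduced_density ax expr0n/= !(mul0r, mulr0) !addr0.
  have x0 := gap_neq0 l00 l0nu0 xn.
  have dx : nu ^+ 2 - l0 ^+ 2 != 0 by rewrite gt_eqF// (gap_den_gt0 l00 l0nu0 xn).
  have cF : continuous (fun s => \1_B nu * a nu * X s).
    by move=> s; apply: cvgM; [exact: cvg_cst|exact: cX].
  have := oscillator_duhamel (dY nu) (dY' nu) (ode nu) cF T0.
  have -> : \int[mu]_(s in `[0, T]) (\1_B nu * a nu * X s * sin (nu * (T - s))) = \1_B nu * a nu * J nu.
    by rewrite -RintZl//; apply: eq_Rintegral => s _; rewrite mulrA.
  move=> E.
  have -> : Y nu T = nu^-1 * (nu * Y nu T) by rewrite mulrA mulVf ?mul1r.
  rewrite E inv_cutE// /reduced_density /reduced_weight /coupling [T * nu]mulrC.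
  by field; rewrite x0 dx.
have iC1 := L1_cos T measurableT ih1; have iS2 := L1_sin T measurableT ih2.
have iBJ := L1_indic mB iJ.
have := XY T.
under eq_Rintegral do rewrite pw.
rewrite (RintD measurableT (L1D measurableT iC1 iS2) iBJ) (RintD measurableT iC1 iS2).
rewrite (Rint_indic_conull mB B0 iJ) eC -/(cosT h1 T) -/(sinT h2 T) => E.
by rewrite -[X T]opprK -E; ring.
Qed.

End decay.
End Model.

(** * Splitting off the trapped mode *)

Section Dynamics.
Context {R : realType}.
Notation mu := (@lebesgue_measure R).
Variables (a a' : R -> R) (nu0 l0 Ma Ma' : R).
Hypotheses (l00 : 0 < l0) (l0nu0 : l0 < nu0)
  (da : forall x : R, isder a x (a' x)) (ca' : continuous a')
  (aM : forall x, `|a x| <= Ma) (a'M : forall x, `|a' x| <= Ma')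
  (a0 : forall x, `|x| <= nu0 -> a x = 0)
  (apos : forall x, nu0 < `|x| -> 0 < a x)
  (ia : L1 setT (fun x => a x ^+ 2)).
Variable (B : set R).
Hypotheses (mB : measurable B) (B0 : mu (~` B) = 0).
Variables (x x' x'' : R -> R) (y y' y'' : R -> R -> R) (v M L : R).
Hypotheses (dx : forall t : R, isder x t (x' t)) (dx' : forall t : R, isder x' t (x'' t))
  (xM : forall t, `|x t| <= M) (xL : forall t, `|x' t| <= L)
  (dy : forall nu t : R, isder (y nu) t (y' nu t))
  (dy' : forall nu t : R, isder (y' nu) t (y'' nu t))
  (ode : forall nu t, y'' nu t + nu ^+ 2 * y nu t = \1_B nu * a nu * x t)
  (mcy : forall t, measurable_fun setT (fun nu => coupling a l0 nu * y nu t))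
  (Lb : L2 (fun nu => `|nu * y nu 0| + `|y' nu 0|))
  (eqx : forall t, x'' t = - (v * x t) + \int[mu]_nu (a nu * y nu t))
  (Sv : self_energy a l0 = v - l0 ^+ 2).

Local Notation c := (coupling a l0).
Local Notation S := (self_energy a l0).
Let d0 : 0 < nu0 ^+ 2 - l0 ^+ 2.
Proof. by rewrite subr_gt0 ltrXn2r// ?nnegrE ltW// (lt_trans l00). Qed.
Let nu00 : 0 < nu0. Proof. exact: lt_trans l0nu0. Qed.
Let M0 : 0 <= M. Proof. by rewrite (le_trans _ (xM 0)). Qed.

(** Bounds nu y and y' up to time T. It grows with T, but differentiation
    under the integral is a local matter. *)
Let b T nu := `|nu * y nu 0| + `|y' nu 0| + T * M * `|a nu|.
Let L2b T : L2 (b T).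
Proof. by apply: L2D => //; apply: L2Z; apply: L2_norm; exact: L2_a da ia. Qed.
Let b0 T nu : 0 <= T -> 0 <= b T nu.
Proof. by move=> T0; rewrite /b !addr_ge0// !mulr_ge0. Qed.

Let yb T nu t : `|t| <= T -> `|nu * y nu t| <= b T nu /\ `|y' nu t| <= b T nu.
Proof.
move=> tT.
have [|h1 h2] := oscillator_bound (dy nu) (dy' nu) (ode nu) (K := `|a nu| * M) t.
  move=> s; rewrite normrM ler_pM// indicE; case: (_ \in _); rewrite ?mul1r// mul0r normr0//.
have h : `|a nu| * M * `|t| <= T * M * `|a nu|.
  have -> : `|a nu| * M * `|t| = `|t| * M * `|a nu| by ring.
  by rewrite ler_wpM2r// ler_wpM2r.
by split; [apply: (le_trans h1)|apply: (le_trans h2)]; rewrite lerD2l.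
Qed.

Let cyb T nu t : `|t| <= T -> `|c nu * y nu t| <= nu0^-1 * (`|c nu| * b T nu).
Proof.
move=> tT; have [h _] := yb nu tT.
have [ax|xn] := gap_cases a0 nu.
  by rewrite /coupling ax !mul0r !normr0 mul0r mulr0.
rewrite normrM mulrCA ler_wpM2l// ler_pdivlMl//.
by rewrite (le_trans _ h)// normrM ler_wpM2r.
Qed.

Let cyb' T nu t : `|t| <= T -> `|c nu * y' nu t| <= `|c nu| * b T nu.
Proof. by move=> tT; have [_ h] := yb nu tT; rewrite normrM ler_wpM2l. Qed.

(** The eigenvalue equation in the component of frequency nu. *)
Let coupling_sqr nu : nu ^+ 2 * c nu = a nu + l0 ^+ 2 * c nu.
Proof.
have [ax|xn] := gap_cases a0 nu; first by rewrite /coupling ax mul0r !mulr0 addr0.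
have := gap_den_gt0 l00 l0nu0 xn; rewrite /coupling => /gt_eqF/negbT dn.
by field.
Qed.

Let cy''E nu t : c nu * y'' nu t =
  \1_B nu * (a nu * c nu) * x t - (a nu * y nu t + l0 ^+ 2 * (c nu * y nu t)).
Proof.
have -> : y'' nu t = \1_B nu * a nu * x t - nu ^+ 2 * y nu t by rewrite -ode addrK.
by rewrite mulrBr [c nu * (nu ^+ 2 * _)]mulrA [c nu * nu ^+ 2]mulrC coupling_sqr; ring.
Qed.

Let cyb'' T nu t : `|t| <= T -> `|c nu * y'' nu t| <=
  M * `|a nu * c nu| + nu0 / (nu0 ^+ 2 - l0 ^+ 2) * (`|a nu| * b T nu).
Proof.
move=> tT; have [h _] := yb nu tT.
have -> : c nu * y'' nu t = \1_B nu * (a nu * c nu) * x t - (nu * c nu) * (nu * y nu t).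
  have -> : y'' nu t = \1_B nu * a nu * x t - nu ^+ 2 * y nu t by rewrite -ode addrK.
  by ring.
rewrite (le_trans (ler_normB _ _))// lerD//.
  rewrite mulrC [leLHS]normrM ler_pM// indicE; case: (_ \in _); rewrite ?mul1r// mul0r normr0//.
rewrite [leLHS]normrM [leRHS]mulrA ler_pM//.
exact: (freq_coupling_le l00 l0nu0 a0 nu).
Qed.

Let Lc : L2 c. Proof. exact: (L2_coupling l00 l0nu0 da a0 ia). Qed.
Let iac : L1 setT (fun nu => a nu * c nu). Proof. exact: (L1_a_coupling l00 l0nu0 da a0 ia). Qed.
Let icb T : L1 setT (fun nu => `|c nu| * b T nu).
Proof. by apply: L2M => //; exact: L2_norm. Qed.
Let iab T : L1 setT (fun nu => `|a nu| * b T nu).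
Proof. by apply: L2M => //; apply: L2_norm; exact: L2_a da ia. Qed.

Let icy t : L1 setT (fun nu => c nu * y nu t).
Proof.
apply: (L1_le _ (mcy t) (L1Z nu0^-1 _ (icb `|t|))) => // nu _; exact: cyb.
Qed.

(** y' is a limit of difference quotients of y. *)
Let mcy' t : measurable_fun setT (fun nu => c nu * y' nu t).
Proof.
apply: (@measurable_fun_cvg _ _ R setT (fun n nu => (n.+1%:R^-1)^-1 *
  (c nu * y nu (t + n.+1%:R^-1) - c nu * y nu t))) => //.
  by move=> n; apply: measurable_funM => //; apply: measurable_funB.
move=> nu _.
have -> : (fun n => (n.+1%:R^-1)^-1 * (c nu * y nu (t + n.+1%:R^-1) - c nu * y nu t)) =
    fun n => c nu * ((n.+1%:R^-1)^-1 * (y nu (t + n.+1%:R^-1) - y nu t)).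
  by apply/funext => n; rewrite [RHS]mulrCA -mulrBr.
by apply: cvgM; [exact: cvg_cst|exact: (isder_seq (dy nu t))].
Qed.

Let icy' t : L1 setT (fun nu => c nu * y' nu t).
Proof. by apply: (L1_le _ (mcy' t) (icb `|t|)) => // nu _; exact: cyb'. Qed.

Let may t : measurable_fun setT (fun nu => a nu * y nu t).
Proof.
have -> : (fun nu => a nu * y nu t) = fun nu => (nu ^+ 2 - l0 ^+ 2) * (c nu * y nu t).
  by apply/funext => nu; rewrite mulrA mulrBl coupling_sqr addrK.
by apply: measurable_funM => //; apply: continuous_measurable_fun; apply: isd_ex_cont => z; eexists; isd.
Qed.

Let iay t : L1 setT (fun nu => a nu * y nu t).
Proof.
apply: (L1_le _ (may t) (L1Z nu0^-1 _ (iab `|t|))) => // nu _.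
have [ax|xn] := gap_cases a0 nu; first by rewrite ax !mul0r !normr0 mul0r mulr0.
have [h _] := yb nu (lexx `|t|).
by rewrite normrM mulrCA ler_wpM2l// ler_pdivlMl// (le_trans _ h)// normrM ler_wpM2r.
Qed.

Let near_le (t0 t : R) : t0 - 1 < t < t0 + 1 -> `|t| <= `|t0| + 1.
Proof.
move=> /andP[h1 h2]; have := ler_norm t0; have := ler_norm (- t0); rewrite normrN.
by rewrite ler_norml; move: `|t0| => z *; apply/andP; split; lra.
Qed.

(** The component of the motion along the eigenvector (1, c). *)
Let p t := x t + \int[mu]_nu (c nu * y nu t).
Let p' t := x' t + \int[mu]_nu (c nu * y' nu t).

Let dp (t : R) : isder p t (p' t).
Proof.
have dxt := dx t; apply: isdD => //.
apply: (@isder_Rintegral _ (fun s nu => c nu * y nu s) (fun s nu => c nu * y' nu s)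
    _ t icy _ (icb (`|t| + 1))) => [s nu|s nu /near_le].
  by have dyn := dy nu s; apply: isd_eq; [isd|rewrite /= mul0r add0r].
exact: cyb'.
Qed.

(** The two components of the eigenvalue equation, [coupling_sqr] and [Sv],
    cancel the coupling terms. *)
Let dp' (t : R) : isder p' t (- (l0 ^+ 2 * p t)).
Proof.
have dxt := dx' t.
have mT : measurable [set: R] by exact: measurableT.
have ig := L1D mT (L1Z M mT (L1_norm iac))
  (L1Z (nu0 / (nu0 ^+ 2 - l0 ^+ 2)) mT (iab (`|t| + 1))).
apply: (isd_eq (a := x'' t + \int[mu]_nu (c nu * y'' nu t))).
  apply: isdD => //; apply: (@isder_Rintegral _ (fun s nu => c nu * y' nu s)
    (fun s nu => c nu * y'' nu s) _ t icy' _ ig) => [s nu|s nu /near_le].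
    by have dyn := dy' nu s; apply: isd_eq; [isd|rewrite /= mul0r add0r].
  exact: cyb''.
have iBac := L1_indic mB iac.
have iBacx : L1 setT (fun nu => \1_B nu * (a nu * c nu) * x t).
  by under eq_fun do rewrite mulrC; exact: L1Z.
have ilcy := L1Z (l0 ^+ 2) measurableT (icy t).
under eq_Rintegral do rewrite cy''E.
rewrite (RintB measurableT iBacx (L1D measurableT (iay t) ilcy)).
rewrite (RintD measurableT (iay t) ilcy) (RintZl _ measurableT (icy t)) (RintZr _ measurableT iBac).
by rewrite (Rint_indic_conull mB B0 iac) -/S Sv eqx /p; ring.
Qed.

Let p_harmonic (t : R) : p t = p 0 * cos (l0 * t) + p' 0 / l0 * sin (l0 * t).
Proof.
have E s : - (l0 ^+ 2 * p s) + l0 ^+ 2 * p s = 0 by rewrite addNr.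
have [|h _] := oscillator_dist dp dp' E (K := 0) t; first by move=> s; rewrite normr0.
move: h; rewrite mul0r normr_le0 subr_eq0 => /eqP h.
have -> : p t = l0^-1 * (l0 * p t) by rewrite mulrA mulVf ?mul1r// gt_eqF.
by rewrite h; field; rewrite gt_eqF.
Qed.

(** The squared norm of the eigenvector. *)
Let N := 1 + \int[mu]_nu (c nu * c nu).
Let icc : L1 setT (fun nu => c nu * c nu). Proof. exact: L2M. Qed.
Let N0 : N != 0.
Proof. by rewrite gt_eqF// ltr_pwDl// Rintegral_ge0// => nu _; rewrite -expr2 sqr_ge0. Qed.

Let P t := N^-1 * p t.
Let P' t := N^-1 * p' t.
Let dP (t : R) : isder P t (P' t).
Proof. by have h := dp t; apply: isd_eq; [isd|rewrite /= mul0r add0r]. Qed.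
Let dP' (t : R) : isder P' t (- (l0 ^+ 2 * P t)).
Proof. by have h := dp' t; apply: isd_eq; [isd|rewrite /= /P; ring]. Qed.

Let X t := x t - P t.
Let X' t := x' t - P' t.
Let dX (t : R) : isder X t (X' t).
Proof. by have h := dP t; have h' := dx t; apply: isd_eq; [isd|]. Qed.

Let Y nu t := y nu t - \1_B nu * c nu * P t.
Let Y' nu t := y' nu t - \1_B nu * c nu * P' t.
Let Y'' nu t := y'' nu t + \1_B nu * c nu * l0 ^+ 2 * P t.
Let dY (nu t : R) : isder (Y nu) t (Y' nu t).
Proof. by have h := dP t; have h' := dy nu t; apply: isd_eq; [isd|rewrite /= /Y'; ring]. Qed.
Let dY' (nu t : R) : isder (Y' nu) t (Y'' nu t).
Proof. by have h := dP' t; have h' := dy' nu t; apply: isd_eq; [isd|rewrite /= /Y''; ring]. Qed.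

Let odeY nu t : Y'' nu t + nu ^+ 2 * Y nu t = \1_B nu * a nu * X t.
Proof.
have -> : Y'' nu t + nu ^+ 2 * Y nu t = (y'' nu t + nu ^+ 2 * y nu t)
  - \1_B nu * (nu ^+ 2 * c nu - l0 ^+ 2 * c nu) * P t by rewrite /Y'' /Y; ring.
by rewrite ode coupling_sqr addrK /X; ring.
Qed.

(** The pair (X, Y) is orthogonal to the eigenvector. *)
Let XY t : \int[mu]_nu (c nu * Y nu t) = - X t.
Proof.
have iB := L1_indic mB icc.
have iBP : L1 setT (fun nu => P t * (\1_B nu * (c nu * c nu))) by exact: L1Z.
transitivity (\int[mu]_nu (c nu * y nu t - P t * (\1_B nu * (c nu * c nu)))).
  by apply: eq_Rintegral => nu _; rewrite /Y; ring.
rewrite (RintB measurableT (icy t) iBP) (RintZl _ measurableT iB) (Rint_indic_conull mB B0 icc).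
have e1 : \int[mu]_nu (c nu * y nu t) = N * P t - x t.
  by rewrite /P mulrA mulfV// mul1r /p addrAC subrr add0r.
have e2 : \int[mu]_nu (c nu * c nu) = N - 1 by rewrite /N addrAC subrr add0r.
by rewrite e1 e2 /X; ring.
Qed.

Let amp := `|p 0| + `|p' 0 / l0|.
Let p_bound t : `|p t| <= amp.
Proof.
rewrite p_harmonic (le_trans (ler_normD _ _))// !normrM lerD//.
  by rewrite -[leRHS]mulr1 ler_pM// cos_max.
by rewrite -normrM normrM -[leRHS]mulr1 ler_pM// sin_max.
Qed.

Let p'_bound t : `|p' t| <= l0 * amp.
Proof.
have E s : - (l0 ^+ 2 * p s) + l0 ^+ 2 * p s = 0 by rewrite addNr.
have [|_ h] := oscillator_dist dp dp' E (K := 0) t; first by move=> s; rewrite normr0.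
move: h; rewrite mul0r normr_le0 subr_eq0 => /eqP ->.
have -> : l0 * amp = `|l0 * p 0| + `|p' 0|.
  rewrite /amp mulrDr !normrM normfV (gtr0_norm l00) [l0 * (_ / _)]mulrCA mulfV ?mulr1//.
  by rewrite gt_eqF.
rewrite (le_trans (ler_normB _ _))// addrC lerD//.
  by rewrite normrM -[leRHS]mulr1 ler_pM// sin_max.
by rewrite normrM -[leRHS]mulr1 ler_pM// cos_max.
Qed.

Let XM t : `|X t| <= M + `|N^-1| * amp.
Proof. by rewrite (le_trans (ler_normB _ _))// lerD// /P normrM ler_wpM2l. Qed.
Let X'M t : `|X' t| <= L + `|N^-1| * (l0 * amp).
Proof. by rewrite (le_trans (ler_normB _ _))// lerD// /P' normrM ler_wpM2l. Qed.

Let bY nu := (`|nu * y nu 0| + `|y' nu 0|) +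
  (`|P 0| * (nu0 / (nu0 ^+ 2 - l0 ^+ 2)) * `|a nu| + `|P' 0| * `|c nu|).
Let LbY : L2 bY.
Proof.
apply: L2D => //; apply: L2D; apply: L2Z; apply: L2_norm => //; exact: L2_a da ia.
Qed.
Let Yb nu : `|nu * Y nu 0| + `|Y' nu 0| <= bY nu.
Proof.
have B1 : `|\1_B nu| <= 1 :> R by rewrite indicE; case: (_ \in _); rewrite ?normr1 ?normr0.
have h1 : `|nu * Y nu 0| <= `|nu * y nu 0| + `|P 0| * (nu0 / (nu0 ^+ 2 - l0 ^+ 2)) * `|a nu|.
  rewrite /Y mulrBr (le_trans (ler_normB _ _))// lerD2l.
  have -> : nu * (\1_B nu * c nu * P 0) = \1_B nu * (P 0 * (nu * c nu)) by ring.
  rewrite normrM -[leRHS]mul1r ler_pM// normrM -[leRHS]mulrA ler_wpM2l//.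
  exact: (freq_coupling_le l00 l0nu0 a0).
have h2 : `|Y' nu 0| <= `|y' nu 0| + `|P' 0| * `|c nu|.
  rewrite /Y' (le_trans (ler_normB _ _))// lerD2l -mulrA [c nu * _]mulrC.
  by rewrite normrM -[leRHS]mul1r ler_pM// normrM.
by rewrite (le_trans (lerD h1 h2))// /bY addrACA.
Qed.

Let mc : measurable_fun setT c. Proof. by case: Lc. Qed.
Let mcB k : measurable_fun setT (fun nu => c nu * (\1_B nu * c nu * k)).
Proof.
by apply: measurable_funM => //; apply: measurable_funM => //; apply: measurable_funM.
Qed.
Let mcY t : measurable_fun setT (fun nu => c nu * Y nu t).
Proof. by under eq_fun do rewrite /Y mulrBr; apply: measurable_funB. Qed.
Let mcY' t : measurable_fun setT (fun nu => c nu * Y' nu t).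
Proof. by under eq_fun do rewrite /Y' mulrBr; apply: measurable_funB. Qed.

Let X_pinfty : X t @[t --> +oo] --> (0 : R).
Proof.
exact: (model_decay l00 l0nu0 da ca' aM a'M a0 apos ia mB B0 dX XM X'M dY dY' odeY
  (mcY 0) (mcY' 0) LbY Yb XY).
Qed.

Let isd_rev (f : R -> R) (t l : R) : isder f (- t) l -> isder (fun s => f (- s)) t (- l).
Proof.
move=> df; apply: isd_eq; first by apply: isd_comp df _; isd.
by rewrite /= mulrN mulr1.
Qed.

(** The equations are invariant under time reversal. *)
Let X_ninfty : X t @[t --> -oo] --> (0 : R).
Proof.
apply/cvgNy_compNP.
apply: (model_decay l00 l0nu0 da ca' aM a'M a0 apos ia mB B0
  (X := fun t => X (- t)) (X' := fun t => - X' (- t))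
  (Y := fun nu t => Y nu (- t)) (Y' := fun nu t => - Y' nu (- t)) (Y'' := fun nu t => Y'' nu (- t))
  (b := bY) (M := M + `|N^-1| * amp) (L := L + `|N^-1| * (l0 * amp))).
- by move=> t; apply: isd_rev.
- by move=> t; exact: XM.
- by move=> t; rewrite normrN.
- by move=> nu t; apply: isd_rev.
- by move=> nu t; rewrite -[Y'' _ _]opprK; apply: isdN; exact: isd_rev.
- by move=> nu t; exact: odeY.
- by rewrite oppr0.
- by under eq_fun do rewrite mulrN; rewrite oppr0; apply: measurableT_comp.
- exact: LbY.
- by move=> nu; rewrite oppr0 normrN.
- by move=> t; exact: XY.
Qed.

(** What is left after subtracting the component along the eigenvector (1, c)
    decays in both time directions by [model_decay]. *)
Lemma trapped_mode_decomposition : exists (A C : R) (theta : R -> R),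
  [/\ forall t, x t = A * cos (l0 * t) + C * sin (l0 * t) + theta t,
      exists K, forall t, `|theta t| <= K,
      exists K, forall s t, `|theta s - theta t| <= K * `|s - t|,
      theta t @[t --> +oo] --> (0 : R) & theta t @[t --> -oo] --> (0 : R)].
Proof.
exists (N^-1 * p 0), (N^-1 * (p' 0 / l0)), X; split.
- by move=> t; rewrite /X /P (p_harmonic t); ring.
- by exists (M + `|N^-1| * amp).
- by exists (L + `|N^-1| * (l0 * amp)); exact: isder_lipschitz.
- exact: X_pinfty.
- exact: X_ninfty.
Qed.

End Dynamics.

(** * Fourier transforms of measures and extended quotients *)

Section FourierOfMeasures.
Context {R : realType}.
Notation finm := {finite_measure set (measurableTypeR R) -> \bar R}.

Lemma bounded_continuous_fourier (m : finm) (F : R -> R) :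
  continuous F -> (forall x, `|F x| <= 1) ->
  (exists M, forall t : R, `|\int[m]_x F (- (t * x))| <= M) /\
  continuous (fun t : R => \int[m]_x F (- (t * x))).
Proof.
move=> cF F1.
have i1 : m.-integrable setT (EFin \o (fun=> 1 : R)).
  by apply: (@finite_measure_integrable_cst _ (measurableTypeR R) R m setT 1 measurableT).
have cFt (t : R) : continuous (fun x : R => F (- (t * x))).
  move=> x; apply: (@cvg_comp _ _ _ (fun x : R => - (t * x)) F); last exact: cF.
  by apply: (isd_ex_cont (f := fun x : R => - (t * x))) => z; eexists; isd.
have mF t : measurable_fun [set: measurableTypeR R] (fun x => F (- (t * x))).
  exact: continuous_measurable_fun.
have iF t : m.-integrable setT (EFin \o (fun x => F (- (t * x)))).
  apply: (le_integrable _ _ _ i1) => //; first exact/measurable_EFinP.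
  by move=> x _ /=; rewrite lee_fin normr1.
split.
- exists (\int[m]_x (1 : R)) => t.
  apply: le_trans (le_normr_Rintegral _ (iF t)) _ => //.
  apply: le_Rintegral => //; first exact: (integrable_norm (iF t)).
- move=> t.
  have It : t \in `]t - 1, t + 1[%classic.
    by rewrite inE/= in_itv/= ltrDl ltr01 ltrBlDr ltrDl ltr01.
  apply: (@continuity_under_integral _ _ _ m (fun t x => F (- (t * x))) setT measurableT (t - 1) (t + 1) _ _ (fun=> 1) i1) => //.
  + apply: aeW => x _ y _.
    apply: (@cvg_comp _ _ _ (fun y : R => - (y * x)) F); last exact: cF.
    by apply: (isd_ex_cont (f := fun y : R => - (y * x))) => z; eexists; isd.
  + by move=> x _; apply: aeW => y _; exact: F1.
Qed.

(** The transforms of finite measures are bounded and, by dominated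
    convergence, continuous; only their real or imaginary parts enter. *)
Lemma in_hatM_real (g : R -> R) : in_hatM (fun t => (g t)%:C%C) ->
  (exists M, forall t, `|g t| <= M) /\ continuous g.
Proof.
move=> [m1 [m2 [m3 [m4 H]]]].
have ccos : continuous (@cos R) by exact: continuous_cos.
have csin : continuous (@sin R) by exact: continuous_sin.
have [[M1 h1] c1] := bounded_continuous_fourier m1 ccos (@cos_max R).
have [[M2 h2] c2] := bounded_continuous_fourier m2 ccos (@cos_max R).
have [[M3 h3] c3] := bounded_continuous_fourier m3 csin (@sin_max R).
have [[M4 h4] c4] := bounded_continuous_fourier m4 csin (@sin_max R).
have gE t : g t = (\int[m1]_x cos (- (t * x)) - \int[m2]_x cos (- (t * x))) -
    (\int[m3]_x sin (- (t * x)) - \int[m4]_x sin (- (t * x))).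
  move: (H t) => /(congr1 (@complex.Re R)) /= ->.
  by rewrite !mul0r !mul1r sub0r.
split.
- exists ((M1 + M2) + (M3 + M4)) => t; rewrite gE.
  by rewrite (le_trans (ler_normB _ _))// lerD// (le_trans (ler_normB _ _))// lerD.
- have -> : g = (fun t => (\int[m1]_x cos (- (t * x)) - \int[m2]_x cos (- (t * x))) -
    (\int[m3]_x sin (- (t * x)) - \int[m4]_x sin (- (t * x)))) by apply/funext.
  by move=> t; apply: cvgB; apply: cvgB; [exact: c1|exact: c2|exact: c3|exact: c4].
Qed.

End FourierOfMeasures.

Section ExtendedQuotient.
Context {R : realType}.
Notation mu := (@lebesgue_measure R).

(** With 0^-1 = 0, the inverse is the pointwise limit of x / (x^2 + 1/n). *)
Lemma measurable_invR : measurable_fun setT (fun x : R => x^-1 : R).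
Proof.
apply: (@measurable_fun_cvg _ _ R setT (fun n (x : R) => x * (x ^+ 2 + n.+1%:R^-1)^-1)) => //.
  move=> n; apply: continuous_measurable_fun => x; apply: cvgM; first exact: cvg_id.
  have h : x ^+ 2 + n.+1%:R^-1 != 0 :> R by rewrite gt_eqF// ltr_wpDl ?sqr_ge0.
  apply: cvgV => //; apply: cvgD; [exact: exprn_continuous|exact: cvg_cst].
move=> x _; have [->|x0] := eqVneq x 0.
  by rewrite invr0; under eq_fun do rewrite mul0r; exact: cvg_cst.
have -> : x^-1 = x * (x ^+ 2 + 0)^-1 by field.
apply: cvgM; first exact: cvg_cst.
apply: cvgV; first by rewrite addr0 expf_neq0.
by apply: cvgD; [exact: cvg_cst|exact: (@cvg_harmonic R)].
Qed.

Lemma measurable_ediv (f g : R -> R) : measurable_fun setT f -> measurable_fun setT g ->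
  measurable_fun setT (fun x => ((f x)%:E / (g x)%:E)%E).
Proof.
move=> mf mg; apply: emeasurable_funM; first exact/measurable_EFinP.
under eq_fun do rewrite inver.
apply: measurable_fun_ifT => //; first exact: measurable_fun_eqr.
by apply/measurable_EFinP; apply: measurableT_comp => //; exact: measurable_invR.
Qed.

(** The extended quotient is infinite where g vanishes and f does not. A
    finite integral therefore makes f vanish almost everywhere on the zeros of
    g, and the quotient dominates h everywhere. *)
Lemma ediv_finite (f g h : R -> R) :
  measurable_fun setT f -> measurable_fun setT g -> measurable_fun setT h ->
  (forall x, 0 <= f x) -> (forall x, 0 <= g x) -> (forall x, 0 <= h x) ->
  (forall x, g x != 0 -> h x <= f x / g x) -> (forall x, g x = 0 -> h x = 0) ->
  (\int[mu]_x ((f x)%:E / (g x)%:E) < +oo)%E ->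
  [/\ L1 setT h,
      \int[mu]_x h x <= fine (\int[mu]_x ((f x)%:E / (g x)%:E))%E &
      {ae mu, forall x, g x = 0 -> f x = 0}].
Proof.
move=> mf mg mh f0 g0 h0 hfg hg0 fin.
have mq := measurable_ediv mf mg.
have q0 x : (0 <= (f x)%:E / (g x)%:E)%E by rewrite mule_ge0 ?inve_ge0 ?lee_fin.
have hq x : ((h x)%:E <= (f x)%:E / (g x)%:E)%E.
  have [gx|gx] := eqVneq (g x) 0; first by rewrite hg0.
  by rewrite inver (negbTE gx) -EFinM lee_fin hfg.
have meh : measurable_fun setT (EFin \o h) by exact/measurable_EFinP.
have le : (\int[mu]_x (h x)%:E <= \int[mu]_x ((f x)%:E / (g x)%:E))%E.
  by apply: ge0_le_integral => // x _; rewrite lee_fin.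
have ih : mu.-integrable setT (EFin \o h).
  apply/integrableP; split => //; under eq_integral do rewrite /= ger0_norm//.
  exact: le_lt_trans le fin.
split; first by constructor.
- rewrite /Rintegral fine_le// ge0_fin_numE ?integral_ge0// => [|x _]; last by rewrite lee_fin.
  exact: le_lt_trans le fin.
- have iq : mu.-integrable setT (fun x => ((f x)%:E / (g x)%:E)%E).
    apply/integrableP; split => //; under eq_integral do rewrite gee0_abs//.
    exact: fin.
  have := integrable_ae measurableT iq; apply: filterS => x /(_ I) + gx.
  rewrite gx inver eqxx; have [//|fx] := eqVneq (f x) 0.
  have fx0 : (0 < (f x)%:E)%E by rewrite lte_fin lt_neqAle eq_sym fx f0.
  by rewrite (gt0_muley fx0) => /fin_numP[_ /eqP].
Qed.

End ExtendedQuotient.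

(** * Complex-valued functions and the memory kernel *)

Section ComplexValued.
Context {R : realType}.

Lemma norm_realc (r : R) : `|r%:C%C| = `|r|%:C%C.
Proof. by rewrite normc_def /= expr0n addr0 sqrtr_sqr. Qed.

Lemma realc_cvg0 (F : set_system R) (f : R -> R) : Filter F ->
  f t @[t --> F] --> (0 : R) -> (f t)%:C%C @[t --> F] --> (0 : (R[i])^o).
Proof.
move=> FF f0; apply/(@cvgrPdist_lt _ (R[i])^o _ F FF (fun t => (f t)%:C%C) 0) => e; rewrite ltcE => /andP[/eqP ie re].
have := (@cvgrPdist_lt _ _ _ F FF f (0 : R)).1 f0 _ re; apply: filterS => t.
by rewrite !sub0r !normrN norm_realc ltcE /= ie eqxx.
Qed.

Lemma in_C0_real (f : R -> R) : (exists K, forall t, `|f t| <= K) ->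
  (exists K, forall s t, `|f s - f t| <= K * `|s - t|) ->
  f t @[t --> +oo] --> (0 : R) -> f t @[t --> -oo] --> (0 : R) ->
  in_C0 (fun t => (f t)%:C%C).
Proof.
move=> [K fK] [L fL] fp fn; split; [split|exact: realc_cvg0|exact: realc_cvg0].
- exists K%:C%C; split; first by rewrite complex_real.
  move=> M KM t _ /=; apply: le_trans (ltW KM).
  by rewrite norm_realc lecR.
- move=> A; rewrite /= -entourage_ballE => -[e /=]; rewrite ltcE => /andP[/eqP ie re] eA.
  rewrite -entourage_ballE /=.
  have L0 : 0 < `|L| + 1 by rewrite ltr_wpDl.
  exists (complex.Re e / (`|L| + 1)); first by rewrite /= divr_gt0.
  move=> [s t] /= st; apply: eA => /=.
  rewrite /ball/= -rmorphB norm_realc ltcE /= ie eqxx/=.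
  apply: le_lt_trans (fL s t) _.
  apply: (@le_lt_trans _ _ ((`|L| + 1) * `|s - t|)).
    by rewrite ler_wpM2r// (le_trans (ler_norm L))// lerDl.
  by rewrite mulrC -ltr_pdivlMr.
Qed.

End ComplexValued.

Section CausalKernel.
Context {R : realType}.
Notation mu := (@lebesgue_measure R).
Variables rho kappa : R -> R.
Local Notation a := (ahat rho kappa).
Hypothesis ik : L1 setT (memory_density a).

Let s (nu : R) := 2 * pi * memory_density a nu.

Let whatE nu : what rho kappa nu = (0 +i* - s nu)%C.
Proof.
rewrite /what /s /memory_density /memory_weight; have [->|nu0] := eqVneq nu 0.
  by rewrite mulr0 !invr0 !mulr0 oppr0.
have d : ('i * nu%:C)%C != 0 :> R[i].
  by rewrite mulf_neq0// ?eq_complex/= ?oner_eq0 ?andbF// (negbTE nu0).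
apply: (mulIf d); rewrite mulfVK//.
apply/eqP; rewrite eq_complex/=; apply/andP; split; apply/eqP; last by ring.
by field.
Qed.

Let sinTN (t : R) : sinT (memory_density a) (- t) = - sinT (memory_density a) t.
Proof.
rewrite -[RHS]mulN1r /sinT -(RintZl _ measurableT (L1_sin t measurableT ik)).
by apply: eq_Rintegral => nu _; rewrite mulNr sinN; ring.
Qed.

Let cosTN (t : R) : cosT (memory_density a) (- t) = cosT (memory_density a) t.
Proof. by apply: eq_Rintegral => nu _; rewrite mulNr cosN. Qed.

Let wE (t : R) : w rho kappa t = (sinT (memory_density a) t +i* - cosT (memory_density a) t)%C.
Proof.
have pi0 : 2 * pi != 0 :> R by rewrite mulf_neq0 ?gt_eqF ?pi_gt0.
rewrite /w /inv_fourier /cintegral.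
have -> : \int[mu]_nu complex.Re (expi (nu * t) * what rho kappa nu) = 2 * pi * sinT (memory_density a) t.
  rewrite /sinT -(RintZl _ measurableT (L1_sin t measurableT ik)); apply: eq_Rintegral => nu _.
  by rewrite whatE /s /= [t * nu]mulrC; ring.
have -> : \int[mu]_nu complex.Im (expi (nu * t) * what rho kappa nu) = - (2 * pi) * cosT (memory_density a) t.
  rewrite /cosT -(RintZl _ measurableT (L1_cos t measurableT ik)); apply: eq_Rintegral => nu _.
  by rewrite whatE /s /= [t * nu]mulrC; ring.
apply/eqP; rewrite eq_complex/=; apply/andP; split; apply/eqP.
  by move: (2 * pi) pi0 => z z0; field.
by move: (2 * pi) pi0 => z z0; field.
Qed.

Let wplusE (t : R) : wplus rho kappa t = (causal (sinT (memory_density a)) t)%:C%C.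
Proof.
rewrite /wplus /causal; case: ifP => // _.
rewrite !wE sinTN cosTN.
have -> : (sinT (memory_density a) t +i* - cosT (memory_density a) t)%C - (- sinT (memory_density a) t +i* - cosT (memory_density a) t)%C
    = 2 * (sinT (memory_density a) t)%:C%C.
  by apply/eqP; rewrite eq_complex/=; apply/andP; split; apply/eqP; ring.
by rewrite mulrA mulVf ?mul1r// pnatr_eq0.
Qed.

(** w is the inverse transform of - 2 i pi a^2 / nu, so its real and imaginary
    parts are a sine and a cosine transform of a^2 / nu. Only the first is
    odd, and wplus is the odd part of w at positive times. *)
Lemma Re_hat_wplus (l : R) :
  complex.Re (hat_wplus rho kappa l) = cosT (causal (sinT (memory_density a))) l.
Proof.
rewrite /hat_wplus /fourier /=; apply: eq_Rintegral => t _.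
by rewrite wplusE /= cosN mulr0 subr0 mulrC.
Qed.

End CausalKernel.

(** * Weighted coordinates of the thermostat *)

Section ReducedSystem.
Context {R : realType}.
Notation mu := (@lebesgue_measure R).

Lemma derivable_isder (f : R -> R) (t : R) : derivable f t 1 -> isder f t (derive1 f t).
Proof. by move=> df; rewrite derive1E; exact: derivableP. Qed.

Variables (rho kappa : R -> R) (x : R -> R) (xi : R -> R -> R) (B : set R).
Hypotheses (rho0 : forall nu, 0 <= rho nu) (mB : measurable B) (B0 : mu (~` B) = 0)
  (xid : forall nu, B nu -> forall t, derivable (xi nu) t 1 /\ derivable (derive1 (xi nu)) t 1)
  (xiode : forall nu, B nu -> forall t,
     rho nu * (derive1 (derive1 (xi nu)) t + nu ^+ 2 * xi nu t) = kappa nu * x t)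
  (kappa0 : forall nu, B nu -> rho nu = 0 -> kappa nu = 0).

Local Notation a := (ahat rho kappa).

(** The factor sqrt rho makes the coupling symmetric; the indicator of B stops
    the oscillators of an exceptional null set, so that the equations hold for
    every frequency. *)
Definition weighted (f : R -> R -> R) nu t := \1_B nu * (Num.sqrt (rho nu) * f nu t).

Local Notation y := (weighted xi).
Local Notation y' := (weighted (fun nu => derive1 (xi nu))).
Local Notation y'' := (weighted (fun nu => derive1 (derive1 (xi nu)))).

Let indic_cases nu : (B nu /\ \1_B nu = 1 :> R) \/ \1_B nu = 0 :> R.
Proof.
by rewrite indicE; case: (boolP (nu \in B)) => [/set_mem|_]; [left|right].
Qed.

Let ahat_sqrt nu : ahat rho kappa nu * Num.sqrt (rho nu) = if rho nu == 0 then 0 else kappa nu.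
Proof.
rewrite /ahat; have [->|r0] := eqVneq (rho nu) 0; first by rewrite sqrtr0 mulr0.
by rewrite mulfVK// sqrtr_eq0 -ltNge lt_neqAle eq_sym r0 rho0.
Qed.

Lemma weighted_isder (nu t : R) : isder (y nu) t (y' nu t).
Proof.
rewrite /weighted; case: (indic_cases nu) => [[Bn ->]|->]; last first.
  by under eq_fun do rewrite mul0r; rewrite mul0r; exact: isd_cst.
have h := derivable_isder (xid Bn t).1.
by apply: isd_eq; [isd|rewrite /=; ring].
Qed.

Lemma weighted_isder' (nu t : R) : isder (y' nu) t (y'' nu t).
Proof.
rewrite /weighted; case: (indic_cases nu) => [[Bn ->]|->]; last first.
  by under eq_fun do rewrite mul0r; rewrite mul0r; exact: isd_cst.
have h := derivable_isder (xid Bn t).2.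
by apply: isd_eq; [isd|rewrite /=; ring].
Qed.

Lemma weighted_ode nu t : y'' nu t + nu ^+ 2 * y nu t = \1_B nu * a nu * x t.
Proof.
rewrite /weighted; case: (indic_cases nu) => [[Bn ->]|->]; last by rewrite !mul0r mulr0 addr0.
rewrite !mul1r /ahat; have [r0|r0] := eqVneq (rho nu) 0.
  by rewrite r0 sqrtr0 invr0 !(mul0r, mulr0) addr0.
have s0 : Num.sqrt (rho nu) != 0 by rewrite sqrtr_eq0 -ltNge lt_neqAle eq_sym r0 rho0.
rewrite [RHS]mulrAC -(xiode Bn) -[X in X * (_ + _) / _](sqr_sqrtr (rho0 nu)).
by field.
Qed.

Lemma ahat_weighted nu t : a nu * y nu t = \1_B nu * (kappa nu * xi nu t).
Proof.
rewrite /weighted; case: (indic_cases nu) => [[Bn ->]|->]; last by rewrite !mul0r mulr0.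
rewrite !mul1r mulrA ahat_sqrt; case: eqP => // r0.
by rewrite (kappa0 Bn r0).
Qed.

Hypothesis a00 : a 0 = 0.

(** The square of sqrt(rho) nu xi - x a / nu. Integrated, it shows that
    eliminating the thermostat lowers the stiffness v by at most K. *)
Lemma potential_square nu t : 0 <=
  \1_B nu * (rho nu * nu ^+ 2 * xi nu t ^+ 2 - 2 * x t * (kappa nu * xi nu t)
             + x t ^+ 2 * (a nu ^+ 2 * nu^-1 ^+ 2)).
Proof.
have := ahat_weighted nu t; rewrite /weighted.
case: (indic_cases nu) => [[Bn ->]|->]; last by rewrite !mul0r.
rewrite !mul1r => <-; rewrite -{1}[rho nu](sqr_sqrtr (rho0 nu)).
move: (Num.sqrt _) (xi nu t) (x t) => r z u.
have [->|nu0] := eqVneq nu 0.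
  by rewrite a00 expr0n/= !(mul0r, mulr0) subr0 addr0.
have -> : r ^+ 2 * nu ^+ 2 * z ^+ 2 - 2 * u * (a nu * (r * z)) + u ^+ 2 * (a nu ^+ 2 * nu^-1 ^+ 2)
   = (r * nu * z - u * a nu / nu) ^+ 2 by field.
exact: sqr_ge0.
Qed.

Lemma weighted_amplitude nu : `|nu * y nu 0| + `|y' nu 0| =
  \1_B nu * (Num.sqrt (rho nu) * (`|nu * xi nu 0| + `|derive1 (xi nu) 0|)).
Proof.
rewrite /weighted; case: (indic_cases nu) => [[Bn ->]|->]; last first.
  by rewrite !mul0r mulr0 normr0 addr0.
by rewrite !mul1r mulrCA [in LHS]normrM [in X in _ + X]normrM ger0_norm ?sqrtr_ge0// mulrDr.
Qed.

End ReducedSystem.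

(** * Energy bounds and the decomposition of the motion *)

Section Final.
Context {R : realType}.

(** Subtracting the completed square [potential_square] from twice the energy
    leaves V^2 + (v - k) X^2 and nonnegative terms. *)
Lemma energy_coercive (v k E X V T U W : R) : 0 < v - k -> 0 <= T ->
  0 <= U - 2 * X * W + X ^+ 2 * k ->
  2^-1 * V ^+ 2 + 2^-1 * T + 2^-1 * v * X ^+ 2 + 2^-1 * U - X * W = E ->
  `|X| <= 2 * E / (v - k) + 1 /\ `|V| <= 2 * E + 1.
Proof.
move=> vk T0 h e.
have h1 : V ^+ 2 + (v - k) * X ^+ 2 <= 2 * E.
  rewrite -e -subr_ge0.
  have -> : 2 * (2^-1 * V ^+ 2 + 2^-1 * T + 2^-1 * v * X ^+ 2 + 2^-1 * U - X * W) -
    (V ^+ 2 + (v - k) * X ^+ 2) = T + (U - 2 * X * W + X ^+ 2 * k) by field.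
  exact: addr_ge0.
have norm_sqr (z : R) : `|z| <= z ^+ 2 + 1.
  rewrite -[z ^+ 2]real_normK ?num_real//; move: `|z| => r.
  by have := sqr_ge0 (r - 2^-1); nra.
split.
  apply: le_trans (norm_sqr X) _; rewrite lerD2r ler_pdivlMr// mulrC.
  by apply: le_trans h1; rewrite lerDr sqr_ge0.
apply: le_trans (norm_sqr V) _; rewrite lerD2r.
by apply: le_trans h1; rewrite lerDl mulr_ge0 ?sqr_ge0 ?ltW.
Qed.

(** The real form of the two exponentials, with alpha = (A - i C) / 2. *)
Lemma trig_complex (A C l t : R) :
  (A * cos (l * t) + C * sin (l * t))%:C%C =
  (A / 2 +i* - (C / 2))%C * expi (l * t) + ((A / 2 +i* - (C / 2))%C)^*%C * expi (- (l * t)).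
Proof.
apply/eqP; rewrite eq_complex/= cosN sinN; apply/andP; split; apply/eqP; by field.
Qed.

End Final.

Local Notation mu := lebesgue_measure.

Theorem theorem4 (R : realType) (v x0 dx0 nu0 lambda0 : R)
    (rho kappa xi0 dxi0 : R -> R) (x : R -> R) (xi : R -> R -> R)
    (rho_meas : measurable_fun [set: R] rho)
    (kappa_meas : measurable_fun [set: R] kappa)
    (xi0_meas : measurable_fun [set: R] xi0)
    (dxi0_meas : measurable_fun [set: R] dxi0)
    (v_gt0 : 0 < v)
    (h1_rho : forall nu, 0 <= rho nu)
    (h1_supp : supp kappa `<=` supp rho)
    (h2_kappa : (int_kappa2_rho rho kappa < +oo)%E)
    (h2_K : (eK rho kappa < +oo)%E)
    (h3 : 0 < v - K rho kappa)
    (h4 : (\int[@lebesgue_measure R]_nu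
             (rho nu * (dxi0 nu ^+ 2 + nu ^+ 2 * xi0 nu ^+ 2))%:E < +oo)%E)
    (h5 : fourier_regular rho kappa)
    (hT : transparency_gap rho kappa nu0)
    (hw_plus : v%:C%C < hat_wplus rho kappa nu0)
    (hw_minus : v%:C%C < hat_wminus rho kappa nu0)
    (lambda0_in : 0 < lambda0 < nu0)
    (Phiplus_lambda0 : hat_Phiplus rho kappa v lambda0 = 0)
    (Phiminus_lambda0 : hat_Phiminus rho kappa v lambda0 = 0)
    (hsol : solution rho kappa v x0 dx0 xi0 dxi0 x xi)
    (henergy : finite_constant_energy rho kappa v x xi) :
  exists (alpha : R[i]) (theta : R -> R[i]),
    in_C0 theta /\
    forall t : R,
      (x t)%:C%C = alpha * expi (lambda0 * t)
                   + alpha^*%C * expi (- (lambda0 * t)) + theta t.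
Proof.
pose a := ahat rho kappa.
have /andP[l00 l0nu0] := lambda0_in.
have [/in_hatM_real[[Ma aM] ca] dera /in_hatM_real[[Ma' a'M] ca'] _ a00] := h5.
have [_ az apos _ _] := hT.
have [xder ikx xode hae _] := hsol.
have [efin [E eE]] := henergy.
have da (nu : R) : isder a nu (derive1 a nu) by exact: derivable_isder.
have ma : measurable_fun setT a by exact: continuous_measurable_fun.
have a_rho nu : rho nu = 0 -> a nu = 0 by move=> r0; rewrite /a /ahat r0 sqrtr0 invr0 mulr0.
have a_sqr nu : a nu ^+ 2 = kappa nu ^+ 2 / rho nu.
  by rewrite /a /ahat expr_div_n sqr_sqrtr.
have [ia _ kappa_ae] : [/\ L1 setT (fun nu => a nu ^+ 2),
    \int[mu]_nu (a nu ^+ 2) <= fine (\int[mu]_nu ((kappa nu ^+ 2)%:E / (rho nu)%:E))%E &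
    {ae mu, forall nu, rho nu = 0 -> kappa nu ^+ 2 = 0}].
  apply: ediv_finite => //.
  - exact: measurable_funX.
  - exact: measurable_funX.
  - by move=> nu; rewrite sqr_ge0.
  - by move=> nu; rewrite sqr_ge0.
  - by move=> nu _; rewrite a_sqr.
  - by move=> nu r0; rewrite a_rho// expr0n.
have [iK leK _] : [/\ L1 setT (fun nu => a nu ^+ 2 * nu^-1 ^+ 2),
    \int[mu]_nu (a nu ^+ 2 * nu^-1 ^+ 2) <= K rho kappa &
    {ae mu, forall nu, rho nu * nu ^+ 2 = 0 -> kappa nu ^+ 2 = 0}].
  apply: ediv_finite => //.
  - exact: measurable_funX.
  - by apply: measurable_funM => //; exact: measurable_funX.
  - apply: measurable_funM; first exact: measurable_funX.
    by apply: measurable_funX; exact: measurable_invR.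
  - by move=> nu; rewrite sqr_ge0.
  - by move=> nu; rewrite mulr_ge0 ?sqr_ge0.
  - by move=> nu; rewrite mulr_ge0 ?sqr_ge0.
  - by move=> nu _; rewrite a_sqr invfM [leRHS]mulrA exprVn.
  - move=> nu /eqP; rewrite mulf_eq0 sqrf_eq0 => /orP[] /eqP r0.
      by rewrite a_rho// expr0n mul0r.
    by rewrite r0 invr0 expr0n mulr0.
(* the zero of hat_Phi is the eigenvalue equation *)
have Sv : self_energy a lambda0 = v - lambda0 ^+ 2.
  rewrite (self_energyE l00 l0nu0 da ca' aM a'M az ia) -Re_hat_wplus; last first.
    exact: (L1_memory_density l00 l0nu0 da az ia).
  move: Phiplus_lambda0 => /(congr1 (@complex.Re R)); rewrite /hat_Phiplus /= => /eqP.
  by rewrite subr_eq0 addrC => /eqP ->.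
have [N [mN N0 subN]] : {ae mu, forall nu,
    [/\ forall t, derivable (xi nu) t 1 /\ derivable (derive1 (xi nu)) t 1,
        forall t, rho nu * (derive1 (derive1 (xi nu)) t + nu ^+ 2 * xi nu t) = kappa nu * x t,
        xi nu 0 = xi0 nu & derive1 (xi nu) 0 = dxi0 nu] /\ (rho nu = 0 -> kappa nu ^+ 2 = 0)}.
  have FF : Filter (nbhs (almost_everywhere (@lebesgue_measure R))) by exact: ae_filter_ringOfSetsType.
  by move: hae kappa_ae; apply: filterS2 => nu h1 h2; split.
pose B := ~` N.
have mB : measurable B by exact: measurableC.
have B0 : mu (~` B) = 0 by rewrite setCK.
have good nu : B nu -> [/\ forall t, derivable (xi nu) t 1 /\ derivable (derive1 (xi nu)) t 1,
        forall t, rho nu * (derive1 (derive1 (xi nu)) t + nu ^+ 2 * xi nu t) = kappa nu * x t,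
        xi nu 0 = xi0 nu & derive1 (xi nu) 0 = dxi0 nu] /\ (rho nu = 0 -> kappa nu ^+ 2 = 0).
  by move=> Bn; apply: contrapT => /subN.
have xid nu : B nu -> forall t, derivable (xi nu) t 1 /\ derivable (derive1 (xi nu)) t 1.
  by move=> /good[[]].
have xiode nu : B nu -> forall t,
    rho nu * (derive1 (derive1 (xi nu)) t + nu ^+ 2 * xi nu t) = kappa nu * x t.
  by move=> /good[[]].
have kappa0 nu : B nu -> rho nu = 0 -> kappa nu = 0.
  by move=> /good[_ h] /h/eqP; rewrite sqrf_eq0 => /eqP.
(* conservation of energy bounds position and velocity for all times *)
have xbound t : `|x t| <= 2 * E / (v - K rho kappa) + 1 /\ `|derive1 x t| <= 2 * E + 1.
  have [i1 i2 i3] := efin t.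
  have L2' : L1 setT (fun nu => rho nu * nu ^+ 2 * xi nu t ^+ 2) by constructor.
  have L3' : L1 setT (fun nu => kappa nu * xi nu t) by constructor.
  have L3'' := L1Z (2 * x t) measurableT L3'.
  have L4 := L1Z (x t ^+ 2) measurableT iK.
  apply: (energy_coercive h3 _ _ (eE t)).
    by apply: Rintegral_ge0 => nu _; rewrite mulr_ge0// sqr_ge0.
  have L23 := L1B measurableT L2' L3''.
  have : 0 <= \int[mu]_nu (\1_B nu * (rho nu * nu ^+ 2 * xi nu t ^+ 2
      - 2 * x t * (kappa nu * xi nu t) + x t ^+ 2 * (a nu ^+ 2 * nu^-1 ^+ 2))).
    by apply: Rintegral_ge0 => nu _; exact: potential_square.
  rewrite (Rint_indic_conull mB B0 (L1D measurableT L23 L4)).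
  rewrite (RintD measurableT L23 L4) (RintB measurableT L2' L3'').
  rewrite (RintZl _ measurableT L3') (RintZl _ measurableT iK) => h.
  by apply: (le_trans h); rewrite lerD2l ler_wpM2l ?sqr_ge0.
have may t : measurable_fun setT (fun nu => a nu * weighted rho B xi nu t).
  under eq_fun do rewrite (ahat_weighted xi h1_rho kappa0).
  by apply: measurable_funM => //; exact: L1_measurable (L1I (ikx t)).
have mcy t : measurable_fun setT (fun nu => coupling a lambda0 nu * weighted rho B xi nu t).
  have -> : (fun nu => coupling a lambda0 nu * weighted rho B xi nu t) =
      fun nu => gap_weight nu0 lambda0 nu * (a nu * weighted rho B xi nu t).
    by apply/funext => nu; rewrite (couplingE l00 l0nu0 az) -mulrA mulrCA.
  by apply: measurable_funM => //; exact: measurable_gap_weight.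
(* finite energy of the thermostat at time 0 *)
have Lb : L2 (fun nu => `|nu * weighted rho B xi nu 0|
    + `|weighted rho B (fun nu => derive1 (xi nu)) nu 0|).
  have -> : (fun nu => `|nu * weighted rho B xi nu 0|
    + `|weighted rho B (fun nu => derive1 (xi nu)) nu 0|) =
    fun nu => \1_B nu * (Num.sqrt (rho nu) * (`|nu * xi0 nu| + `|dxi0 nu|)).
    apply/funext => nu; rewrite weighted_amplitude//.
    rewrite indicE; case: (boolP (nu \in B)) => [/set_mem/good[[_ _ -> ->] _]//|_].
    by rewrite !mul0r.
  have m1 : measurable_fun setT (fun nu => Num.sqrt (rho nu) * (`|nu * xi0 nu| + `|dxi0 nu|)).
    apply: measurable_funM.
      by apply: measurableT_comp => //; apply: continuous_measurable_fun; exact: sqrt_continuous.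
    apply: measurable_funD; apply: measurableT_comp => //.
    by apply: measurable_funM => //; exact: measurable_id.
  have L4 : L1 setT (fun nu => rho nu * (dxi0 nu ^+ 2 + nu ^+ 2 * xi0 nu ^+ 2)).
    apply: L1_ge0 => // [|nu _]; last first.
      apply: mulr_ge0; first exact: h1_rho.
      by apply: addr_ge0; [exact: sqr_ge0|apply: mulr_ge0; exact: sqr_ge0].
    apply: measurable_funM => //; apply: measurable_funD; first exact: measurable_funX.
    by apply: measurable_funM; exact: measurable_funX.
  split; first exact: measurable_funM.
  apply: (L1_le _ _ (L1Z 2 _ L4)) => //.
    by apply: measurable_funX; exact: measurable_funM.
  move=> nu _; rewrite ger0_norm ?sqr_ge0// !exprMn sqr_sqrtr//.
  have -> : nu ^+ 2 * xi0 nu ^+ 2 = `|nu * xi0 nu| ^+ 2 by rewrite real_normK ?num_real// exprMn.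
  rewrite -[dxi0 nu ^+ 2]real_normK ?num_real//.
  have := h1_rho nu; move: (rho nu) `|nu * xi0 nu| `|dxi0 nu| => r p q r0.
  have h : r * (p + q) ^+ 2 <= 2 * (r * (q ^+ 2 + p ^+ 2)).
    rewrite [leRHS]mulrCA ler_wpM2l//; have := sqr_ge0 (p - q); lra.
  rewrite indicE; case: (_ \in _); first by rewrite expr1n mul1r.
  by rewrite expr0n/= mul0r (le_trans _ h)// mulr_ge0// sqr_ge0.
have eqx t : derive1 (derive1 x) t = - (v * x t) + \int[mu]_nu (a nu * weighted rho B xi nu t).
  have -> : \int[mu]_nu (a nu * weighted rho B xi nu t) = \int[mu]_nu (kappa nu * xi nu t).
    rewrite -(Rint_indic_conull mB B0 (L1I (ikx t))).
    by apply: eq_Rintegral => nu _; rewrite (ahat_weighted xi h1_rho kappa0).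
  by rewrite -xode addrCA addNr addr0.
have [A [C [th [xE thK thL thp thn]]]] := trapped_mode_decomposition l00 l0nu0 da ca' aM a'M az apos ia mB B0
  (fun t => derivable_isder (xder t).1) (fun t => derivable_isder (xder t).2)
  (fun t => (xbound t).1) (fun t => (xbound t).2)
  (weighted_isder rho xid) (weighted_isder' rho xid) (weighted_ode h1_rho xiode)
  mcy Lb eqx Sv.
exists (A / 2 +i* - (C / 2))%C, (fun t => (th t)%:C%C); split; first exact: in_C0_real.
by move=> t; rewrite -trig_complex -rmorphD -xE.
Qed.
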